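(* Let $a_n^{(\omega)},b_n^{(\omega)}$ be ergodic Jacobi parameters with density of states $\nu$ and Lyapunov exponent $\gamma$, and let $E_0\in\mathbb{R}$ be such that the symmetric derivative of $\nu$ exists at $E_0$ and is finite. Suppose there is Poisson behavior at $E_0$. Then $\gamma(E_0)>0$.
   Context: Ergodic Jacobi parameters: $(\Omega,\rho)$ is a probability space, $T:\Omega\to\Omega$ an ergodic (measure preserving) transformation, $f:\Omega\to(0,\infty)$ and $g:\Omega\to\mathbb{R}$ bounded measurable functions, and $a_n^{(\omega)}=f(T^n\omega)$, $b_n^{(\omega)}=g(T^n\omega)$. For fixed $\omega$, the orthonormal polynomials are defined by $p_{-1}=0$, $p_0=1$, $xp_n=a_{n+1}p_{n+1}+b_{n+1}p_n+a_np_{n-1}$, $n\ge0$. Let $\nu_{n,\omega}$ be the probability measure giving weight $1/n$ to each of the $n$ (real, simple) zeros of $p_n$; it is known that for a.e. $\omega$ it converges weakly to a measure $\nu$ independent of $\omega$ a.e., called the density of states. The symmetric derivative of $\nu$ at $E_0$ is $\lim_{h\downarrow0}\nu((E_0-h,E_0+h))/(2h)$. Transfer matrix: with $a_0\equiv1$, $T(n,E)$ is the $2\times2$ matrix with $\binom{u_{n+1}}{u_n}=T(n,E)\binom{u_1}{u_0}$ for every solution of $a_nu_{n+1}+(b_n-E)u_n+a_{n-1}u_{n-1}=0$, $n\ge1$. The Lyapunov exponent is $\gamma(E)=\lim_{n\to\infty}\frac1n\log\|T(n,E)\|$ (a.e. $\omega$). Poisson behavior at $E_0$ means: for some $\lambda>0$,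 for any $\ell\ge 1$, any reals $\alpha_1<\beta_1\le\alpha_2<\beta_2\le\cdots\le\alpha_\ell<\beta_\ell$ and any $k_1,\dots,k_\ell\in\{0,1,2,\dots\}$, as $n\to\infty$, $$\mathrm{Prob}\Bigl(\#\Bigl\{\text{zeros of }p_n\text{ in }\Bigl[E_0+\frac{\alpha_m}{n},E_0+\frac{\beta_m}{n}\Bigr]\Bigr\}=k_m\text{ for }m=1,\dots,\ell\Bigr)\to\prod_{m=1}^\ell\frac{[\lambda(\beta_m-\alpha_m)]^{k_m}}{k_m!}\,e^{-\lambda(\beta_m-\alpha_m)} .$$ *)

(* Defs.v *)
From HB Require Import structures.
From mathcomp Require Import all_boot all_order all_algebra finmap.
From mathcomp Require Import all_classical all_reals all_analysis.
From mathcomp Require Import ring.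

Set Implicit Arguments.
Unset Strict Implicit.
Unset Printing Implicit Defensive.
Import Order.TTheory GRing.Theory Num.Theory.
Import numFieldNormedType.Exports.
Local Open Scope classical_set_scope.
Local Open Scope ring_scope.

Section Dynamics.
Context d (Omega : measurableType d) (R : realType) (P : probability Omega R).

Definition measure_preserving (T : Omega -> Omega) : Prop :=
  measurable_fun setT T /\
  forall A : set Omega, measurable A -> P (T @^-1` A) = P A.

(* T need not be invertible. *)
Definition ergodic (T : Omega -> Omega) : Prop :=
  measure_preserving T /\
  forall A : set Omega, measurable A -> T @^-1` A = A ->
    P A = 0%E \/ P A = 1%E.

End Dynamics.

Definition jacobi_param (Omega R : Type) (F : Omega -> R) (T : Omega -> Omega)
    (w : Omega) (n : nat) : R :=
  F (iter n T w).

Section Jacobi.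
Context {R : realType}.
Implicit Types (a b u : nat -> R) (E : R).

(* The recursion x p_n = a_{n+1} p_{n+1} + b_{n+1} p_n + a_n p_{n-1} solved for
   p_{n+1}, with p_{-1} = 0; the value of a at index 0 is immaterial.  *)
Fixpoint orthopoly a b (n : nat) : {poly R} :=
  match n with
  | 0 => 1
  | m.+1 => (a m.+1)^-1 *:
      (('X - (b m.+1)%:P) * orthopoly a b m
       - match m with 0 => 0 | m'.+1 => a m *: orthopoly a b m' end)
  end.

Definition zeros (p : {poly R}) : set R := [set x | root p x].

(* fset_set is the underlying finite set for finite sets only; zeros p is
   finite as soon as p != 0, which holds for orthopoly a b n if a > 0. *)
Definition num_zeros (p : {poly R}) (A : set R) : nat :=
  #|` fset_set (zeros p `&` A) |.

Definition zero_measure (p : {poly R}) (n : nat) :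
    {measure set (measurableTypeR R) -> \bar R} :=
  let Z : seq R := fset_set (zeros p) in
  mscale (n%:R^-1)%:nng
    (msum (fun i => \d_(nth 0 Z i : measurableTypeR R)) (size Z)).

Definition weak_cvg (mu_ : nat -> {measure set (measurableTypeR R) -> \bar R})
    (mu : {measure set (measurableTypeR R) -> \bar R}) : Prop :=
  forall h : R -> R, continuous h -> bounded_fun h ->
    (\int[mu_ n]_x (h x)%:E)%E @[n --> \oo] --> (\int[mu]_x (h x)%:E)%E.

Definition is_symmetric_derivative
    (mu : {measure set (measurableTypeR R) -> \bar R}) (x D : R) : Prop :=
  fine (mu `]x - h, x + h[%classic) / (2 * h) @[h --> 0^'+] --> D.

(* The convention a_0 = 1 used in the difference equation only. *)
Definition set_a0 a : nat -> R := fun n => if n is 0 then 1 else a n.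

Definition jacobi_solution a b E u : Prop :=
  forall n, (1 <= n)%N ->
    set_a0 a n * u n.+1 + (b n - E) * u n + set_a0 a n.-1 * u n.-1 = 0.

Definition pair_col (x y : R) : 'cV[R]_2 := \col_i (if i == 0 then x else y).

Definition transfer_step a b E (n : nat) : 'M[R]_2 :=
  \matrix_(i, j)
    if i == 0 then
      (if j == 0 then (E - b n) / set_a0 a n
       else - (set_a0 a n.-1 / set_a0 a n))
    else (if j == 0 then 1 else 0).

Fixpoint transfer_matrix a b E (n : nat) : 'M[R]_2 :=
  if n is m.+1 then transfer_step a b E n *m transfer_matrix a b E m else 1%:M.

Lemma transfer_stepE a b E n x y :
  transfer_step a b E n *m pair_col x y =
  pair_col ((E - b n) / set_a0 a n * x - set_a0 a n.-1 / set_a0 a n * y) x.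
Proof.
apply/colP => i; rewrite !mxE !big_ord_recl big_ord0 !mxE /= addr0.
by case: (i == 0); rewrite ?mul1r ?mul0r ?addr0 // mulNr.
Qed.

Lemma set_a0_neq0 a n : (forall m, 0 < a m) -> set_a0 a n != 0.
Proof. by move=> a0; case: n => [|n] /=; rewrite ?oner_eq0 ?gt_eqF. Qed.

Lemma transfer_matrixE a b E u n : (forall m, 0 < a m) ->
  jacobi_solution a b E u ->
  pair_col (u n.+1) (u n) = transfer_matrix a b E n *m pair_col (u 1%N) (u 0%N).
Proof.
move=> a0 su; elim: n => [|n IH]; first by rewrite mul1mx.
rewrite -mulmxA -IH transfer_stepE; congr pair_col.
have an0 := set_a0_neq0 n.+1 a0.
have := su n.+1 isT; move: an0 => /= an0 /eqP.
rewrite -addrA addr_eq0 => /eqP e; apply: (mulfI an0); rewrite e.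
by field.
Qed.

Lemma pair_colE (v : 'cV[R]_2) : v = pair_col (v 0 0) (v 1 0).
Proof.
apply/colP => i; rewrite mxE; case: eqVneq => [-> //|i0].
by congr (v _ _); apply: val_inj; case: i i0 => [[|[|]]].
Qed.

(* The solution with prescribed u_0 = y and u_1 = x. *)
Lemma jacobi_solution_exists a b E x y : (forall m, 0 < a m) ->
  exists u, [/\ jacobi_solution a b E u, u 1%N = x & u 0%N = y].
Proof.
move=> a0; pose v n := transfer_matrix a b E n *m pair_col x y.
have vE n : v n.+1 = pair_col
    ((E - b n.+1) / a n.+1 * v n 0 0 - set_a0 a n / a n.+1 * v n 1 0) (v n 0 0).
  by rewrite {1}/v /= -mulmxA -/(v n) {1}(pair_colE (v n)) transfer_stepE.
have vS n : v n.+1 1 0 = v n 0 0 by rewrite vE mxE.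
exists (fun n => v n 1 0); split; last 2 first.
- by rewrite vS /v mul1mx mxE.
- by rewrite /v mul1mx mxE.
case=> // n _; rewrite !vS vE mxE /=.
have an0 : a n.+1 != 0 by rewrite gt_eqF.
by field.
Qed.

Lemma transfer_matrix_unique a b E n (M : 'M[R]_2) : (forall m, 0 < a m) ->
  (forall u, jacobi_solution a b E u ->
     pair_col (u n.+1) (u n) = M *m pair_col (u 1%N) (u 0%N)) ->
  M = transfer_matrix a b E n.
Proof.
move=> a0 MP.
have eqMv x y : M *m pair_col x y = transfer_matrix a b E n *m pair_col x y.
  have [u [su <- <-]] := jacobi_solution_exists b E x y a0.
  by rewrite -MP// -transfer_matrixE.
apply/matrixP => i j.
have := eqMv (j == 0)%:R (j != 0)%:R => /colP/(_ i).
rewrite !mxE !big_ord_recl !big_ord0 !mxE /= !addr0.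
case: (eqVneq j 0) => [->|j0] /=; first by rewrite !mulr1 !mulr0 !addr0.
have -> : j = lift ord0 ord0.
  by apply: val_inj; case: j j0 => [[|[|]]].
by rewrite !mulr1 !mulr0 !add0r.
Qed.

Definition euclid_norm (m : nat) (v : 'cV[R]_m) : R :=
  Num.sqrt (\sum_i v i 0 ^+ 2).

Definition op_norm (m n : nat) (M : 'M[R]_(m, n)) : R :=
  sup [set euclid_norm (M *m v) | v in [set v : 'cV[R]_n | euclid_norm v <= 1]].

End Jacobi.

Section ErgodicJacobi.
Context d (Omega : measurableType d) (R : realType) (P : probability Omega R).
Variables (T : Omega -> Omega) (f g : Omega -> R).

Definition ergodic_jacobi : Prop :=
  [/\ ergodic P T,
      measurable_fun setT (f : Omega -> measurableTypeR R),
      measurable_fun setT (g : Omega -> measurableTypeR R),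
      (forall w, 0 < f w) & bounded_fun f /\ bounded_fun g].

Definition erg_orthopoly (w : Omega) (n : nat) : {poly R} :=
  orthopoly (jacobi_param f T w) (jacobi_param g T w) n.

Definition is_density_of_states
    (nu : probability (measurableTypeR R) R) : Prop :=
  {ae P, forall w, weak_cvg (fun n => zero_measure (erg_orthopoly w n) n) nu}.

(* The limit is taken in the extended reals: as f is not assumed to be bounded
   away from 0, it can be +oo. *)
Definition is_lyapunov_exponent (E : R) (gamma : \bar R) : Prop :=
  {ae P, forall w,
    (n%:R^-1 * ln (op_norm
       (transfer_matrix (jacobi_param f T w) (jacobi_param g T w) E n)))%:E
      @[n --> \oo] --> gamma}.

Definition poisson_behavior (E0 : R) : Prop :=
  exists2 lambda : R, 0 < lambda &
  forall (l : nat) (alpha beta : 'I_l -> R) (k : 'I_l -> nat),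
    (1 <= l)%N ->
    (forall m, alpha m < beta m) ->
    (forall m m' : 'I_l, m' = m.+1 :> nat -> beta m <= alpha m') ->
    P [set w | forall m : 'I_l,
        num_zeros (erg_orthopoly w n)
          `[E0 + alpha m / n%:R, E0 + beta m / n%:R]%classic = k m]
      @[n --> \oo] -->
    (\prod_(m < l) ((lambda * (beta m - alpha m)) ^+ k m / (k m)`!%:R
                    * expR (- (lambda * (beta m - alpha m)))))%:E.

End ErgodicJacobi.

(* Main.v *)
Require Import Defs.
From mathcomp Require Import all_boot all_order all_algebra finmap.
From mathcomp Require Import all_classical all_reals all_analysis measurable_realfun.
From mathcomp Require Import complex.
From mathcomp Require Import ring lra.
Set Implicit Arguments.
Unset Strict Implicit.
Unset Printing Implicit Defensive.
Import Order.TTheory GRing.Theory Num.Theory.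
Import numFieldNormedType.Exports.
Local Open Scope classical_set_scope.
Local Open Scope ring_scope.
Import ComplexField.Normc.
Local Open Scope complex_scope.
Local Notation Re := complex.Re.
Local Notation Im := complex.Im.

(** Write z = E0 + i/n and suppose that the Lyapunov exponent at E0 is at most 0.

    The averages of ln (h^2 + (t - E0)^2) over the zeros t of p_K converge to
    twice the logarithmic potential of the density of states at E0 + i h. Half
    of the Thouless formula bounds the limit of this quantity as h tends to 0
    by 2 E[ln f] plus twice the Lyapunov exponent, and finiteness of the
    symmetric derivative lets it grow at most linearly in h
    ([log_potential_linear]). So at height 1/n it exceeds 2 E[ln f] by O(1/n)
    only ([log_intg], where ln f also turns out to be integrable).

    The functions t_k = - a_k p_(k-1)(z) / p_k(z) take values in the upper
    half-plane, and |p_k|^2 Im t_k is multiplied by 1 + (1/n) / Im t_k when k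
    grows by one. Hence the sum of ln (1 + 1 / (n Im t_k)) over k <= K is on
    average at most about K times the excess of the potential, that is O(1/n)
    per site ([log_loss_sum_le]). When the losses on a block of
    n sites and at its ends are bounded, so are the transfer matrices over the
    block ([block_bound]). Averaging over the position of the block and using
    stationarity, the probability that |a_n q_(n-1) p_n|(z) exceeds C is small
    when C is large, uniformly in n ([bad_prob]).

    By the Schwarz-Pick lemma, the m-functions at z and at z + x/n or z - x/n
    are at a hyperbolic distance bounded in terms of x alone. Combined with the
    Wronskian identity, a bound C as above gives |p_n(z)| <= c |p_n(z + x/n)|
    and |p_n(z)| <= c |p_n(z - x/n)|, where c is (x^2 + 2) times a constant
    ([pp_compare]). In terms of the rescaled zeros u = n (t - E0), the sum of
    ln (1 + (u - x)^2) / 2 + ln (1 + (u + x)^2) / 2 - ln (1 + u^2) is at least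
    - O(ln x) with probability close to 1 ([sum_log_diff2_ge]).

    This rigidity contradicts Poisson behavior. For a Poisson process the same
    sum, majorised by a sum over counts in unit cells, has mean O(ln x) but
    fluctuations of order sqrt x, so it lies below any fixed multiple of - ln x
    with probability at least 2^-30 once x is large ([poisson_cells]). *)

(** * Hyperbolic closeness in the upper half-plane *)

Section HalfPlane.
Context {R : realType}.
Implicit Types (u v w z : R[i]) (k c : R).

Lemma normc_sq z : normc z ^+ 2 = Re z ^+ 2 + Im z ^+ 2.
Proof. by case: z => x y /=; rewrite sqr_sqrtr // addr_ge0 // sqr_ge0. Qed.

Lemma normc_ge0 z : 0 <= normc z.
Proof. by case: z => x y /=; exact: sqrtr_ge0. Qed.

Lemma normc_eq0 z : (normc z == 0) = (z == 0).
Proof.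
by apply/eqP/eqP => [/eq0_normc //| ->]; rewrite normc0.
Qed.

Lemma normc_gt0 z : (0 < normc z) = (z != 0).
Proof. by rewrite lt_def normc_ge0 andbT normc_eq0. Qed.

Lemma normc_real (x : R) : normc x%:C = `|x|.
Proof. by rewrite /= expr0n /= addr0 sqrtr_sqr. Qed.

Lemma Im_le_normc z : `|Im z| <= normc z.
Proof.
rewrite -(ler_sqr (normr_ge0 _) (normc_ge0 _)) normc_sq real_normK ?num_real //.
by rewrite lerDr sqr_ge0.
Qed.

Lemma Im_neq0 z : 0 < Im z -> z != 0.
Proof. by apply: contraTneq => ->; rewrite ltxx. Qed.

Lemma Im_inv c u : Im (- (c%:C / u)) = c * Im u / normc u ^+ 2.
Proof.
rewrite normc_sq; case: u => x y; have [->|u0] := eqVneq (x +i* y) 0.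
  by rewrite invr0 mulr0 /= mulr0 mul0r oppr0.
move: u0; rewrite eq_complex /= => u0.
by rewrite /=; ring.
Qed.

Lemma ImD u v : Im (u + v) = Im u + Im v.
Proof. by case: u => x y; case: v => x' y'. Qed.

Lemma ImB_real z (x : R) : Im (z - x%:C) = Im z.
Proof. by case: z => s t /=; rewrite subr0. Qed.

Lemma ImZ_real (x : R) z : Im (x%:C * z) = x * Im z.
Proof. by case: z => s t /=; rewrite mul0r addr0. Qed.

(** In the upper half-plane |u - v|^2 / (Im u Im v) equals 2 (cosh d - 1), where
    d is the hyperbolic distance of u and v; the multiplicative form also makes
    sense on the real axis. The maps used below (sums, inversions, positive
    scalings) do not increase this distance, which replaces the Schwarz-Pick
    lemma for general analytic functions. *)
Definition hclose k u v := normc (u - v) ^+ 2 <= k * (Im u * Im v).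

Lemma hcloseC k u v : hclose k u v -> hclose k v u.
Proof. by rewrite /hclose (mulrC (Im v)) -opprB normcN. Qed.

(** Triangle inequality, then Cauchy-Schwarz: the cross term 2 |u1 - u2| |v1 - v2|
    is absorbed by the mixed products Im u1 Im v2 + Im v1 Im u2. *)
Lemma hcloseD k u1 u2 v1 v2 : 0 <= k ->
  0 <= Im u1 -> 0 <= Im u2 -> 0 <= Im v1 -> 0 <= Im v2 ->
  hclose k u1 u2 -> hclose k v1 v2 -> hclose k (u1 + v1) (u2 + v2).
Proof.
move=> k0 a1 a2 b1 b2; rewrite /hclose !ImD => hu hv.
set X := normc (u1 - u2) in hu; set Y := normc (v1 - v2) in hv.
have X0 : 0 <= X by exact: normc_ge0.
have Y0 : 0 <= Y by exact: normc_ge0.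
have le : normc (u1 + v1 - (u2 + v2)) <= X + Y.
  by rewrite opprD addrACA le_normcD.
have S0 : 0 <= k * (Im u1 * Im v2 + Im v1 * Im u2).
  by rewrite mulr_ge0 // addr_ge0 // mulr_ge0.
have XY : 2 * (X * Y) <= k * (Im u1 * Im v2 + Im v1 * Im u2).
  have XY0 : 0 <= 2 * (X * Y) by rewrite !mulr_ge0.
  rewrite -ler_sqr ?nnegrE //.
  have : X ^+ 2 * Y ^+ 2 <= (k * (Im u1 * Im u2)) * (k * (Im v1 * Im v2)).
    by rewrite ler_pM // sqr_ge0.
  have := mulr_ge0 (sqr_ge0 k) (sqr_ge0 (Im u1 * Im v2 - Im v1 * Im u2)).
  rewrite !exprMn; nra.
apply: (@le_trans _ _ ((X + Y) ^+ 2)).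
  by rewrite ler_sqr ?nnegrE ?normc_ge0 ?addr_ge0.
rewrite sqrrD; nra.
Qed.

(** Both sides are multiplied by c^2 / (|u|^2 |v|^2): u |-> - c / u is a hyperbolic
    isometry for c > 0. *)
Lemma hclose_inv k c u v : 0 <= k -> u != 0 -> v != 0 ->
  hclose k u v -> hclose k (- (c%:C / u)) (- (c%:C / v)).
Proof.
move=> k0 u0 v0; rewrite /hclose !Im_inv => h.
have -> : - (c%:C / u) - - (c%:C / v) = c%:C * (u - v) / (u * v).
  by field; rewrite u0 v0.
have nu : normc u != 0 by rewrite normc_eq0.
have nv : normc v != 0 by rewrite normc_eq0.
rewrite !(normcM, normcV) normc_real !exprMn exprVn exprMn.
rewrite real_normK ?num_real //.
have -> : k * (c * Im u / normc u ^+ 2 * (c * Im v / normc v ^+ 2)) =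
   c ^+ 2 * (k * (Im u * Im v)) / (normc u ^+ 2 * normc v ^+ 2).
  by field; rewrite nu nv.
have n0 : 0 <= (normc u ^+ 2 * normc v ^+ 2)^-1.
  by rewrite invr_ge0 mulr_ge0 // sqr_ge0.
rewrite ler_wpM2r //.
by rewrite ler_wpM2l ?sqr_ge0.
Qed.

Lemma hcloseZ k c u v : hclose k u v -> hclose k (c%:C * u) (c%:C * v).
Proof.
rewrite /hclose -mulrBr normcM normc_real !ImZ_real exprMn real_normK ?num_real //.
move=> h; have := ler_wpM2l (sqr_ge0 c) h; congr (_ <= _); ring.
Qed.

(** Follows from (|u| - |v|)^2 <= |u - v|^2 <= k |u| |v|. *)
Lemma hclose_norm k u v : 0 <= k -> hclose k u v ->
  normc u <= (k + 2) * normc v.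
Proof.
rewrite /hclose => k0 h.
have u0 := normc_ge0 u; have v0 := normc_ge0 v.
have le : (normc u - normc v) ^+ 2 <= normc (u - v) ^+ 2.
  rewrite -[leLHS]real_normK ?num_real // ler_sqr ?nnegrE ?normr_ge0 ?normc_ge0 //.
  have h1 : normc u <= normc (u - v) + normc v.
    by apply: le_trans (le_normcD _ _); rewrite subrK.
  have h2 : normc v <= normc (u - v) + normc u.
    by have := le_normcD (v - u) u; rewrite subrK -(normcN (v - u)) opprB.
  by rewrite ler_norml; apply/andP; split; lra.
have le2 : k * (Im u * Im v) <= k * (normc u * normc v).
  rewrite ler_wpM2l //; apply: le_trans (ler_norm _) _.
  by rewrite normrM ler_pM // Im_le_normc.
have le3 : normc u * normc u <= normc u * ((k + 2) * normc v).
  have := sqr_ge0 (normc v); nra.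
move: u0; rewrite le_eqVlt => /orP[/eqP <-|u0].
  by rewrite mulr_ge0 // addr_ge0.
by rewrite -(ler_pM2l u0).
Qed.

End HalfPlane.

(** * Solutions of the Jacobi recursion and their m-functions *)

Section JacobiPair.
Context {R : realType}.
Implicit Types (a b : nat -> R) (z : R[i]) (v : R[i] * R[i]).

Definition shift (k : nat) (a : nat -> R) : nat -> R := fun n => a (n + k)%N.

(** The state is the pair (u_n, a_n u_(n-1)): with the factor a_n in its second
    component, a step involves the parameters of index n + 1 only and has
    determinant 1. *)
Fixpoint jacobi_iter a b z v (n : nat) : R[i] * R[i] :=
  if n is m.+1 then
    let u := jacobi_iter a b z v m in
    (((z - (b n)%:C) * u.1 - u.2) / (a n)%:C, (a n)%:C * u.1)
  else v.

(** The polynomials p_n of the first kind start from the state (1, 0), the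
    polynomials q_n of the second kind from (0, -1). The names [pp], [qq] are for
    the value at n, and [pm], [qm] for a_n times the value at n - 1. *)
Definition pp a b z n := (jacobi_iter a b z (1, 0) n).1.
Definition pm a b z n := (jacobi_iter a b z (1, 0) n).2.
Definition qq a b z n := (jacobi_iter a b z (0, -1) n).1.
Definition qm a b z n := (jacobi_iter a b z (0, -1) n).2.

Lemma pp0 a b z : pp a b z 0 = 1. Proof. by []. Qed.
Lemma pm0 a b z : pm a b z 0 = 0. Proof. by []. Qed.
Lemma qq0 a b z : qq a b z 0 = 0. Proof. by []. Qed.
Lemma qm0 a b z : qm a b z 0 = -1. Proof. by []. Qed.

Lemma ppS a b z n :
  pp a b z n.+1 = ((z - (b n.+1)%:C) * pp a b z n - pm a b z n) / (a n.+1)%:C.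
Proof. by []. Qed.

Lemma pmS a b z n : pm a b z n.+1 = (a n.+1)%:C * pp a b z n.
Proof. by []. Qed.

Lemma qqS a b z n :
  qq a b z n.+1 = ((z - (b n.+1)%:C) * qq a b z n - qm a b z n) / (a n.+1)%:C.
Proof. by []. Qed.

Lemma qmS a b z n : qm a b z n.+1 = (a n.+1)%:C * qq a b z n.
Proof. by []. Qed.

Lemma jacobi_iter_add a b z v k j :
  jacobi_iter a b z v (k + j) = jacobi_iter (shift j a) (shift j b) z (jacobi_iter a b z v j) k.
Proof. by elim: k => //= k ->. Qed.

Lemma jacobi_iter_lin a b z v k :
  jacobi_iter a b z v k = (v.1 * pp a b z k - v.2 * qq a b z k,
                   v.1 * pm a b z k - v.2 * qm a b z k).
Proof.
elim: k => [|k IH] /=.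
  by rewrite /pp /pm /qq /qm /= !mulr1 !mulr0 subr0 mulrN1 opprK add0r; case: v.
rewrite IH ppS pmS qqS qmS /=; congr (_, _); ring.
Qed.

Lemma pp_add a b z k j : pp a b z (k + j) =
  pp a b z j * pp (shift j a) (shift j b) z k
  - pm a b z j * qq (shift j a) (shift j b) z k.
Proof. by rewrite /pp jacobi_iter_add jacobi_iter_lin. Qed.

Lemma pm_add a b z k j : pm a b z (k + j) =
  pp a b z j * pm (shift j a) (shift j b) z k
  - pm a b z j * qm (shift j a) (shift j b) z k.
Proof. by rewrite /pm jacobi_iter_add jacobi_iter_lin. Qed.

Lemma qq_add a b z k j : qq a b z (k + j) =
  qq a b z j * pp (shift j a) (shift j b) z k
  - qm a b z j * qq (shift j a) (shift j b) z k.
Proof. by rewrite /qq jacobi_iter_add jacobi_iter_lin. Qed.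

Lemma realC_neq0 (x : R) : 0 < x -> x%:C != 0 :> R[i].
Proof. by move=> x0; rewrite eq_complex /= eqxx andbT gt_eqF. Qed.

(** Every step of the recursion has determinant 1. *)
Lemma wronskian a b z n : (forall m, 0 < a m) ->
  pp a b z n * qm a b z n - pm a b z n * qq a b z n = -1.
Proof.
move=> a0; elim: n => [|n IH]; first by rewrite /pp /pm /qq /qm /=; ring.
rewrite ppS pmS qqS qmS -IH.
by field; exact: realC_neq0.
Qed.

(** The Weyl m-functions of the sites 1, ..., n seen from their right end (up to
    the factor a_n^2) and from their left end. *)
Definition m_right a b z n := - (pm a b z n / pp a b z n).
Definition m_left a b z n := - (qq a b z n / pp a b z n).

Lemma shift_gt0 k a : (forall m, 0 < a m) -> forall m, 0 < shift k a m.
Proof. by move=> a0 m; exact: a0. Qed.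

Section upper.
Variables (a b : nat -> R) (z : R[i]).
Hypotheses (a0 : forall m, 0 < a m) (z0 : 0 < Im z).

Lemma riccati_denom_gt0 n : 0 <= Im (m_right a b z n) -> 0 < Im (z - (b n.+1)%:C + m_right a b z n).
Proof. by move=> h; rewrite ImD ImB_real; apply: ltr_wpDr. Qed.

Lemma ppS_m_right n : pp a b z n != 0 ->
  pp a b z n.+1 = pp a b z n * (z - (b n.+1)%:C + m_right a b z n) / (a n.+1)%:C.
Proof.
move=> p0; rewrite ppS /m_right; congr (_ / _); field.
exact: p0.
Qed.

(** Nonvanishing of p_n in the upper half-plane and positivity of the m-function
    are proved together: each Riccati step needs both. *)
Lemma pp_neq0_m_right_ge0 n : pp a b z n != 0 /\ 0 <= Im (m_right a b z n).
Proof.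
elim: n => [|n [p0 t0]].
  rewrite /m_right; have [-> ->] : pp a b z 0 = 1 /\ pm a b z 0 = 0 by [].
  by rewrite mul0r oppr0 oner_neq0.
have r0 := Im_neq0 (riccati_denom_gt0 t0).
have p1 : pp a b z n.+1 != 0.
  by rewrite ppS_m_right // !mulf_neq0 ?invr_eq0 ?realC_neq0.
split => //; rewrite /m_right pmS ppS_m_right //.
have -> : (a n.+1)%:C * pp a b z n /
   (pp a b z n * (z - (b n.+1)%:C + m_right a b z n) / (a n.+1)%:C) =
   (a n.+1 ^+ 2)%:C / (z - (b n.+1)%:C + m_right a b z n).
  by rewrite rmorphXn /=; field; rewrite p0 r0 realC_neq0.
rewrite Im_inv divr_ge0 ?sqr_ge0 // mulr_ge0 ?sqr_ge0 //.
exact/ltW/riccati_denom_gt0.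
Qed.

Lemma pp_neq0 n : pp a b z n != 0. Proof. by case: (pp_neq0_m_right_ge0 n). Qed.
Lemma m_right_ge0 n : 0 <= Im (m_right a b z n). Proof. by case: (pp_neq0_m_right_ge0 n). Qed.

Lemma riccati_denom_neq0 n : z - (b n.+1)%:C + m_right a b z n != 0.
Proof. exact/Im_neq0/riccati_denom_gt0/m_right_ge0. Qed.

Lemma m_rightS n :
  m_right a b z n.+1 = - ((a n.+1 ^+ 2)%:C / (z - (b n.+1)%:C + m_right a b z n)).
Proof.
rewrite {1}/m_right pmS ppS_m_right ?pp_neq0 // rmorphXn /=; field.
by rewrite pp_neq0 riccati_denom_neq0 realC_neq0.
Qed.

Lemma m_rightS_gt0 n : 0 < Im (m_right a b z n.+1).
Proof.
rewrite m_rightS Im_inv divr_gt0 // ?mulr_gt0 ?exprn_gt0 // ?normc_gt0 ?riccati_denom_neq0 //.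
exact/riccati_denom_gt0/m_right_ge0.
Qed.

End upper.

(** Here the first site is split off rather than the last one, hence the shifted
    parameters. *)
Lemma m_leftS a b z n : (forall m, 0 < a m) -> 0 < Im z ->
  0 <= Im (m_left (shift 1 a) (shift 1 b) z n) ->
  m_left a b z n.+1 = - (1%:C / (z - (b 1%N)%:C +
    (a 1%N ^+ 2)%:C * m_left (shift 1 a) (shift 1 b) z n)).
Proof.
move=> a0 z0 f0.
have p0 := pp_neq0 (shift 1 b) (shift_gt0 1 a0) z0 n.
have a1 : (a 1%N)%:C != 0 by exact: realC_neq0.
have d0 : z - (b 1%N)%:C + (a 1%N ^+ 2)%:C * m_left (shift 1 a) (shift 1 b) z n != 0.
  apply: Im_neq0; rewrite ImD ImB_real ImZ_real ltr_wpDr // mulr_ge0 //.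
  exact: sqr_ge0.
have p1 := pp_neq0 b a0 z0 (n + 1).
rewrite -addn1 {1}/m_left.
rewrite pp_add qq_add in p1 *.
rewrite /pp /pm /qq /qm /= in p1 *.
rewrite -/(pp _ _ _ _) -/(qq _ _ _ _) in p0 p1 *.
move: d0; rewrite /m_left rmorphXn /=.
move: p0 p1 a1.
set p := pp _ _ _ _; set q := qq _ _ _ _; set A := (a 1%N)%:C; set B := z - _.
clearbody p q A B => p0 p1 A0 d0; field; rewrite p0 A0 andbT /=.
by apply: contra_neq d0 => e; apply: (mulfI p0); rewrite mulr0 -e; field.
Qed.

Lemma m_left_ge0 a b z n : (forall m, 0 < a m) -> 0 < Im z ->
  0 <= Im (m_left a b z n).
Proof.
move=> a0 z0; elim: n a b a0 => [|n IH] a b a0.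
  by rewrite /m_left qq0 mul0r oppr0.
rewrite m_leftS ?IH //; last exact: shift_gt0.
rewrite Im_inv mul1r divr_ge0 ?sqr_ge0 // ImD ImB_real ImZ_real.
apply: addr_ge0; first exact: ltW.
by apply: mulr_ge0; [exact: sqr_ge0|apply: IH; exact: shift_gt0].
Qed.

(** Schwarz-Pick for the m-function: each step of the Riccati recursion adds
    z - b_n and inverts, and both operations keep points [hclose] with the same
    constant. *)
Lemma hclose_m_right k a b z1 z2 n : (forall m, 0 < a m) -> 0 < Im z1 ->
  0 < Im z2 -> 0 <= k -> hclose k z1 z2 -> hclose k (m_right a b z1 n) (m_right a b z2 n).
Proof.
move=> a0 h1 h2 k0 hz; elim: n => [|n IH].
  rewrite /m_right !pm0 !mul0r oppr0.
  by rewrite /hclose subrr normc0 expr0n /= !mulr0.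
rewrite !m_rightS //; apply: hclose_inv; rewrite ?riccati_denom_neq0 //.
apply: hcloseD; rewrite ?ImB_real ?(ltW h1) ?(ltW h2) ?m_right_ge0 //.
by rewrite /hclose !ImB_real opprB addrA subrK.
Qed.

Lemma hclose_m_left k a b z1 z2 n : (forall m, 0 < a m) -> 0 < Im z1 ->
  0 < Im z2 -> 0 <= k -> hclose k z1 z2 -> hclose k (m_left a b z1 n) (m_left a b z2 n).
Proof.
move=> a0 h1 h2 k0 hz; elim: n a b a0 => [|n IH] a b a0.
  rewrite /m_left !qq0 !mul0r oppr0.
  by rewrite /hclose subrr normc0 expr0n /= !mulr0.
have f1 := m_left_ge0 (shift 1 b) n (shift_gt0 1 a0) h1.
have f2 := m_left_ge0 (shift 1 b) n (shift_gt0 1 a0) h2.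
rewrite !m_leftS //; apply: hclose_inv => //.
- by apply: Im_neq0; rewrite ImD ImB_real ImZ_real ltr_wpDr // mulr_ge0 // sqr_ge0.
- by apply: Im_neq0; rewrite ImD ImB_real ImZ_real ltr_wpDr // mulr_ge0 // sqr_ge0.
apply: hcloseD; rewrite ?ImB_real ?ImZ_real ?(ltW h1) ?(ltW h2) //.
- by rewrite mulr_ge0 // sqr_ge0.
- by rewrite mulr_ge0 // sqr_ge0.
- by rewrite /hclose !ImB_real opprB addrA subrK.
by apply: hcloseZ; apply: IH; exact: shift_gt0.
Qed.

(** By the Wronskian identity, 1 / (p_n a_n p_(n-1)) is the difference of two
    consecutive left m-functions. So a bound on the q p products at z1 carries
    over, through the m-functions, to a comparison of |p_n p_(n-1)| at z1 and z2.
    The ratio p_(n-1) / p_n is a right m-function and is comparable as well;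
    multiplying the two estimates cancels p_(n-1) and leaves |p_n|^2. *)
Lemma pp_compare k C a b z1 z2 n : (forall m, 0 < a m) -> 0 < Im z1 ->
  0 < Im z2 -> 0 <= k -> hclose k z1 z2 ->
  normc (qm a b z1 n.+1) * normc (pp a b z1 n.+1) <= C ->
  normc (pp a b z1 n.+1) ^+ 2 <=
    (k + 2) ^+ 2 * (2 * C + 1) * normc (pp a b z2 n.+1) ^+ 2.
Proof.
move=> a0 h1 h2 k0 hz hC.
have P1 := pp_neq0 b a0 h1 n.+1; have P2 := pp_neq0 b a0 h2 n.+1.
have P1' := pp_neq0 b a0 h1 n; have P2' := pp_neq0 b a0 h2 n.
have A0 : (a n.+1)%:C != 0 :> R[i] by exact: realC_neq0.
have M1 : pm a b z1 n.+1 != 0 by rewrite pmS mulf_neq0.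
have M2 : pm a b z2 n.+1 != 0 by rewrite pmS mulf_neq0.
have key z : pp a b z n != 0 -> pp a b z n.+1 != 0 ->
    1 / (pp a b z n.+1 * pm a b z n.+1) = m_left a b z n - m_left a b z n.+1.
  move=> e1 e2; rewrite /m_left -[1]opprK -(wronskian b z n.+1 a0) pmS qmS.
  by field; rewrite e1 e2.
have ffm z : pp a b z n != 0 -> m_left a b z n = - (qm a b z n.+1 / pm a b z n.+1).
  by move=> e1; rewrite /m_left pmS qmS; field; rewrite e1.
have F1 := hclose_norm k0 (hclose_m_left b n a0 h2 h1 k0 (hcloseC hz)).
have F2 := hclose_norm k0 (hclose_m_left b n.+1 a0 h2 h1 k0 (hcloseC hz)).
have F3 := hclose_norm k0 (hclose_m_right b n.+1 a0 h2 h1 k0 (hcloseC hz)).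
have W : normc (pm a b z1 n.+1) * normc (qq a b z1 n.+1) <= C + 1.
  rewrite -normcM.
  have -> : pm a b z1 n.+1 * qq a b z1 n.+1 =
     qm a b z1 n.+1 * pp a b z1 n.+1 + 1%:C.
    by rewrite -[1%:C]opprK -(wronskian b z1 n.+1 a0); ring.
  apply: le_trans (le_normcD _ _) _.
  by rewrite normcM normc_real normr1 lerD2r.
have G : normc (1 / (pp a b z2 n.+1 * pm a b z2 n.+1)) <=
    (k + 2) * (normc (m_left a b z1 n) + normc (m_left a b z1 n.+1)).
  rewrite key //; apply: le_trans (le_normcD _ _) _.
  by rewrite (normcN (m_left _ _ _ n.+1)) mulrDr; exact: lerD.
rewrite /m_left /m_right in F3 *; move: hC W P1 P2 M1 M2 G F3; rewrite ffm // /m_left /m_right.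
have rp0 := mulr_ge0 (normc_ge0 (qm a b z1 n.+1)) (normc_ge0 (pp a b z1 n.+1)).
move: rp0; move: (pp a b z1 n.+1) (pp a b z2 n.+1) (pm a b z1 n.+1)
  (pm a b z2 n.+1) (qq a b z1 n.+1) (qm a b z1 n.+1) => P1 P2 M1 M2 Q1 Q2 rp0 hC W.
rewrite !normcN !(normcM, normcV) normc1 -!normc_gt0.
move: rp0 hC W; move: (normc P1) (normc P2) (normc M1) (normc M2) (normc Q1) (normc Q2).
move=> p1 p2 m1 m2 q r rp0 hC W.
move=> p1_0 p2_0 m1_0 m2_0 G H.
have {}G : p1 * m1 <= (k + 2) * (2 * C + 1) * (p2 * m2).
  have e : (k + 2) * (r / m1 + q / p1) = (k + 2) * (r * p1 + m1 * q) / (p1 * m1).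
    by field; rewrite !gt_eqF.
  move: G; rewrite e ler_pdivlMr ?mulr_gt0 // mul1r mulrC.
  rewrite ler_pdivrMr ?mulr_gt0 // => G; apply: (le_trans G).
  apply: ler_wpM2r; first by rewrite mulr_ge0 ?ltW.
  by apply: ler_wpM2l; [exact: addr_ge0|lra].
have {}H : m2 * p1 <= (k + 2) * (m1 * p2).
  move: H; rewrite ler_pdivrMr // => H; apply: le_trans (ler_wpM2r (ltW p1_0) H) _.
  by rewrite le_eqVlt; apply/orP; left; apply/eqP; field; rewrite gt_eqF.
have C0 : 0 <= 2 * C + 1 by lra.
have GH := ler_pM (mulr_ge0 (ltW p1_0) (ltW m1_0)) (mulr_ge0 (ltW m2_0) (ltW p1_0)) G H.
rewrite -(ler_pM2r (mulr_gt0 m1_0 m2_0)).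
by move: GH; congr (_ <= _); ring.
Qed.

Section block.
Variables (a b : nat -> R) (z : R[i]).
Hypotheses (a0 : forall m, 0 < a m) (z0 : 0 < Im z).
Local Notation t := (m_right a b z).
Local Notation p := (pp a b z).

(** Up to a factor, |p_k|^2 Im t_k is the Wronskian of p and its complex
    conjugate, which gains |p_k|^2 Im z at each site. *)
Lemma pp_m_right_step k :
  normc (p k.+1) ^+ 2 * Im (t k.+1) = normc (p k) ^+ 2 * (Im z + Im (t k)).
Proof.
rewrite ppS_m_right ?pp_neq0 // m_rightS // Im_inv ImD ImB_real.
have := riccati_denom_neq0 b a0 z0 k; rewrite -normc_eq0.
rewrite !(normcM, normcV) normc_real gtr0_norm // => r0.
by field; rewrite r0 gt_eqF.
Qed.

Lemma m_right_step_norm k :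
  normc (t k.+1) ^+ 2 * (Im z + Im (t k)) = a k.+1 ^+ 2 * Im (t k.+1).
Proof.
rewrite m_rightS // Im_inv ImD ImB_real normcN.
have := riccati_denom_neq0 b a0 z0 k; rewrite -normc_eq0.
rewrite !(normcM, normcV) normc_real gtr0_norm ?exprn_gt0 // => r0.
by field.
Qed.

Lemma pp_block j n :
  normc (p (n + j.+1)) ^+ 2 * Im (t (n + j.+1)) =
  normc (p j.+1) ^+ 2 * Im (t j.+1) * \prod_(i < n) (1 + Im z / Im (t (i + j.+1))).
Proof.
elim: n => [|n IH]; first by rewrite big_ord0 mulr1.
rewrite addSn pp_m_right_step big_ord_recr /= mulrA -IH addnS.
have t0 := m_rightS_gt0 b a0 z0 (n + j).
by field; rewrite gt_eqF.
Qed.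

(** Since u + w v = v (w + w') with w' = u / v in the upper half-plane, the
    imaginary parts of w and w' cannot cancel. *)
Lemma le_normc_cone (u v w : R[i]) : u != 0 -> 0 <= Im (- (v / u)) -> 0 <= Im w ->
  normc v * Im w <= normc (u + w * v).
Proof.
move=> u0 h w0; have [->|v0] := eqVneq v 0.
  by rewrite normc0 mul0r normc_ge0.
have -> : u + w * v = v * (- (1%:C / (- (v / u))) + w).
  by field; rewrite ?oppr_eq0 v0 u0.
rewrite normcM ler_wpM2l ?normc_ge0 //.
apply: le_trans (Im_le_normc _); rewrite ImD Im_inv mul1r.
rewrite ger0_norm; last by rewrite addr_ge0 // divr_ge0 // sqr_ge0.
by rewrite lerDr divr_ge0 // sqr_ge0.
Qed.

(** The solution p, restarted at the left end of the block and divided by its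
    value there, is p' + t q' for the solutions p', q' of the shifted
    recursion. By [le_normc_cone] nothing cancels in this sum, so its size bounds
    q', the corresponding entry q'_m, and then p'. The size itself is known:
    [pp_block] gives its growth, at most D, in terms of |p|^2 Im t, and the
    hypotheses on |t| / Im t compare the two components at either end. *)
Lemma block_bound j n (D S : R) : 0 <= D -> 0 <= S ->
  \prod_(i < n.+1) (1 + Im z / Im (t (i + j.+1))) <= D ->
  normc (t j.+1) <= S * Im (t j.+1) ->
  normc (t (n.+1 + j.+1)) <= S * Im (t (n.+1 + j.+1)) ->
  normc (qm (shift j.+1 a) (shift j.+1 b) z n.+1) *
  normc (pp (shift j.+1 a) (shift j.+1 b) z n.+1) <= D * S * (1 + S).
Proof.
move=> D0 S0 hD h1 h2.
set a' := shift _ a; set b' := shift _ b.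
have a0' : forall m, 0 < a' m by exact: shift_gt0.
have pj := pp_neq0 b a0 z0 j.+1.
have wp := m_rightS_gt0 b a0 z0 j.
have mp : 0 < Im (t (n.+1 + j.+1)) by rewrite addSn; exact: m_rightS_gt0.
have E1 : pp a b z (n.+1 + j.+1) =
    pp a b z j.+1 * (pp a' b' z n.+1 + t j.+1 * qq a' b' z n.+1).
  by rewrite pp_add -/a' -/b' /m_right; field.
have E2 : pm a b z (n.+1 + j.+1) =
    pp a b z j.+1 * (pm a' b' z n.+1 + t j.+1 * qm a' b' z n.+1).
  by rewrite pm_add -/a' -/b' /m_right; field.
have pn := pp_neq0 b a0 z0 (n.+1 + j.+1).
have E3 : normc (pm a b z (n.+1 + j.+1)) =
   normc (t (n.+1 + j.+1)) * normc (pp a b z (n.+1 + j.+1)).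
  by rewrite -normcM /m_right mulNr normcN divfK.
have B := pp_block j n.+1.
have Q1 : normc (qq a' b' z n.+1) * Im (t j.+1) <=
    normc (pp a' b' z n.+1 + t j.+1 * qq a' b' z n.+1).
  by apply: le_normc_cone; [exact: pp_neq0|exact: m_left_ge0|exact: ltW].
have Q2 : normc (qm a' b' z n.+1) * Im (t j.+1) <=
    normc (pm a' b' z n.+1 + t j.+1 * qm a' b' z n.+1).
  have -> : pm a' b' z n.+1 + t j.+1 * qm a' b' z n.+1 =
      (a' n.+1)%:C * (pp a' b' z n + t j.+1 * qq a' b' z n).
    by rewrite pmS qmS; ring.
  rewrite qmS !normcM -mulrA ler_wpM2l ?normc_ge0 //.
  by apply: le_normc_cone; [exact: pp_neq0|exact: m_left_ge0|exact: ltW].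
have P : normc (pp a' b' z n.+1) <= normc (pp a' b' z n.+1 + t j.+1 * qq a' b' z n.+1)
   + normc (t j.+1) * normc (qq a' b' z n.+1).
  rewrite -normcM -[X in _ <= _ + X]normcN.
  by apply: le_trans (le_normcD _ _); rewrite addrK.
move: B E3 pj pn; rewrite {}E1 {}E2 -!normc_gt0.
move: h1 h2 Q1 Q2 P wp mp.
have Pi0 := hD; move: (\prod_(i < _) _) hD {Pi0} => Pi hD.
move: (pp a b z j.+1) (pp a' b' z n.+1) (qq a' b' z n.+1) (pm a' b' z n.+1)
  (qm a' b' z n.+1) (t j.+1) (t (n.+1 + j.+1)) => Pj X Q Y Z W W'.
rewrite !(normcM Pj).
move: (normc_ge0 (X + W * Q)) (normc_ge0 Q) (normc_ge0 Z) (normc_ge0 X).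
move: (normc (X + _)) (normc (Y + _)) (normc Q) (normc Z) (normc X) (normc Pj)
  (normc W) (normc W') (Im W) (Im W').
move=> N1 N2 q r x pj Tw Tm w w' N10 q0 r0 x0 h1 h2 Q1 Q2 P wp mp B E3 pj0 pN0.
have {}E3 : N2 = Tm * N1.
  by apply: (mulfI (lt0r_neq0 pj0)); rewrite E3; ring.
have {}B : N1 ^+ 2 * w' = w * Pi.
  apply: (mulfI (lt0r_neq0 (exprn_gt0 2 pj0))).
  by rewrite mulrA -exprMn B; ring.
have hx : x <= N1 * (1 + S).
  apply: le_trans P _; rewrite mulrDr mulr1 lerD2l.
  apply: le_trans (_ : S * (q * w) <= _).
    by rewrite mulrCA mulrC ler_wpM2l.
  by rewrite mulrC ler_wpM2r.
have hr : r * w <= S * w' * N1.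
  by apply: (le_trans Q2); rewrite E3 ler_wpM2r.
have h : w * (r * x) <= w * (Pi * S * (1 + S)).
  have := ler_pM (mulr_ge0 r0 (ltW wp)) x0 hr hx; congr (_ <= _); first by ring.
  by transitivity (N1 ^+ 2 * w' * (S * (1 + S))); [|rewrite B]; ring.
rewrite ler_pM2l // in h; apply: (le_trans h).
by apply: ler_wpM2r; [exact: addr_ge0|exact: ler_wpM2r].
Qed.

Lemma m_right_norm_le k (M S : R) : 0 <= S -> 0 <= M -> a k.+1 <= M ->
  1 <= S * Im (t k) -> 1 <= S * Im (t k.+1) ->
  normc (t k.+1) <= (M * S) * Im (t k.+1).
Proof.
move=> S0 M0 aM h1 h2.
have t1 := m_rightS_gt0 b a0 z0 k; have t0 := m_right_ge0 b a0 z0 k.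
have E := m_right_step_norm k.
rewrite -ler_sqr ?nnegrE ?normc_ge0 ?mulr_ge0 ?(ltW t1) //.
have t0' : 0 < Im (t k).
  by rewrite lt_def t0 andbT; apply: contraTneq h1 => ->; rewrite mulr0 ler10.
have n0 := sqr_ge0 (normc (t k.+1)).
have hA : normc (t k.+1) ^+ 2 * Im (t k) <= M ^+ 2 * Im (t k.+1).
  apply: (@le_trans _ _ (normc (t k.+1) ^+ 2 * (Im z + Im (t k)))).
    by rewrite ler_wpM2l // lerDr ltW.
  by rewrite E ler_wpM2r ?(ltW t1) // ler_sqr ?nnegrE ?(ltW (a0 _)).
rewrite -(ler_pM2r t0'); apply: (le_trans hA).
have -> : (M * S * Im (t k.+1)) ^+ 2 * Im (t k) =
  M ^+ 2 * Im (t k.+1) * ((S * Im (t k.+1)) * (S * Im (t k))) by ring.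
rewrite ler_peMr ?mulr_ge0 ?sqr_ge0 ?(ltW t1) //.
by rewrite -[1]mulr1 ler_pM.
Qed.

(** This bounds the boundary term when the product of the growth factors is
    telescoped from the first site on. *)
Lemma Im_m_right_le k : Im z * Im (t k.+1) <= a k.+1 ^+ 2.
Proof.
have t1 := m_rightS_gt0 b a0 z0 k; have t0 := m_right_ge0 b a0 z0 k.
have E := m_right_step_norm k.
rewrite -(ler_pM2r t1) -E -mulrA -expr2 mulrC.
have h : Im (t k.+1) ^+ 2 <= normc (t k.+1) ^+ 2.
  rewrite ler_sqr ?nnegrE ?normc_ge0 ?(ltW t1) //.
  by apply: le_trans (Im_le_normc _); exact: ler_norm.
by apply: ler_pM => //; [exact: sqr_ge0|exact: ltW|rewrite lerDl].
Qed.

Lemma prod_block_le K :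
  Im z ^+ 2 * \prod_(i < K) (1 + Im z / Im (t (i + 1))) <=
  normc (p K.+1) ^+ 2 * a K.+1 ^+ 2.
Proof.
have := pp_block 0 K; rewrite addn1 (pp_m_right_step 0).
rewrite pp0 normc1 expr1n mul1r.
rewrite (_ : t 0 = 0); last by rewrite /m_right pm0 mul0r oppr0.
rewrite [Im 0]/= addr0 => B.
rewrite expr2 -mulrA -B mulrCA ler_wpM2l ?sqr_ge0 //.
exact: Im_m_right_le.
Qed.

End block.
End JacobiPair.

(** * Zeros of the orthonormal polynomials *)

Section Zeros.
Context {R : realType}.
Implicit Types (a b : nat -> R) (z : R[i]).

Lemma orthopolySS a b n : orthopoly a b n.+2 = (a n.+2)^-1 *:
  (('X - (b n.+2)%:P) * orthopoly a b n.+1 - a n.+1 *: orthopoly a b n).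
Proof. by []. Qed.

Lemma horner_orthopoly a b z n :
  (map_poly (real_complex R) (orthopoly a b n)).[z] = pp a b z n /\
  (map_poly (real_complex R) (orthopoly a b n.+1)).[z] = pp a b z n.+1.
Proof.
elim: n => [|n [IH1 IH2]].
  rewrite ppS pp0 pm0 subr0 /= subr0 !rmorph1 hornerC.
  rewrite linearZ /= hornerZ rmorphM /= rmorph1 rmorphB /= map_polyX map_polyC.
  by rewrite !hornerE fmorphV /= mulr1 mulrC.
split => //; rewrite ppS pmS -IH1 -IH2 orthopolySS.
move: (orthopoly a b n) (orthopoly a b n.+1) => o0 o1.
rewrite linearZ /= hornerZ rmorphB /= rmorphM /= rmorphB /= map_polyX map_polyC.
by rewrite linearZ /= !(hornerD, hornerN, hornerM, hornerZ, hornerX, hornerC) fmorphV mulrC.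
Qed.

Lemma orthopolyE a b z n :
  (map_poly (real_complex R) (orthopoly a b n)).[z] = pp a b z n.
Proof. by case: (horner_orthopoly a b z n). Qed.

Lemma size_lead_orthopoly a b n : (forall m, 0 < a m) ->
  size (orthopoly a b n) = n.+1 /\
  lead_coef (orthopoly a b n) = (\prod_(i < n) a i.+1)^-1.
Proof.
move=> a0.
suff: (size (orthopoly a b n) = n.+1 /\
  lead_coef (orthopoly a b n) = (\prod_(i < n) a i.+1)^-1) /\
  (size (orthopoly a b n.+1) = n.+2 /\
  lead_coef (orthopoly a b n.+1) = (\prod_(i < n.+1) a i.+1)^-1) by case.
have an m : (a m)^-1 != 0 by rewrite invr_eq0 gt_eqF.
elim: n => [|n [[s1 l1] [s2 l2]]].
  rewrite /= subr0 mulr1 size_scale // size_XsubC lead_coefZ lead_coefXsubC.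
  rewrite size_poly1 lead_coef1 big_ord0 invr1 big_ord1 mulr1.
  by split.
split => //; rewrite orthopolySS size_scale // lead_coefZ.
have p0 : orthopoly a b n.+1 != 0 by rewrite -size_poly_eq0 s2.
have sM : size (('X - (b n.+2)%:P) * orthopoly a b n.+1) = n.+3.
  by rewrite size_monicM ?monicXsubC // size_XsubC s2.
have lt : leq (size (- (a n.+1 *: orthopoly a b n))).+1
    (size (('X - (b n.+2)%:P) * orthopoly a b n.+1)).
  by rewrite size_polyN sM; apply: leq_ltn_trans (size_scale_leq _ _) _; rewrite s1.
rewrite size_polyDl // lead_coefDl // lead_coefM lead_coefXsubC mul1r l2; split=> //.
by rewrite [in RHS]big_ord_recr /= invfM mulrC.
Qed.

(** By the Christoffel-Darboux formula, a_(n+1) (p_(n+1)' p_n - p_(n+1) p_n') is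
    the sum of the p_j^2 for j <= n; it is at least p_0^2 = 1, so p_(n+1) and
    its derivative have no common zero. *)
Lemma deriv_orthopoly a b n x : (forall m, 0 < a m) ->
  root (orthopoly a b n) x -> (orthopoly a b n)^`().[x] != 0.
Proof.
move=> a0; case: n => [|n]; first by rewrite /= rootE hornerC oner_eq0.
(* The Christoffel-Darboux kernel on the diagonal. *)
pose W n := a n.+1 * ((orthopoly a b n.+1)^`().[x] * (orthopoly a b n).[x] -
  (orthopoly a b n.+1).[x] * (orthopoly a b n)^`().[x]).
have W1 m : 1 <= W m.
  elim: m => [|m IH].
    rewrite /W /= !subr0 mulr1 !derivZ derivXsubC derivC !hornerE subr0.
    by rewrite divff // gt_eqF.
  have -> : W m.+1 = (orthopoly a b m.+1).[x] ^+ 2 + W m.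
    rewrite /W orthopolySS.
    move: (orthopoly a b m) (orthopoly a b m.+1) => o0 o1.
    rewrite derivZ derivB derivM derivXsubC derivZ !hornerE.
    by field; exact/lt0r_neq0.
  by apply: (le_trans IH); rewrite lerDr sqr_ge0.
rewrite rootE => /eqP e; apply: contraTneq (W1 n) => e'.
by rewrite /W e e' !mul0r subrr mulr0 ler10.
Qed.

Lemma uniq_prod_XsubC (r : seq R) :
  (forall x, root (\prod_(y <- r) ('X - y%:P)) x ->
     (\prod_(y <- r) ('X - y%:P))^`().[x] != 0) -> uniq r.
Proof.
elim: r => //= y r IH; rewrite big_cons.
set q := \prod_(_ <- _) _ => h.
have der x : (('X - y%:P) * q)^`().[x] = q.[x] + (x - y) * q^`().[x].
  by rewrite derivM derivXsubC !hornerE.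
apply/andP; split.
  apply/negP => yr; have : q.[y] = 0.
    by apply/eqP; rewrite -rootE root_prod_XsubC.
  move=> q0; have := h y; rewrite der q0 subrr mul0r addr0 eqxx.
  by rewrite rootE !hornerE subrr mul0r eqxx => /(_ isT).
apply: IH => x qx; have := h x; rewrite der (eqP qx) add0r.
rewrite rootE !hornerE (eqP qx) mulr0 eqxx => /(_ isT).
by apply: contra_neq => ->; rewrite mulr0.
Qed.

(** The complex zeros are real because p_n has real coefficients and no zero in
    the upper half-plane. *)
Lemma orthopoly_roots a b n : (forall m, 0 < a m) ->
  exists r : seq R, [/\ uniq r, size r = n &
    orthopoly a b n = (\prod_(i < n) a i.+1)^-1 *: \prod_(x <- r) ('X - x%:P)].
Proof.
move=> a0; have [sp lp] := size_lead_orthopoly b n a0.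
have A0 : (\prod_(i < n) a i.+1)^-1 != 0.
  by rewrite invr_eq0; apply/prodf_neq0 => i _; rewrite gt_eqF.
set p := orthopoly a b n in sp lp *.
have [r rE] := closed_field_poly_normal (map_poly (real_complex R) p).
(* A zero in the lower half-plane has its conjugate in the upper one. *)
have real z : z \in r -> Im z = 0.
  move=> zr; have rt : root (map_poly (real_complex R) p) z.
    by rewrite rE rootZ ?root_prod_XsubC // lead_coef_map fmorph_eq0 lp.
  apply/eqP; case: (ltgtP (Im z) 0) => // h; exfalso.
    have : root (map_poly (real_complex R) p) z^*.
      rewrite -complex_root_conj -map_poly_comp.
      rewrite (eq_map_poly (g := real_complex R)) // => x /=.
      by rewrite /conjc /real_complex_def /= oppr0.
    rewrite rootE orthopolyE => /eqP e.
    have hz : 0 < Im z^* by case: z h {zr rt e} => s t /=; rewrite oppr_gt0.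
    by have := pp_neq0 b a0 hz n; rewrite e eqxx.
  have := pp_neq0 b a0 h n; rewrite -orthopolyE.
  by move: rt; rewrite rootE => ->.
pose s := [seq Re z | z <- r].
have rs : r = [seq x%:C | x <- s].
  rewrite -map_comp -[LHS]map_id; apply/eq_in_map => z /real.
  by case: z => x y /= ->.
have pE : p = (\prod_(i < n) a i.+1)^-1 *: \prod_(x <- s) ('X - x%:P).
  apply: (map_poly_inj (real_complex R)).
  rewrite linearZ /= rmorph_prod /= rE lead_coef_map lp rs big_map.
  by congr (_ *: _); apply: eq_bigr => x _; rewrite rmorphB /= map_polyX map_polyC.
exists s; split => //.
- apply: uniq_prod_XsubC => x rx.
  have := @deriv_orthopoly a b n x a0.
  rewrite -/p pE rootZ // rx => /(_ isT).
  by rewrite derivZ hornerZ mulf_eq0 negb_or => /andP[].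
- have := sp; rewrite pE size_scale // size_prod_XsubC => -[].
  by [].
Qed.

Definition roots_of a b n : seq R := fset_set (zeros (orthopoly a b n)).

Lemma zeros_finite a b n : (forall m, 0 < a m) ->
  finite_set (zeros (orthopoly a b n)).
Proof.
move=> a0; have [r [_ _ rE]] := orthopoly_roots b n a0.
apply: (sub_finite_set _ (finite_seq r)) => x.
rewrite /zeros /= rE rootZ ?root_prod_XsubC //.
by rewrite invr_eq0; apply/prodf_neq0 => i _; rewrite gt_eqF.
Qed.

Lemma mem_roots_of a b n x : (forall m, 0 < a m) ->
  (x \in roots_of a b n) = root (orthopoly a b n) x.
Proof.
move=> a0; rewrite /roots_of in_fset_set; last exact: zeros_finite.
by apply/idP/idP; rewrite ?in_setE //= => h; rewrite ?in_setE.
Qed.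

Lemma roots_of_uniq a b n : uniq (roots_of a b n).
Proof. exact: fset_uniq. Qed.

Lemma roots_ofE a b n : (forall m, 0 < a m) ->
  size (roots_of a b n) = n /\
  orthopoly a b n =
    (\prod_(i < n) a i.+1)^-1 *: \prod_(x <- roots_of a b n) ('X - x%:P).
Proof.
move=> a0; have [r [ur sr rE]] := orthopoly_roots b n a0.
have pr : perm_eq r (roots_of a b n).
  apply: uniq_perm => //; first exact: roots_of_uniq.
  move=> x; rewrite mem_roots_of // rE rootZ ?root_prod_XsubC //.
  by rewrite invr_eq0; apply/prodf_neq0 => i _; rewrite gt_eqF.
by rewrite -(perm_size pr) {1}rE (perm_big _ pr).
Qed.

Lemma normc_pp_roots a b n (x y : R) : (forall m, 0 < a m) ->
  normc (pp a b (x +i* y) n) =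
  (\prod_(i < n) a i.+1)^-1 *
  \prod_(t <- roots_of a b n) Num.sqrt ((x - t) ^+ 2 + y ^+ 2).
Proof.
move=> a0; rewrite -orthopolyE (roots_ofE b n a0).2.
rewrite linearZ /= hornerZ normcM normc_real ger0_norm; last first.
  by rewrite invr_ge0 prodr_ge0 // => i _; exact: ltW.
congr (_ * _); rewrite rmorph_prod /= horner_prod.
elim: (roots_of a b n) => [|t r IH]; first by rewrite !big_nil normc1.
rewrite !big_cons normcM IH; congr (_ * _).
by rewrite rmorphB /= map_polyX map_polyC !hornerE /= subr0.
Qed.

(** Beyond 3 M the diagonal term dominates the recursion, and the inequality
    |a_n p_(n-1)| <= M |p_n| propagates. *)
Lemma roots_bounded a b n M x : (forall m, 0 < a m) -> (forall m, a m <= M) ->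
  (forall m, `|b m| <= M) -> x \in roots_of a b n -> `|x| < 3 * M.
Proof.
move=> a0 aM bM; rewrite mem_roots_of //; apply: contraTT; rewrite -leNgt => xM.
have M0 : 0 < M by exact: lt_le_trans (a0 0%N) (aM 0%N).
suff [p0 _] : pp a b x%:C n != 0 /\
    normc (pm a b x%:C n) <= M * normc (pp a b x%:C n).
  apply: contra p0 => /eqP e; rewrite -orthopolyE horner_map.
  by rewrite e /= eqxx.
elim: n => [|n [p0 h]].
  by rewrite pp0 pm0 normc0 oner_eq0 mulr_ge0 ?ltW // normc_gt0 oner_eq0.
have np : 0 < normc (pp a b x%:C n) by rewrite normc_gt0.
have an := a0 n.+1.
have key : M * normc (pp a b x%:C n) <= a n.+1 * normc (pp a b x%:C n.+1).
  have E : (a n.+1)%:C * pp a b x%:C n.+1 =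
     (x%:C - (b n.+1)%:C) * pp a b x%:C n - pm a b x%:C n.
    by rewrite ppS mulrC divfK // realC_neq0.
  rewrite -[a n.+1]gtr0_norm // -normc_real -normcM E.
  have h1 : 2 * M * normc (pp a b x%:C n) <=
      normc ((x%:C - (b n.+1)%:C) * pp a b x%:C n).
    rewrite normcM -rmorphB normc_real ler_pM2r //.
    have := ler_normD (x - b n.+1) (b n.+1); rewrite subrK.
    have := bM n.+1; lra.
  have := le_normcD ((x%:C - (b n.+1)%:C) * pp a b x%:C n - pm a b x%:C n)
    (pm a b x%:C n).
  rewrite subrK; lra.
have q0 : 0 < normc (pp a b x%:C n.+1).
  by rewrite -(pmulr_rgt0 _ an); apply: lt_le_trans key; exact: mulr_gt0.
split; first by rewrite -normc_gt0.
rewrite pmS normcM normc_real gtr0_norm //.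
apply: (@le_trans _ _ (M * normc (pp a b x%:C n))).
  by rewrite ler_wpM2r ?(ltW np).
by apply: (le_trans key); rewrite ler_wpM2r ?(ltW q0).
Qed.

End Zeros.

(** * A second difference of the logarithm *)

Section Test.
Context {R : realType}.
Implicit Types (t x : R).

Definition half_log t : R := ln (1 + t ^+ 2) / 2.

Lemma half_log_arg_gt0 t : 0 < 1 + t ^+ 2.
Proof. by rewrite ltr_pwDl // sqr_ge0. Qed.

Lemma half_log_ge0 t : 0 <= half_log t.
Proof. by rewrite divr_ge0 // ln_ge0 // lerDl sqr_ge0. Qed.

Lemma half_log_le t t' : `|t| <= `|t'| -> half_log t <= half_log t'.
Proof.
move=> h; rewrite /half_log ler_pM2r ?invr_gt0 // ler_ln ?posrE ?half_log_arg_gt0 //.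
rewrite lerD2l -(real_normK (num_real t)) -(real_normK (num_real t')).
by rewrite ler_sqr ?nnegrE.
Qed.

Lemma half_logN t : half_log (- t) = half_log t. Proof. by rewrite /half_log sqrrN. Qed.

(** Summed over the rescaled zeros of p_n this becomes the logarithm of
    |p_n(z + x/n) p_n(z - x/n) / p_n(z)^2|. *)
Definition log_diff2 x t : R := half_log (t - x) + half_log (t + x) - 2 * half_log t.

Lemma log_diff2N x t : log_diff2 x (- t) = log_diff2 x t.
Proof. by rewrite /log_diff2 -opprD !half_logN -[- t + x]opprK opprD opprK half_logN; ring. Qed.

(** A majorant of [log_diff2] on i <= |t| <= i + 1, with each of its three terms
    estimated on its own. *)
Definition cell_sup (x i : nat) : R :=
  half_log (x + i.+1)%:R + (if (i < x)%N then half_log (x - i)%:R else half_log (i.+1 - x)%:R)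
  - 2 * half_log i%:R.

Lemma log_diff2_cell (x i : nat) t : i%:R <= `|t| <= i.+1%:R -> log_diff2 x%:R t <= cell_sup x i.
Proof.
wlog t0 : t / 0 <= t.
  move=> H; have [|/ltW t0] := leP 0 t; first exact: H.
  by rewrite -log_diff2N -normrN; apply: H; rewrite oppr_ge0.
rewrite (ger0_norm t0) => /andP[h1 h2]; rewrite /log_diff2 /cell_sup.
have g1 : half_log (t + x%:R) <= half_log (x + i.+1)%:R.
  by apply: half_log_le; rewrite !ger0_norm ?addr_ge0 // natrD addrC lerD2l.
have g3 : half_log i%:R <= half_log t by apply: half_log_le; rewrite !ger0_norm.
suff g2 : half_log (t - x%:R) <= if (i < x)%N then half_log (x - i)%:R else half_log (i.+1 - x)%:R by lra.
case: ltnP => ix; apply: half_log_le.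
  rewrite natrB ?(ltnW ix) // [leRHS]ger0_norm ?subr_ge0 ?ler_nat ?(ltnW ix) //.
  rewrite ler_norml; apply/andP; split; first lra.
  have : i.+1%:R <= x%:R :> R by rewrite ler_nat.
  have : i.+1%:R <= i%:R + 1 :> R by rewrite -natr1.
  lra.
rewrite natrB ?(leq_trans ix) // [leRHS]ger0_norm ?subr_ge0 ?ler_nat ?(leq_trans ix) //.
have : x%:R <= i%:R :> R by rewrite ler_nat.
have : i.+1%:R = i%:R + 1 :> R by rewrite -natr1.
by move=> e h; rewrite ger0_norm; lra.
Qed.

(** The sign is that of (1 + (t - x)^2) (1 + (t + x)^2) - (1 + t^2)^2
    = x^2 (2 + x^2 - 2 t^2). Points far from the origin can therefore be dropped
    from upper bounds. *)
Lemma log_diff2_le0 x t : 2 <= x -> x <= `|t| -> log_diff2 x t <= 0.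
Proof.
move=> x2 xt; rewrite /log_diff2 subr_le0 /half_log -mulrDl mulrCA divff // mulr1.
rewrite -lnM ?posrE ?half_log_arg_gt0 // ler_pdivrMr // mulr_natr mulr2n.
rewrite -lnM ?posrE ?half_log_arg_gt0 //.
rewrite ler_ln ?posrE ?mulr_gt0 ?half_log_arg_gt0 //.
have : x ^+ 2 <= t ^+ 2.
  rewrite -(real_normK (num_real t)) ler_sqr ?nnegrE //; lra.
move=> xt2; have x4 : 4 <= x ^+ 2 by rewrite expr2; nra.
have : x ^+ 2 * (2 + x ^+ 2 - 2 * t ^+ 2) <= 0 by rewrite pmulr_rle0; lra.
rewrite -subr_ge0 => h; rewrite -subr_ge0.
by apply: le_trans h _; rewrite le_eqVlt; apply/orP; left; apply/eqP; ring.
Qed.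

Lemma half_log0 : half_log 0 = 0. Proof. by rewrite /half_log expr0n addr0 ln1 mul0r. Qed.

Lemma half_log_incr x u : 0 < x -> x ^+ 2 <= u -> x <= u ->
  half_log (u + x) - half_log u <= 2 / x.
Proof.
move=> x0 xu xu'; have u0 : 0 < u by lra.
have d0 := half_log_arg_gt0 u; have d1 := half_log_arg_gt0 (u + x).
have e : (1 + (u + x) ^+ 2) / (1 + u ^+ 2) =
    1 + (2 * u * x + x ^+ 2) / (1 + u ^+ 2) by field; rewrite gt_eqF.
rewrite /half_log -mulrBl -ln_div ?posrE // e.
have h0 : 0 < (2 * u * x + x ^+ 2) / (1 + u ^+ 2).
  by rewrite divr_gt0 // addr_gt0 ?exprn_gt0 ?mulr_gt0.
have h1 : (2 * u * x + x ^+ 2) / (1 + u ^+ 2) <= 4 / x.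
  rewrite ler_pdivrMr // [leRHS]mulrAC ler_pdivlMr //.
  have : u * x * x <= u * u by rewrite -mulrA ler_pM2l // -expr2.
  have : x * x * x <= u * u by apply: ler_pM => //; rewrite ?mulr_ge0 ?(ltW x0) // -expr2.
  rewrite !expr2; nra.
have h2 : ln (1 + (2 * u * x + x ^+ 2) / (1 + u ^+ 2)) <= 4 / x.
  by apply: le_trans h1; apply: le_ln1Dx; rewrite (lt_trans _ h0) // ltrN10.
have : 4 / x = 2 / x * 2 by field; rewrite gt_eqF.
by move=> e4; rewrite ler_pdivrMr // -e4.
Qed.

(** The three sums of values of [half_log] at integers telescope. *)
Lemma sum_cell_sup (x q : nat) :
  \sum_(i < q + x) cell_sup x i =
  2 * half_log (q + x)%:R +
  \sum_(i < x) (half_log ((q + i.+1)%:R + x%:R) - half_log (q + i.+1)%:R).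
Proof.
pose S n : R := \sum_(i < n) half_log i.+1%:R.
have E0 n : \sum_(i < n) half_log i%:R = S n - half_log n%:R :> R.
  elim: n => [|n IH]; first by rewrite /S !big_ord0 half_log0 subr0.
  by rewrite /S !big_ord_recr /= IH -/(S n); ring.
have E1 n k : S (n + k)%N = S n + \sum_(i < k) half_log (n + i.+1)%:R.
  by rewrite /S big_split_ord /=; congr (_ + _); apply: eq_bigr => i _; rewrite addnS.
rewrite /cell_sup sumrB big_split /= -mulr_sumr E0.
have -> : \sum_(i < q + x) half_log (x + i.+1)%:R = S (x + (q + x))%N - S x.
  by rewrite E1 addrAC subrr add0r.
have -> : \sum_(i < q + x) (if (i < x)%N then half_log (x - i)%:R else half_log (i.+1 - x)%:R)
    = S x + S q.
  rewrite addnC big_split_ord /=; congr (_ + _).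
    rewrite (reindex_inj rev_ord_inj) /=; apply: eq_bigr => i _.
    have ix := ltn_ord i.
    by rewrite ltn_subrL (leq_ltn_trans (leq0n i) ix) /= subKn.
  apply: eq_bigr => i _; rewrite ltnNge leq_addr /=.
  by rewrite -addnS addKn.
have -> : (x + (q + x) = q + x + x)%N by rewrite addnC.
rewrite sumrB.
have -> : \sum_(i < x) half_log ((q + i.+1)%:R + x%:R) = S (q + x + x)%N - S (q + x)%N.
  rewrite (E1 (q + x)%N) addrAC subrr add0r; apply: eq_bigr => i _.
  by rewrite -natrD addnAC.
have -> : \sum_(i < x) half_log (q + i.+1)%:R = S (q + x)%N - S q.
  by rewrite (E1 q) addrAC subrr add0r.
ring.
Qed.

(** Cutting at x^2 + x makes each of the x boundary terms O(1/x), so that the sum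
    over the cells is only logarithmic in x. *)
Lemma sum_cell_sup_le (x : nat) : (0 < x)%N ->
  \sum_(i < x ^ 2 + x) cell_sup x i <= 2 * half_log (x ^ 2 + x)%:R + 2.
Proof.
move=> x0; rewrite sum_cell_sup lerD2l.
have xR : 0 < x%:R :> R by rewrite ltr0n.
apply: (@le_trans _ _ (\sum_(i < x) 2 / x%:R)).
  apply: ler_sum => i _; apply: half_log_incr => //.
    by rewrite -natrX ler_nat leq_addr.
  rewrite ler_nat; apply: leq_trans (leq_addr _ _).
  by rewrite -{1}[x]expn1 leq_pexp2l.
by rewrite sumr_const card_ord -[leLHS]mulr_natr divfK // gt_eqF.
Qed.

Lemma cell_sup_abs (x i r : nat) : (i < r)%N -> (x <= r)%N ->
  `|cell_sup x i| <= 2 * half_log (x + r)%:R.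
Proof.
move=> ir xr; rewrite /cell_sup.
have h1 : half_log (x + i.+1)%:R <= half_log (x + r)%:R :> R.
  by apply: half_log_le; rewrite !ger0_norm // ler_nat leq_add2l.
have h3 : half_log i%:R <= half_log (x + r)%:R :> R.
  by apply: half_log_le; rewrite !ger0_norm // ler_nat (leq_trans (ltnW ir)) // leq_addl.
set A := if _ then _ else _.
have h2 : 0 <= A <= half_log (x + r)%:R.
  rewrite /A; case: ifP => _; rewrite half_log_ge0 /=; apply: half_log_le;
    rewrite !ger0_norm // ler_nat.
    by rewrite (leq_trans (leq_subr _ _)) // leq_addr.
  by rewrite (leq_trans (leq_subr _ _)) // (leq_trans ir) // leq_addl.
move/andP: h2 => [h2 h2'].
have := half_log_ge0 (x + i.+1)%:R; have := half_log_ge0 i%:R.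
move=> k1 k2; rewrite ler_norml; apply/andP; split; lra.
Qed.

Lemma expR2_le : expR 2 <= 10 :> R.
Proof.
have h : expR (1 / 4) <= 4 / 3 :> R.
  have := expR_ge1Dx (- (1 / 4) : R); rewrite expRN => h.
  rewrite -[leLHS]invrK -[leRHS]invrK lef_pV2 ?posrE ?invr_gt0 ?expR_gt0 //.
    apply: le_trans h; lra.
have -> : 2 = 8%:R * (1 / 4) :> R by field.
rewrite expRM_natl.
apply: le_trans (_ : (4 / 3) ^+ 8 <= _); last lra.
by apply: lerXn2r; rewrite ?nnegrE ?expR_ge0.
Qed.

(** Cells within a quarter of x contribute at least 1 each to the variance, which
    is therefore at least of order x. *)
Lemma cell_sup_ge1 (y i : nat) : (0 < y)%N -> (i < y)%N ->
  1 <= cell_sup (4 * y) i :> R.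
Proof.
move=> y0 iy; rewrite /cell_sup.
have ix : (i < 4 * y)%N by rewrite (leq_trans iy) // leq_pmull.
rewrite ix.
have h1 : half_log (4 * y)%:R <= half_log (4 * y + i.+1)%:R :> R.
  by apply: half_log_le; rewrite !ger0_norm // ler_nat leq_addr.
have h2 : half_log (3 * y)%:R <= half_log (4 * y - i)%:R :> R.
  apply: half_log_le; rewrite !ger0_norm // ler_nat leq_subRL ?(ltnW ix) //.
  by rewrite (mulSn 3) leq_add2r ltnW.
have h3 : half_log i%:R <= half_log y%:R :> R.
  by apply: half_log_le; rewrite !ger0_norm // ler_nat ltnW.
suff : 2 <= 2 * (half_log (4 * y)%:R + half_log (3 * y)%:R - 2 * half_log y%:R) :> R by lra.
have -> : 2 * (half_log (4 * y)%:R + half_log (3 * y)%:R - 2 * half_log y%:R) =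
   ln ((1 + (4 * y)%:R ^+ 2) * (1 + (3 * y)%:R ^+ 2)) -
   ln ((1 + y%:R ^+ 2) * (1 + y%:R ^+ 2)) :> R.
  by rewrite !lnM ?posrE ?half_log_arg_gt0 // /half_log; field.
rewrite -ln_div ?posrE ?mulr_gt0 ?half_log_arg_gt0 // -[2]expRK.
rewrite ler_ln ?posrE ?expR_gt0 ?divr_gt0 ?mulr_gt0 ?half_log_arg_gt0 //.
apply: le_trans expR2_le _.
rewrite ler_pdivlMr ?mulr_gt0 ?half_log_arg_gt0 // !natrM.
have : 1 <= y%:R :> R by rewrite ler1n.
move: (y%:R : R) => Y Y1; have : 1 <= Y ^+ 2 by rewrite expr_ge1 // ltW // (lt_le_trans ltr01).
rewrite !exprMn; nra.
Qed.

End Test.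

(** * Downward fluctuations of Poisson sums *)

Section Poisson.
Context {R : realType}.

Lemma expR_lower (y : R) : -1 <= y -> 1 + y + y ^+ 2 / 4 <= expR y.
Proof.
move=> y1; have -> : y = 2%:R * (y / 2) by field.
rewrite expRM_natl; apply: (@le_trans _ _ ((1 + y / 2) ^+ 2)).
  by rewrite le_eqVlt; apply/orP; left; apply/eqP; field.
have h := expR_ge1Dx (y / 2).
by rewrite ler_sqr ?nnegrE ?expR_ge0 //; lra.
Qed.

Lemma expR_upper (y : R) : `|y| <= 1 / 4 -> expR y <= 1 + y + y ^+ 2.
Proof.
rewrite ler_norml => /andP[y1 y2].
have -> : expR y = expR (y / 2) ^+ 2.
  by rewrite -expRM_natl; congr expR; field.
have h : expR (y / 2) <= (1 - y / 2)^-1.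
  have := expR_ge1Dx (- (y / 2)); rewrite expRN => h.
  rewrite -[leLHS]invrK lef_pV2 ?posrE ?invr_gt0 ?expR_gt0 //; lra.
apply: (@le_trans _ _ ((1 - y / 2)^-1 ^+ 2)).
  by rewrite ler_sqr ?nnegrE ?expR_ge0 // invr_ge0; lra.
have h1 : 0 < (1 - y / 2) ^+ 2 by rewrite exprn_gt0 //; lra.
have h2 : 0 < 1 + y + y ^+ 2 by rewrite expr2; nra.
rewrite exprVn -[leLHS]mul1r ler_pdivrMr //.
have h3 : 0 <= y ^+ 2 * (1 / 4 - 3 * y / 4 + y ^+ 2 / 4).
  by rewrite mulr_ge0 ?sqr_ge0 //; have := sqr_ge0 y; lra.
have -> : (1 + y + y ^+ 2) * (1 - y / 2) ^+ 2 =
   1 + y ^+ 2 * (1 / 4 - 3 * y / 4 + y ^+ 2 / 4) by field.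
by rewrite lerDl.
Qed.

Definition pois (lam : R) (j : nat) : R := lam ^+ j / j`!%:R * expR (- lam).

Lemma pois_ge0 lam j : 0 <= lam -> 0 <= pois lam j.
Proof. by move=> l0; rewrite !mulr_ge0 ?invr_ge0 ?exprn_ge0 ?expR_ge0. Qed.

Lemma pois_gen lam u j :
  pois lam j * u ^+ j = expR (- lam) * exp_coeff (lam * u) j.
Proof. by rewrite /pois /exp_coeff /= exprMn; ring. Qed.

Lemma exp_coeff_sum_le (y : R) K : 0 <= y ->
  \sum_(j < K) exp_coeff y j <= expR y.
Proof.
move=> y0; have := nondecreasing_cvgn_le _ (is_cvg_series_exp_coeff y) K.
rewrite /series /= big_mkord; apply.
apply/nondecreasing_seqP => n; rewrite /series /= big_nat_recr //= lerDl.
exact: exp_coeff_ge0.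
Qed.

Lemma cvg_exp_coeff_sum (y : R) :
  (fun K => \sum_(j < K) exp_coeff y j) @ \oo --> expR y.
Proof.
rewrite (_ : (fun K => _) = series (exp_coeff y)).
  exact: is_cvg_series_exp_coeff.
by apply/funext => K; rewrite /series /= big_mkord.
Qed.

Section box.
Variables (l : nat) (c : 'I_l -> R) (lam s : R).
Hypothesis l0 : 0 <= lam.

Let val K (k : {ffun 'I_l -> 'I_K}) : R := \sum_(m < l) c m * (k m : nat)%:R.
Let prob K (k : {ffun 'I_l -> 'I_K}) : R := \prod_(m < l) pois lam (k m).

Lemma box_laplace K (r : R) :
  \sum_(k : {ffun 'I_l -> 'I_K}) prob k * expR (- (r * val k)) =
  \prod_(m < l) (expR (- lam) * \sum_(j < K) exp_coeff (lam * expR (- (r * c m))) j).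
Proof.
under [RHS]eq_bigr do rewrite mulr_sumr.
rewrite bigA_distr_bigA /=; apply: eq_bigr => k _.
rewrite /prob /val mulr_sumr -sumrN expR_sum -big_split /=.
apply: eq_bigr => m _; rewrite -pois_gen; congr (_ * _).
by rewrite -expRM_natr; congr expR; ring.
Qed.

(** Limit of the logarithm of [box_laplace], that is, the logarithm of the Laplace
    transform of the sum of c m * k_m for independent Poisson counts k_m. *)
Definition log_laplace (r : R) : R := \sum_(m < l) lam * (expR (- (r * c m)) - 1).

Lemma box_laplace_le K r :
  \sum_(k : {ffun 'I_l -> 'I_K}) prob k * expR (- (r * val k)) <= expR (log_laplace r).
Proof.
rewrite box_laplace /log_laplace expR_sum; apply: ler_prod => m _.
have y0 : 0 <= lam * expR (- (r * c m)) by rewrite mulr_ge0 // expR_ge0.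
rewrite mulr_ge0 ?expR_ge0 ?sumr_ge0 //=; last by move=> j _; exact: exp_coeff_ge0.
rewrite mulrBr mulr1 addrC expRD ler_wpM2l ?expR_ge0 //.
exact: exp_coeff_sum_le.
Qed.

Lemma box_laplace_cvg r :
  (fun K => \sum_(k : {ffun 'I_l -> 'I_K}) prob k * expR (- (r * val k))) @ \oo
    --> expR (log_laplace r).
Proof.
under eq_fun do rewrite box_laplace.
have -> : expR (log_laplace r) =
  \prod_(m < l) (expR (- lam) * expR (lam * expR (- (r * c m)))).
  rewrite /log_laplace expR_sum; apply: eq_bigr => m _.
  by rewrite -expRD; congr expR; ring.
apply: cvg_big; first exact: mul_continuous.
move=> m _; apply: cvgMr; exact: cvg_exp_coeff_sum.
Qed.

(** Where the sum is at least - B the integrand is at most expR (s * B); elsewhere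
    X <= eta X^2 + 1 / (4 eta) trades the transform at s for that at 2 s and for
    the probability of the event. *)
Lemma box_split K B delta eta : 0 < eta -> 0 <= s ->
  \sum_(k : {ffun 'I_l -> 'I_K} | val k < - B) prob k <= delta ->
  \sum_(k : {ffun 'I_l -> 'I_K}) prob k * expR (- (s * val k)) <=
  expR (s * B) + eta * expR (log_laplace (2 * s)) + delta / (4 * eta).
Proof.
move=> e0 s0 hd.
have p0 (k : {ffun 'I_l -> 'I_K}) : 0 <= prob k.
  by apply: prodr_ge0 => m _; exact: pois_ge0.
rewrite (bigID (fun k => val k < - B)) /= addrC -addrA; apply: lerD.
  apply: (@le_trans _ _ (\sum_(k : {ffun 'I_l -> 'I_K} | ~~ (val k < - B))
       prob k * expR (s * B))).
    apply: ler_sum => k; rewrite -leNgt => hk.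
    by rewrite ler_wpM2l // ler_expR -mulrN ler_wpM2l // lerNl.
  rewrite -mulr_suml -[leRHS]mul1r ler_wpM2r ?expR_ge0 //.
  apply: (@le_trans _ _ (\sum_(k : {ffun 'I_l -> 'I_K}) prob k)).
    by rewrite [leRHS](bigID (fun k => val k < - B)) /= lerDr sumr_ge0.
  have := box_laplace_le K 0.
  have -> : log_laplace 0 = 0.
    by rewrite /log_laplace big1 // => m _; rewrite mul0r oppr0 expR0 subrr mulr0.
  rewrite expR0; congr (_ <= _); apply: eq_bigr => k _.
  by rewrite mul0r oppr0 expR0 mulr1.
apply: (@le_trans _ _ (\sum_(k : {ffun 'I_l -> 'I_K} | val k < - B)
    (eta * (prob k * expR (- (2 * s * val k))) + prob k / (4 * eta)))).
  apply: ler_sum => k _.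
  have -> : expR (- (2 * s * val k)) = expR (- (s * val k)) ^+ 2.
    by rewrite -expRM_natl; congr expR; ring.
  set E := expR _.
  have -> : eta * (prob k * E ^+ 2) + prob k / (4 * eta) =
    prob k * E + prob k * (eta * (E - 1 / (2 * eta)) ^+ 2).
    by field; rewrite gt_eqF.
  by rewrite lerDl mulr_ge0 // mulr_ge0 ?sqr_ge0 // ltW.
rewrite big_split /= -mulr_sumr -mulr_suml; apply: lerD.
  rewrite ler_wpM2l ?(ltW e0) //; apply: le_trans (box_laplace_le K (2 * s)).
  rewrite [leRHS](bigID (fun k => val k < - B)) /= lerDl sumr_ge0 // => k _.
  by rewrite mulr_ge0 // expR_ge0.
by rewrite ler_wpM2r // invr_ge0 mulr_ge0 // ltW.
Qed.

Lemma log_laplace_lower : (forall m, `|s * c m| <= 1 / 8) ->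
  - (s * (lam * \sum_(m < l) c m)) +
    s ^+ 2 * (lam * \sum_(m < l) c m ^+ 2) / 4 <= log_laplace s.
Proof.
move=> hc; have -> : - (s * (lam * \sum_(m < l) c m)) +
    s ^+ 2 * (lam * \sum_(m < l) c m ^+ 2) / 4 =
    \sum_(m < l) lam * (- (s * c m) + (s * c m) ^+ 2 / 4).
  under [RHS]eq_bigr do rewrite mulrDr.
  rewrite big_split /=; congr (_ + _).
    by rewrite !mulr_sumr -sumrN; apply: eq_bigr => m _; ring.
  by rewrite !mulr_sumr mulr_suml; apply: eq_bigr => m _; ring.
apply: ler_sum => m _; rewrite ler_wpM2l //.
have := @expR_lower (- (s * c m)); have := hc m; rewrite ler_norml => /andP[h1 h2].
rewrite sqrrN => h.
have : 1 + - (s * c m) + (s * c m) ^+ 2 / 4 <= expR (- (s * c m)) by apply: h; lra.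
lra.
Qed.

Lemma log_laplace_upper : (forall m, `|s * c m| <= 1 / 8) ->
  log_laplace (2 * s) <= - (2 * (s * (lam * \sum_(m < l) c m))) +
    4 * (s ^+ 2 * (lam * \sum_(m < l) c m ^+ 2)).
Proof.
move=> hc; have -> : - (2 * (s * (lam * \sum_(m < l) c m))) +
    4 * (s ^+ 2 * (lam * \sum_(m < l) c m ^+ 2)) =
    \sum_(m < l) lam * (- (2 * s * c m) + (2 * s * c m) ^+ 2).
  under [RHS]eq_bigr do rewrite mulrDr.
  rewrite big_split /=; congr (_ + _).
    by rewrite !mulr_sumr -sumrN; apply: eq_bigr => m _; ring.
  by rewrite !mulr_sumr; apply: eq_bigr => m _; ring.
apply: ler_sum => m _; rewrite ler_wpM2l //.
have h : `|- (2 * s * c m)| <= 1 / 4.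
  by rewrite normrN -mulrA normrM ger0_norm //; have := hc m; lra.
by have := expR_upper h; rewrite sqrrN; lra.
Qed.

(** The scale s is such that s^2 times the variance is 4 ln 4. Up to centring, the
    Laplace transform is then at least 4 at s and at most 2^32 at 2 s. If the
    event had probability at most 2^-30 for every truncation K, [box_split]
    would bound the centred transform at s by a number smaller than
    2 + 1 + 1. *)
Lemma poisson_fluctuation B D : 0 <= s ->
  (forall m, `|s * c m| <= 1 / 8) ->
  lam * \sum_(m < l) c m <= D ->
  s ^+ 2 * (lam * \sum_(m < l) c m ^+ 2) = 4 * ln 4 ->
  s * (B + D) <= 2 / 5 ->
  exists K, 2^-1 ^+ 30 <
    \sum_(k : {ffun 'I_l -> 'I_K} | val k < - B) prob k.
Proof.
move=> s0 hc hD hT hB.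
have := log_laplace_lower hc; have := log_laplace_upper hc; rewrite hT.
set m0 := lam * \sum_(m < l) c m; move=> hi lo.
have l4 : expR (ln 4) = 4 :> R by rewrite lnK // posrE.
have a1 : 4 <= expR (s * m0) * expR (log_laplace s).
  by rewrite -expRD -{1}l4 ler_expR; lra.
have a2 : expR (s * m0) * expR (s * m0) * expR (log_laplace (2 * s)) <= 2 ^+ 32.
  have -> : 2 ^+ 32 = expR (16 * ln 4) :> R.
    by rewrite (expRM_natl 16) l4 (_ : 4 = 2 ^+ 2 :> R) -?exprM //; ring.
  by rewrite -!expRD ler_expR; lra.
have a3 : expR (s * (B + m0)) < 2.
  apply: (@le_lt_trans _ _ (expR (2 / 5))).
    rewrite ler_expR; apply: le_trans hB; apply: ler_wpM2l => //.
    by rewrite lerD2l.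
  have := expR_ge1Dx (- (2 / 5) : R); rewrite expRN => h.
  by rewrite -[ltLHS]invrK -[ltRHS]invrK ltf_pV2 ?posrE ?invr_gt0 ?expR_gt0 //; lra.
apply/not_existsP => H.
(* Makes the second and third term of [box_split] at most 1 after centring. *)
pose eta : R := 2^-1 ^+ 32 * expR (s * m0).
have e0 : 0 < eta by rewrite mulr_gt0 ?expR_gt0 // exprn_gt0.
have lim : expR (log_laplace s) <=
    expR (s * B) + eta * expR (log_laplace (2 * s)) + 2^-1 ^+ 30 / (4 * eta).
  have cv := @box_laplace_cvg s.
  rewrite -(cvg_lim _ cv) //; apply: limr_le.
    by apply/cvg_ex; eexists; exact: cv.
  apply: nearW => K; apply: box_split => //.
  by rewrite leNgt; apply/negP => h; apply: (H K).
have E : expR (s * m0) * expR (log_laplace s) <= expR (s * (B + m0)) + 1 + 1.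
  apply: le_trans (ler_wpM2l (expR_ge0 _) lim) _; rewrite !mulrDr.
  apply: lerD; first apply: lerD.
  - by rewrite -expRD addrC.
  - have -> : expR (s * m0) * (eta * expR (log_laplace (2 * s))) =
      2^-1 ^+ 32 * (expR (s * m0) * expR (s * m0) * expR (log_laplace (2 * s))).
      by rewrite /eta; ring.
    apply: (@le_trans _ _ (2^-1 ^+ 32 * 2 ^+ 32)).
      by rewrite ler_pM2l // exprn_gt0.
    by rewrite -exprMn mulVf // expr1n.
  rewrite /eta (_ : 2^-1 ^+ 32 = 2^-1 ^+ 30 / 4 :> R); last first.
    by rewrite (exprD _ 30 2); congr (_ * _); field.
  have := expR_gt0 (s * m0); have : 0 < 2^-1 ^+ 30 :> R by rewrite exprn_gt0.
  move: (2^-1 ^+ 30 : R) (expR _) => u v u0 v0.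
  by rewrite le_eqVlt; apply/orP; left; apply/eqP; field; rewrite !gt_eqF.
by clear lim H e0 a2; lra.
Qed.

End box.
End Poisson.

(** * Poisson sums over the cells of a large window *)

Section Choice.
Context {R : realType}.

(** For m < 2 r the interval [m - r, m + 1 - r] lies in the set of all u with
    [cell_index] <= |u| <= [cell_index] + 1. *)
Definition cell_index (r m : nat) : nat := if (m < r)%N then (r - m.+1)%N else (m - r)%N.

Lemma cell_index_lt r (m : 'I_(r + r)) : (cell_index r m < r)%N.
Proof.
rewrite /cell_index; case: (ltnP m r) => h.
  by rewrite ltn_subrL /= (leq_ltn_trans _ h).
by rewrite ltn_subLR.
Qed.

Lemma sum_cell_index r (F : nat -> R) :
  \sum_(m < r + r) F (cell_index r m) = 2 * \sum_(i < r) F i.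
Proof.
rewrite big_split_ord /= [2 * _]mulr_natl mulr2n; congr (_ + _).
  rewrite (reindex_inj rev_ord_inj) /=; apply: eq_bigr => i _.
  have ir := ltn_ord i.
  rewrite /cell_index ltn_subrL (leq_ltn_trans (leq0n i) ir) /= subnSK //.
  by rewrite subKn // ltnW.
by apply: eq_bigr => i _; rewrite /cell_index ltnNge leq_addr /= addKn.
Qed.

Lemma slow_log (K : R) : exists2 y : nat, (0 < y)%N &
  K * (1 + ln (4 * y + 1)%:R) ^+ 2 <= y%:R.
Proof.
pose N := (Num.truncn (81 * `|K|)).+1.
have NK : 81 * K <= N%:R.
  apply: (@le_trans _ _ (81 * `|K|)); first by rewrite ler_pM2l // ler_norm.
  by apply: ltW; rewrite truncnS_gt.
have N1 : 1 <= N%:R :> R by rewrite ler1n.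
have N0 : 0 < N%:R :> R by rewrite ltr0n.
(* A fourth power, since ln (4 N^4 + 1) <= 8 N. *)
exists (N ^ 4)%N; first by rewrite expn_gt0.
have [K0|K0] := leP K 0.
  apply: (@le_trans _ _ 0) => //; rewrite mulr_le0_ge0 ?sqr_ge0 //.
have l0 : 0 <= ln (4 * N ^ 4 + 1)%:R :> R by rewrite ln_ge0 // ler1n addn1.
have ell : ln (4 * N ^ 4 + 1)%:R <= 8 * N%:R :> R.
  apply: (@le_trans _ _ (ln ((2 * N)%:R ^+ 4))).
    rewrite ler_ln ?posrE ?exprn_gt0 ?ltr0n ?addn1 // -natrX ler_nat.
    rewrite expnMn -addn1 (_ : (2 ^ 4 = 4 + 12)%N) // mulnDl leq_add2l.
    by rewrite muln_gt0 expn_gt0.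
  rewrite lnXn ?ltr0n // natrM -[leLHS]mulr_natl.
  have : ln (2 * N%:R) <= 2 * N%:R :> R by apply: ltW; apply: ln_sublinear; rewrite mulr_gt0.
  lra.
apply: (@le_trans _ _ (K * (9 * N%:R) ^+ 2)).
  rewrite ler_pM2l // ler_sqr ?nnegrE; lra.
rewrite natrX (_ : K * _ = (81 * K) * (N%:R * N%:R)); last by ring.
apply: (@le_trans _ _ (N%:R * (N%:R * N%:R))).
  by rewrite ler_pM2r // mulr_gt0.
have : 0 <= N%:R * N%:R * N%:R * (N%:R - 1) :> R by rewrite !mulr_ge0 // subr_ge0.
rewrite -subr_ge0 => h; rewrite -subr_ge0; apply: le_trans h _.
by rewrite le_eqVlt; apply/orP; left; apply/eqP; ring.
Qed.

(** The variance of the sum over the 2 r cells is at least of order x, whereas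
    its mean, its coefficients and the threshold are O(ln x). So the scale s of
    [poisson_fluctuation] is at most of order x^(-1/2), and its hypotheses hold as soon
    as x is large compared with a power of ln x. *)
Lemma poisson_cells (lam C : R) : 0 < lam -> 0 <= C ->
  exists x r : nat, [/\ (2 <= x)%N, (x <= r)%N & exists K,
  2^-1 ^+ 30 <
    \sum_(k : {ffun 'I_(r + r) -> 'I_K} |
      \sum_(m < r + r) cell_sup x (cell_index r m) * (k m : nat)%:R
        < - ln ((x%:R ^+ 2 + 2) ^+ 2 * (2 * C + 1)))
      \prod_(m < r + r) pois lam (k m)].
Proof.
move=> l0 C0.
(* A (1 + ln (4 y + 1)) bounds the threshold plus the mean. *)
pose A : R := 4 + 8 * lam + `|ln (2 * C + 1)|.
have A4 : 4 <= A by rewrite /A; have := normr_ge0 (ln (2 * C + 1)); lra.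
have [y y0 hy] := slow_log ((6 * 32 * 32) * A ^+ 2 / lam).
pose x := (4 * y)%N; pose r := (x ^ 2 + x)%N.
have x0 : (0 < x)%N by rewrite muln_gt0.
exists x, r; split.
- by rewrite /x (@leq_trans (4 * 1)) // leq_mul2l.
- exact: leq_addl.
set ell := ln _ in hy.
have y1 : 1 <= y%:R :> R by rewrite ler1n.
have ell0 : 0 <= ell by rewrite ln_ge0 // ler1n addn1.
have half_log_r u : (u <= x + r)%N -> half_log u%:R <= 2 * ell.
  move=> ur; apply: (@le_trans _ _ (half_log (x + r)%:R)).
    by apply: half_log_le; rewrite !ger0_norm // ler_nat.
  rewrite /half_log ler_pdivrMr // (_ : 2 * ell * 2 = 4%:R * ell); last by ring.
  rewrite mulr_natl -lnXn ?ltr0n ?addn1 // ler_ln ?posrE ?half_log_arg_gt0 ?exprn_gt0 //.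
  rewrite /r /x !(natrD, natrM, natrX) -[(4 * y).+1%:R]natr1 natrM.
  move: y1; move: (y%:R : R) => Y Y1.
  rewrite -subr_ge0 (_ : _ - _ = 2 * (16 * Y ^+ 2 + 8 * Y)); last by ring.
  by rewrite mulr_ge0 // addr_ge0 ?mulr_ge0 ?sqr_ge0 //; lra.
pose B : R := ln ((x%:R ^+ 2 + 2) ^+ 2 * (2 * C + 1)).
pose D : R := lam * (4 * half_log r%:R + 4).
pose c (m : 'I_(r + r)) : R := cell_sup x (cell_index r m).
have BD : B + D <= A * (1 + ell).
  have hB : B <= 4 * ell + ln (2 * C + 1).
    have p1 : 0 < x%:R ^+ 2 + 2 :> R by rewrite ltr_wpDl // sqr_ge0.
    have p2 : 0 < 2 * C + 1 by lra.
    rewrite /B lnM ?posrE ?(exprn_gt0 2 p1) //.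
    rewrite lerD2r mulr_natl -lnXn ?ltr0n ?addn1 //.
    have h : x%:R ^+ 2 + 2 <= (4 * y).+1%:R ^+ 2 :> R.
      by rewrite /x -[(4 * y).+1%:R]natr1 natrM !expr2; nra.
    rewrite ler_ln ?posrE ?exprn_gt0 //.
    by rewrite (exprM _ 2 2) lerXn2r ?nnegrE ?sqr_ge0 // ltW.
  have hD : D <= lam * (8 * ell + 4).
    by rewrite /D ler_pM2l //; have := half_log_r r (leq_addl _ _); lra.
  have hn := ler_norm (ln (2 * C + 1)).
  have := mulr_ge0 (normr_ge0 (ln (2 * C + 1))) ell0.
  have := mulr_ge0 (ltW l0) ell0.
  rewrite /A; nra.
have hc m : `|c m| <= 4 * ell.
  have := cell_sup_abs (R := R) (cell_index_lt m) (leq_addl (x ^ 2) x : (x <= r)%N).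
  by move/le_trans; apply; have := half_log_r _ (leqnn (x + r)); lra.
have hD : lam * \sum_(m < r + r) c m <= D.
  rewrite ler_pM2l // /c (sum_cell_index r (cell_sup x)).
  have := @sum_cell_sup_le R x x0; rewrite -/r; lra.
pose V := lam * \sum_(m < r + r) c m ^+ 2.
have hV : 2 * lam * y%:R <= V.
  rewrite /V /c (sum_cell_index r (fun i => cell_sup x i ^+ 2)) mulrCA mulrA.
  rewrite ler_pM2l ?mulr_gt0 //.
  have yr : (r = y + (r - y))%N.
    rewrite subnKC // (leq_trans _ (leq_addl _ _)) // leq_pmull //.
  rewrite yr big_split_ord /= ler_wpDr //; first by rewrite sumr_ge0 // => i _; exact: sqr_ge0.
  apply: (@le_trans _ _ (\sum_(i < y) (1 : R))).
    by rewrite sumr_const card_ord.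
  apply: ler_sum => i _.
  have h : 1 <= cell_sup x i :> R by exact: cell_sup_ge1.
  by rewrite expr2; nra.
have hV2 : (12 * 32 * 32) * (A * (1 + ell)) ^+ 2 <= V.
  apply: le_trans hV; move: hy; rewrite -(ler_pM2l (mulr_gt0 (ltr0n R 2) l0)).
  apply: le_trans; rewrite le_eqVlt; apply/orP; left; apply/eqP.
  by field; rewrite gt_eqF.
have V0 : 0 < V.
  have yR : 0 < y%:R :> R by lra.
  by apply: lt_le_trans hV; rewrite !mulr_gt0.
have l4 : 0 <= ln 4 :> R by rewrite ln_ge0 // ler1n.
have l4' : ln 4 <= 3 :> R by have := @le_ln1Dx R 3; rewrite (_ : 1 + 3 = 4 :> R); [apply; lra|ring].
(* V is the variance of the Poisson sum. *)
pose s := Num.sqrt (4 * ln 4 / V).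
have sV : s ^+ 2 * V = 4 * ln 4.
  have q0 : 0 <= 4 * ln 4 / V by rewrite divr_ge0 ?(ltW V0) // mulr_ge0.
  by rewrite /s sqr_sqrtr // divfK // gt_eqF.
have s0 : 0 <= s by exact: sqrtr_ge0.
have sA : s * (A * (1 + ell)) <= 1 / 32.
  have p0 : 0 <= s * (A * (1 + ell)).
    by apply: mulr_ge0 => //; apply: mulr_ge0; lra.
  rewrite -ler_sqr ?nnegrE //.
  rewrite exprMn; apply: (@le_trans _ _ (s ^+ 2 * (V / (12 * 32 * 32)))).
    by rewrite ler_wpM2l ?sqr_ge0 //; lra.
  by rewrite mulrA sV; lra.
have hB : s * (B + D) <= 2 / 5.
  by apply: (@le_trans _ _ (s * (A * (1 + ell)))); [rewrite ler_wpM2l|lra].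
have hs m : `|s * c m| <= 1 / 8.
  rewrite normrM ger0_norm //; apply: (@le_trans _ _ (s * (4 * ell))).
    by rewrite ler_wpM2l.
  have : s * ell <= s * (A * (1 + ell)) by rewrite ler_wpM2l //; nra.
  lra.
have := @poisson_fluctuation R _ c lam s (ltW l0) B D s0 hs hD sV hB. exact.
Qed.
End Choice.

(** * Rigidity of the zeros when the transfer matrix is bounded *)

Section Counting.
Context {R : realType}.
Implicit Types (a b : nat -> R).

Lemma num_zerosE a b n (u v : R) : (forall m, 0 < a m) ->
  num_zeros (orthopoly a b n) `[u, v]%classic =
  count (fun t => u <= t <= v) (roots_of a b n).
Proof.
move=> a0; rewrite /num_zeros -size_filter; apply: perm_size.
apply: uniq_perm; [exact: fset_uniq|by rewrite filter_uniq ?fset_uniq|] => t.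
rewrite mem_filter mem_roots_of // in_fset_set; last first.
  by apply: sub_finite_set (zeros_finite b n a0) => x [].
apply/idP/idP; first by rewrite in_setE => -[/= rt]; rewrite in_itv /= rt andbT.
by move=> /andP[h rt]; rewrite in_setE; split; rewrite //= in_itv.
Qed.

Definition scaled_pt (E0 : R) (n : nat) (s : R) : R[i] := (E0 + s / n%:R) +i* n%:R^-1.

Lemma expR_half_log (u : R) : expR (half_log u) = Num.sqrt (1 + u ^+ 2).
Proof.
have u0 := half_log_arg_gt0 u.
apply/eqP; rewrite -(@eqrXn2 _ 2) ?expR_ge0 ?sqrtr_ge0 // sqr_sqrtr ?(ltW u0) //.
by rewrite -expRM_natl /half_log mulrCA divff // mulr1 lnK // posrE.
Qed.

(** The factor k collects what does not depend on s: it cancels when the values at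
    different s are compared. *)
Lemma normc_scaled_pt a b (E0 : R) n : (forall m, 0 < a m) -> (0 < n)%N ->
  exists2 k : R, 0 < k & forall s, normc (pp a b (scaled_pt E0 n s) n) =
    k * expR (\sum_(t <- roots_of a b n) half_log (n%:R * (t - E0) - s)).
Proof.
move=> a0 n0; have nR : 0 < n%:R :> R by rewrite ltr0n.
exists ((\prod_(i < n) a i.+1)^-1 * \prod_(t <- roots_of a b n) n%:R^-1).
  by rewrite mulr_gt0 ?invr_gt0 ?prodr_gt0 // => i _; rewrite invr_gt0.
move=> s; rewrite normc_pp_roots // -mulrA expR_sum -big_split /=; congr (_ * _).
apply: eq_bigr => t _; rewrite expR_half_log.
have -> : (E0 + s / n%:R - t) ^+ 2 + n%:R^-1 ^+ 2 =
    n%:R^-1 ^+ 2 * (1 + (n%:R * (t - E0) - s) ^+ 2).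
  by field; rewrite gt_eqF.
by rewrite sqrtrM ?sqr_ge0 // sqrtr_sqr gtr0_norm // invr_gt0.
Qed.

(** The points z and z + x/n, z - x/n, all at height 1/n, are [hclose] with constant
    x^2, so [pp_compare] applies to both pairs; the logarithms of the two
    comparisons add up to the claim. *)
Lemma sum_log_diff2_ge a b (E0 C x : R) n : (forall m, 0 < a m) -> (0 < n)%N -> 0 <= C ->
  normc (qm a b (scaled_pt E0 n 0) n) * normc (pp a b (scaled_pt E0 n 0) n) <= C ->
  - ln ((x ^+ 2 + 2) ^+ 2 * (2 * C + 1)) <=
    \sum_(t <- roots_of a b n) log_diff2 x (n%:R * (t - E0)).
Proof.
move=> a0 n0 C0 hC; have [k k0 kE] := normc_scaled_pt b E0 a0 n0.
have nR : 0 < n%:R :> R by rewrite ltr0n.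
set Q := _ * _.
have Q0 : 0 < Q.
  apply: mulr_gt0; last lra.
  by rewrite exprn_gt0 // ltr_wpDl // sqr_ge0.
pose S s := \sum_(t <- roots_of a b n) half_log (n%:R * (t - E0) - s).
have key y : y ^+ 2 = x ^+ 2 -> 2 * S 0 <= ln Q + 2 * S y.
  move=> yx; have cl : hclose (x ^+ 2) (scaled_pt E0 n 0) (scaled_pt E0 n y).
    rewrite /hclose normc_sq /= mul0r addr0 -yx.
    by rewrite le_eqVlt; apply/orP; left; apply/eqP; field; rewrite gt_eqF.
  case: n n0 nR kE cl hC @S => // n n0 nR kE cl hC S.
  have i0 : 0 < n.+1%:R^-1 :> R by rewrite invr_gt0.
  have := pp_compare a0 (i0 : 0 < Im (scaled_pt E0 n.+1 0)) (i0 : 0 < Im (scaled_pt E0 n.+1 y))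
    (sqr_ge0 x) cl hC.
  rewrite !kE -/(S 0) -/(S y) -/Q !(exprMn _ k) [leRHS]mulrCA ler_pM2l ?exprn_gt0 // => h.
  rewrite -ler_expR expRD lnK ?posrE // !(expRM_natl 2).
  exact: h.
have h1 := key x erefl; have h2 := key (- x) (sqrrN x).
have -> : \sum_(t <- roots_of a b n) log_diff2 x (n%:R * (t - E0)) =
    S x + S (- x) - 2 * S 0.
  rewrite /S mulr_sumr -big_split -sumrB /=; apply: eq_bigr => t _.
  by rewrite /log_diff2 opprK subr0.
lra.
Qed.

(** Neighbouring closed cells share an endpoint; u is kept away from all of them,
    so that it lies in one cell only. *)
Lemma log_diff2_le_cells (x r : nat) (u : R) : (2 <= x)%N -> (x <= r)%N ->
  (forall j : nat, (j <= r + r)%N -> u != j%:R - r%:R) ->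
  log_diff2 x%:R u <= \sum_(m < r + r) cell_sup x (cell_index r m) *
     ((m%:R - r%:R <= u <= m%:R + 1 - r%:R)%R : nat)%:R.
Proof.
move=> x2 xr ne.
have [ur|ur] := leP r%:R `|u|.
  rewrite big1 => [|m _].
    apply: log_diff2_le0; first by rewrite (ler_nat _ 2).
    by apply: le_trans ur; rewrite ler_nat.
  suff -> : (m%:R - r%:R <= u <= m%:R + 1 - r%:R) = false by rewrite mulr0.
  apply/negP => /andP[h1 h2].
  have n1 := ne 0%N isT; have n2 := ne (r + r)%N (leqnn _).
  have : m.+1%:R <= (r + r)%:R :> R by rewrite ler_nat.
  have : 0 <= m%:R :> R by [].
  rewrite -natr1 natrD => m0 mr.
  move: ur; rewrite ler_normr => /orP[ur|ur].
    by move: n2; rewrite natrD addrK => /eqP; apply; lra.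
  by move: n1; rewrite sub0r => /eqP; apply; lra.
have /andP[u1 u2] : - r%:R < u < r%:R by rewrite -ltr_norml.
pose m0 := Num.truncn (u + r%:R).
have ur0 : 0 <= u + r%:R by lra.
have /andP[t1 t2] := truncn_itv ur0; rewrite -/m0 -natr1 in t1 t2.
have m0r : (m0 < r + r)%N.
  by rewrite -(ltr_nat R) natrD; apply: le_lt_trans t1 _; lra.
rewrite (bigD1 (Ordinal m0r)) //= big1 => [|m mm]; last first.
  suff -> : (m%:R - r%:R <= u <= m%:R + 1 - r%:R) = false by rewrite mulr0.
  apply/negP => /andP[h1 h2].
  have : m != m0 :> nat by [].
  rewrite neq_ltn => /orP[mlt|mlt].
    have l : m.+1%:R <= m0%:R :> R by rewrite ler_nat.
    rewrite -natr1 in l.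
    have /eqP := ne m0 (ltnW m0r); apply; lra.
  have l : m0.+1%:R <= m%:R :> R by rewrite ler_nat.
  rewrite -natr1 in l; lra.
rewrite addr0 (_ : _ && _ = true) ?mulr1; last by apply/andP; split; lra.
apply: log_diff2_cell; rewrite /cell_index; case: ltnP => h.
  have hr : m0.+1%:R <= r%:R :> R by rewrite ler_nat.
  rewrite -[(r - m0.+1).+1]/((r - m0.+1).+1) -natr1 natrB // -natr1.
  rewrite -natr1 in hr.
  by rewrite ler0_norm; [apply/andP; split; lra|lra].
have hr : r%:R <= m0%:R :> R by rewrite ler_nat.
rewrite -natr1 natrB //.
by rewrite ger0_norm; [apply/andP; split; lra|lra].
Qed.

Lemma counts_ge a b (E0 C : R) n (x r : nat) :
  (forall m, 0 < a m) -> (0 < n)%N -> 0 <= C -> (2 <= x)%N -> (x <= r)%N ->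
  (forall j : nat, (j <= r + r)%N ->
     ~~ root (orthopoly a b n) (E0 + (j%:R - r%:R) / n%:R)) ->
  normc (qm a b (scaled_pt E0 n 0) n) * normc (pp a b (scaled_pt E0 n 0) n) <= C ->
  - ln ((x%:R ^+ 2 + 2) ^+ 2 * (2 * C + 1)) <=
  \sum_(m < r + r) cell_sup x (cell_index r m) *
    (num_zeros (orthopoly a b n)
      `[E0 + (m%:R - r%:R) / n%:R, E0 + (m%:R + 1 - r%:R) / n%:R]%classic)%:R.
Proof.
move=> a0 n0 C0 x2 xr ne hC; have nR : 0 < n%:R :> R by rewrite ltr0n.
apply: le_trans (sum_log_diff2_ge x%:R a0 n0 C0 hC) _.
apply: (@le_trans _ _ (\sum_(t <- roots_of a b n)
   \sum_(m < r + r) cell_sup x (cell_index r m) *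
     ((m%:R - r%:R <= n%:R * (t - E0) <= m%:R + 1 - r%:R)%R : nat)%:R)).
  rewrite !big_seq; apply: ler_sum => t; rewrite mem_roots_of // => rt.
  apply: log_diff2_le_cells => // j jr; apply: contraNneq (ne j jr) => <-.
  suff -> : E0 + n%:R * (t - E0) / n%:R = t by [].
  by field; rewrite gt_eqF.
rewrite exchange_big /= le_eqVlt; apply/orP; left; apply/eqP.
apply: eq_bigr => m _; rewrite -mulr_sumr num_zerosE // -natr_sum.
congr (_ * _%:R); rewrite -sum1_count [RHS]big_mkcond /=; apply: eq_bigr => t _.
have -> : (E0 + (m%:R - r%:R) / n%:R <= t <= E0 + (m%:R + 1 - r%:R) / n%:R) =
  (m%:R - r%:R <= n%:R * (t - E0) <= m%:R + 1 - r%:R).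
  rewrite -!(lerBrDl _ _ E0) -!(lerBlDl _ E0) ler_pdivrMr // ler_pdivlMr //.
  by rewrite (mulrC n%:R).
by case: (_ && _).
Qed.

End Counting.

(** * Hyperbolic losses along a block *)

Lemma expR_le1D2x (R : realType) (v : R) : 0 <= v -> v <= 1 / 2 ->
  expR v <= 1 + 2 * v.
Proof.
move=> v0 v1; have := expR_ge1Dx (- v); rewrite expRN.
have := expR_gt0 v; move: (expR v) => E E1 hv.
have : (1 - v) * E <= 1 by rewrite -ler_pdivlMr // div1r.
nra.
Qed.

Section Averaging.
Context {R : realType}.
Variables (a b : nat -> R) (M E0 G : R) (n : nat).
Hypotheses (a0 : forall m, 0 < a m) (aM : forall m, a m <= M).
Hypotheses (n0 : (0 < n)%N) (G0 : 0 < G) (Gn : 2 * G <= n%:R).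

Local Notation z := (scaled_pt E0 n 0).
Local Notation t := (m_right a b z).

(** The logarithm of the factor by which |p_k|^2 Im t_k grows at site k + 1. *)
Definition log_loss k : R := ln (1 + n%:R^-1 / Im (t k)).

Definition block_const : R := expR G * (M * (2 * G)) * (1 + M * (2 * G)).

Definition bad_block (a' b' : nat -> R) :=
  block_const < normc (qm a' b' z n) * normc (pp a' b' z n).

Let nR : 0 < n%:R :> R. Proof. by rewrite ltr0n. Qed.
Let z0 : 0 < Im z. Proof. by rewrite /= invr_gt0. Qed.

Lemma log_loss_ge0 k : 0 <= log_loss k.
Proof. by rewrite ln_ge0 // lerDl divr_ge0 ?m_right_ge0 // invr_ge0. Qed.

Lemma log_loss_small k : n%:R * log_loss k.+1 <= G -> 1 <= 2 * G * Im (t k.+1).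
Proof.
have t0 := m_rightS_gt0 b a0 z0 k.
have p0 : 0 < 1 + n%:R^-1 / Im (t k.+1).
  by rewrite addr_gt0 // divr_gt0 // invr_gt0.
rewrite mulrC -ler_pdivlMr // => h.
have : 1 + n%:R^-1 / Im (t k.+1) <= expR (G / n%:R).
  by rewrite -(@lnK _ (1 + n%:R^-1 / _)) ?posrE // ler_expR.
have v0 : 0 <= G / n%:R by rewrite divr_ge0 ?ltW.
have v1 : G / n%:R <= 1 / 2 by rewrite ler_pdivrMr // div1r ler_pdivlMl.
have e := expR_le1D2x v0 v1.
move=> /le_trans/(_ e); rewrite lerD2l.
have -> : 2 * (G / n%:R) = n%:R^-1 * (2 * G) by ring.
by rewrite ler_pM2l ?invr_gt0 // invf_ple ?posrE ?mulr_gt0 // => h'; rewrite -ler_pdivrMl ?mulr_gt0 // mulr1.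
Qed.

(** If the inequality failed, the factors along the block would have product at
    most expR G, and Im t would be at least 1 / (2 G) at two consecutive sites at
    each end. The latter bounds |t| / Im t there ([m_right_norm_le]), and then
    [block_bound] contradicts badness. *)
Lemma bad_blockP j : bad_block (shift j.+2 a) (shift j.+2 b) ->
  G <= \sum_(i < n) log_loss (i + j.+2) +
    n%:R * (log_loss j.+1 + log_loss j.+2 + log_loss (n + j.+1) + log_loss (n + j.+2)).
Proof.
rewrite /bad_block => h; rewrite leNgt; apply/negP => hG; move: h.
apply/negP; rewrite -leNgt.
have S0 : 0 <= \sum_(i < n) log_loss (i + j.+2) by apply: sumr_ge0 => i _; exact: log_loss_ge0.
have l1 := log_loss_ge0 j.+1; have l2 := log_loss_ge0 j.+2.
have l3 := log_loss_ge0 (n + j.+1); have l4 := log_loss_ge0 (n + j.+2).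
have n1 := mulr_ge0 (ltW nR) l1; have n2 := mulr_ge0 (ltW nR) l2.
have n3 := mulr_ge0 (ltW nR) l3; have n4 := mulr_ge0 (ltW nR) l4.
rewrite !mulrDr in hG.
have q1 : 1 <= 2 * G * Im (t j.+1) by apply: log_loss_small; lra.
have q2 : 1 <= 2 * G * Im (t j.+2) by apply: log_loss_small; lra.
have q3 : 1 <= 2 * G * Im (t (n + j.+1)) by rewrite addnS; apply: log_loss_small; rewrite -addnS; lra.
have q4 : 1 <= 2 * G * Im (t (n + j.+2)) by rewrite addnS; apply: log_loss_small; rewrite -addnS; lra.
have M0 : 0 <= M by exact: le_trans (ltW (a0 0%N)) (aM 0%N).
have G20 : 0 <= 2 * G by rewrite mulr_ge0 // ltW.
have MG : 0 <= M * (2 * G) by exact: mulr_ge0.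
have r1 := m_right_norm_le a0 z0 G20 M0 (aM j.+2) q1 q2.
have r2 : normc (t (n + j.+2)) <= M * (2 * G) * Im (t (n + j.+2)).
  by rewrite addnS; apply: m_right_norm_le => //; rewrite -addnS.
have pr : \prod_(i < n) (1 + Im z / Im (t (i + j.+2))) <= expR G.
  have -> : \prod_(i < n) (1 + Im z / Im (t (i + j.+2))) =
      expR (\sum_(i < n) log_loss (i + j.+2)).
    rewrite expR_sum; apply: eq_bigr => i _; rewrite /log_loss lnK // posrE.
    by rewrite ltr_pwDl // divr_ge0 ?m_right_ge0 // ltW.
  by rewrite ler_expR; lra.
rewrite /block_const.
have := @block_bound R a b z a0 z0 j.+1 n.-1 (expR G) (M * (2 * G)) (expR_ge0 G) MG.
by rewrite prednK //; apply.
Qed.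

(** In the sum of [bad_blockP] over j, every loss occurs in at most n blocks, and
    4 times as an end term of weight n. *)
Lemma sum_bad_le K :
  G * \sum_(j < K) (`[< bad_block (shift j.+2 a) (shift j.+2 b) >] : nat)%:R <=
  5 * n%:R * \sum_(k < K + n.+2) log_loss k.+1.
Proof.
pose TL := \sum_(k < K + n.+2) log_loss k.+1.
have part i : (i <= n.+1)%N -> \sum_(j < K) log_loss (i + j.+1) <= TL.
  move=> ni; rewrite /TL (_ : (K + n.+2 = i + (K + (n.+2 - i)))%N); last first.
    by rewrite addnCA subnKC // (leq_trans ni).
  rewrite !big_split_ord /=.
  have e : \sum_(j < K) log_loss (i + j.+1) = \sum_(j < K) log_loss (i + j).+1.
    by apply: eq_bigr => j _; rewrite addnS.
  rewrite e addrCA lerDl addr_ge0 // sumr_ge0 // => j _; exact: log_loss_ge0.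
rewrite mulr_sumr; apply: (@le_trans _ _ (\sum_(j < K)
  (\sum_(i < n) log_loss (i + j.+2) +
    n%:R * (log_loss j.+1 + log_loss j.+2 + log_loss (n + j.+1) + log_loss (n + j.+2))))).
  apply: ler_sum => j _; case: asboolP => [/bad_blockP|_]; rewrite ?mulr1 //= mulr0.
  rewrite addr_ge0 ?mulr_ge0 ?addr_ge0 ?log_loss_ge0 // sumr_ge0 // => i _.
  exact: log_loss_ge0.
rewrite big_split /= exchange_big /= -mulr_sumr !big_split /=.
have p1 := part 0%N isT; have p2 := part 1%N isT.
have p3 := part n (leqnSn n); have p4 := part n.+1 (leqnn _).
have e2 : \sum_(j < K) log_loss j.+2 = \sum_(j < K) log_loss (1 + j.+1) by [].
have e4 : \sum_(j < K) log_loss (n + j.+2) = \sum_(j < K) log_loss (n.+1 + j.+1).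
  by apply: eq_bigr => j _; rewrite addnS.
have s1 : \sum_(i < n) \sum_(j < K) log_loss (i + j.+2) <= n%:R * TL.
  apply: (@le_trans _ _ (\sum_(i < n) TL)); last first.
    by rewrite sumr_const card_ord mulr_natl.
  apply: ler_sum => i _.
  have -> : \sum_(j < K) log_loss (i + j.+2) = \sum_(j < K) log_loss (i.+1 + j.+1).
    by apply: eq_bigr => j _; rewrite addnS.
  by apply: part; rewrite ltnW // ltnS.
have s2 : n%:R * (\sum_(j < K) log_loss j.+1 + \sum_(j < K) log_loss j.+2 +
    \sum_(j < K) log_loss (n + j.+1) + \sum_(j < K) log_loss (n + j.+2)) <= n%:R * (4 * TL).
  rewrite ler_pM2l // e2 e4; have p1' : \sum_(j < K) log_loss j.+1 <= TL by exact: p1.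
  lra.
apply: le_trans (lerD s1 s2) _; rewrite -/TL le_eqVlt; apply/orP; left; apply/eqP.
ring.
Qed.

(** The logarithm of [prod_block_le]. The leading coefficient of p_(K+1) is the
    inverse of a_1 ... a_(K+1); its last factor cancels against a_(K+1). *)
Lemma log_loss_sum_le K :
  \sum_(k < K) log_loss k.+1 <=
    - 2 * \sum_(i < K) ln (a i.+1) +
    \sum_(s <- roots_of a b K.+1) ln (n%:R^-1 ^+ 2 + (s - E0) ^+ 2) + 2 * ln n%:R.
Proof.
have n2 : 0 < n%:R^-1 ^+ 2 :> R by rewrite exprn_gt0 // invr_gt0.
have A0 : 0 < \prod_(i < K) a i.+1 by apply: prodr_gt0.
have lnprod : forall m, ln (\prod_(i < m) a i.+1) = \sum_(i < m) ln (a i.+1).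
  elim=> [|m IH]; first by rewrite !big_ord0 ln1.
  by rewrite !big_ord_recr /= lnM ?IH // posrE ?prodr_gt0.
have lnroots (r : seq R) :
    ln ((\prod_(s <- r) Num.sqrt ((E0 - s) ^+ 2 + n%:R^-1 ^+ 2)) ^+ 2) =
    \sum_(s <- r) ln (n%:R^-1 ^+ 2 + (s - E0) ^+ 2).
  elim: r => [|s r IH]; first by rewrite !big_nil expr1n ln1.
  have p0 : 0 < (E0 - s) ^+ 2 + n%:R^-1 ^+ 2 by rewrite ltr_wpDl // sqr_ge0.
  rewrite !big_cons exprMn lnM ?IH; last 2 first.
  - by rewrite posrE exprn_gt0 // sqrtr_gt0.
  - rewrite posrE exprn_gt0 // prodr_gt0 // => s' _; rewrite sqrtr_gt0.
    by rewrite ltr_wpDl // sqr_ge0.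
  rewrite sqr_sqrtr ?(ltW p0) // (addrC (_ ^+ 2)) (_ : E0 - s = - (s - E0)) ?sqrrN //.
  by rewrite opprB.
have := prod_block_le b a0 z0 K.
have -> : \prod_(i < K) (1 + Im z / Im (t (i + 1))) = expR (\sum_(k < K) log_loss k.+1).
  rewrite expR_sum; apply: eq_bigr => i _; rewrite /log_loss addn1 lnK // posrE.
  by rewrite ltr_pwDl // divr_ge0 ?m_right_ge0 // ltW.
rewrite /scaled_pt normc_pp_roots // mul0r addr0.
have pr0 : 0 < \prod_(s <- roots_of a b K.+1) Num.sqrt ((E0 - s) ^+ 2 + n%:R^-1 ^+ 2).
  apply: prodr_gt0 => s _; rewrite sqrtr_gt0.
  by rewrite ltr_wpDl // sqr_ge0.
move: (\prod_(s <- _) _) pr0 (lnroots (roots_of a b K.+1)) => X X0 lX.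
rewrite big_ord_recr /= => h.
have aK : a K.+1 != 0 by rewrite gt_eqF.
have {}h : expR (\sum_(k < K) log_loss k.+1) <=
   (\prod_(i < K) a i.+1) ^- 2 * X ^+ 2 * n%:R ^+ 2.
  move: h; rewrite (_ : (_ * X) ^+ 2 * a K.+1 ^+ 2 =
    (\prod_(i < K) a i.+1) ^- 2 * X ^+ 2); last first.
    by field; rewrite aK gt_eqF.
  by rewrite mulrC exprVn ler_pdivrMr // exprn_gt0.
move: h; rewrite -ler_ln ?posrE ?expR_gt0 //; last first.
  by rewrite !mulr_gt0 ?invr_gt0 ?exprn_gt0.
have ln3 (u v w : R) : 0 < u -> 0 < v -> 0 < w -> ln (u * v * w) = ln u + ln v + ln w.
  by move=> u0 v0 w0; rewrite !lnM ?posrE ?mulr_gt0.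
rewrite expRK ln3 ?invr_gt0 ?exprn_gt0 // lX.
rewrite lnV ?posrE ?exprn_gt0 // !lnXn // lnprod.
by move=> h; apply: (le_trans h); rewrite le_eqVlt; apply/orP; left; apply/eqP;
  rewrite !mulr2n; ring.
Qed.

End Averaging.

(** * Expectations and stationarity *)

Section Expectation.
Context d (Omega : measurableType d) (R : realType) (P : probability Omega R).
Implicit Types X Y : Omega -> R.

Definition intg X := P.-integrable setT (EFin \o X).
Definition expect X : R := \int[P]_w X w.

Lemma intg_bounded X (C : R) : measurable_fun setT X -> (forall w, `|X w| <= C) ->
  intg X.
Proof.
move=> mX bX; apply: measurable_bounded_integrable => //.
  exact: (le_lt_trans (probability_le1 P measurableT) (ltry _)).
exists C; split; first exact: num_real.
by move=> x Cx w _ /=; apply: le_trans (bX w) (ltW Cx).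
Qed.

Lemma intg_meas X : intg X -> measurable_fun setT X.
Proof. by move=> /integrableP[/measurable_EFinP]. Qed.

Lemma intg_cst (c : R) : intg (fun=> c).
Proof. by apply: (@intg_bounded _ `|c|). Qed.

Lemma intgD X Y : intg X -> intg Y -> intg (fun w => X w + Y w).
Proof. by move=> iX iY; have := integrableD measurableT iX iY. Qed.

Lemma intgZ (c : R) X : intg X -> intg (fun w => c * X w).
Proof. by move=> iX; have := integrableZl measurableT c iX. Qed.

Lemma intg_sum (n : nat) (X : nat -> Omega -> R) : (forall i, intg (X i)) ->
  intg (fun w => \sum_(i < n) X i w).
Proof.
move=> iX; elim: n => [|n IH].
  by rewrite (_ : (fun w => _) = fun=> 0) ?intg_cst //; apply/funext => w; rewrite big_ord0.
rewrite (_ : (fun w => _) = fun w => \sum_(i < n) X i w + X n w).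
  exact: intgD.
by apply/funext => w; rewrite big_ord_recr.
Qed.

Lemma expectD X Y : intg X -> intg Y -> expect (fun w => X w + Y w) = expect X + expect Y.
Proof. by move=> iX iY; rewrite /expect RintegralD. Qed.

Lemma expectZ (c : R) X : intg X -> expect (fun w => c * X w) = c * expect X.
Proof. by move=> iX; rewrite /expect RintegralZl. Qed.

Lemma expect_cst (c : R) : expect (fun=> c) = c.
Proof.
rewrite /expect Rintegral_cst //; transitivity (c * fine (P setT)) => //.
by rewrite probability_setT mulr1.
Qed.

Lemma expect_sum (n : nat) (X : nat -> Omega -> R) : (forall i, intg (X i)) ->
  expect (fun w => \sum_(i < n) X i w) = \sum_(i < n) expect (X i).
Proof.
move=> iX; elim: n => [|n IH].
  rewrite big_ord0 (_ : (fun w => _) = fun=> 0) ?expect_cst //.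
  by apply/funext => w; rewrite big_ord0.
rewrite big_ord_recr /= -IH -expectD //; last exact: intg_sum.
by congr expect; apply/funext => w; rewrite big_ord_recr.
Qed.

Lemma expect_le X Y : intg X -> intg Y -> (forall w, X w <= Y w) -> expect X <= expect Y.
Proof. by move=> iX iY XY; apply: le_Rintegral. Qed.

Lemma expect_indic (A : set Omega) : measurable A ->
  expect (fun w => (`[< A w >] : nat)%:R) = fine (P A) /\
  intg (fun w => (`[< A w >] : nat)%:R).
Proof.
move=> mA; have -> : (fun w => (`[< A w >] : nat)%:R) = \1_A :> (Omega -> R).
  by apply/funext => w; rewrite indicE; congr (nat_of_bool _)%:R; apply/asboolP/idP; rewrite in_setE.
split; last first.
  apply: (@intg_bounded _ 1); first exact: measurable_indic.
  by move=> w; rewrite indicE ger0_norm // lern1 leq_b1.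
by rewrite /expect /Rintegral integral_indic // setIT.
Qed.

Section preserving.
Variable T : Omega -> Omega.
Hypothesis hT : measure_preserving P T.

Lemma iter_preserving k : measure_preserving P (iter k T).
Proof.
have [mT pT] := hT; elim: k => [|k [mk pk]]; first by split => //; exact: measurable_id.
split; first exact: measurableT_comp.
move=> A mA; rewrite -(pT A mA) -(pk (T @^-1` A)) //.
by rewrite -[X in measurable X]setTI; exact: mT.
Qed.

Lemma intg_T X : intg X -> intg (X \o T) /\ expect (X \o T) = expect X.
Proof.
have [mT pT] := hT => iX.
have mX := intg_meas iX.
have eqm (f : Omega -> \bar R) : (\int[pushforward P T]_w f w)%E = (\int[P]_w f w)%E.
  by apply: eq_measure_integral => A mA _; exact: pT.
have iXT : intg (X \o T).
  apply/integrableP; split; first by apply/measurable_EFinP; exact: measurableT_comp.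
  move/integrableP: iX => [_]; rewrite -eqm ge0_integral_pushforward //.
  by apply: measurableT_comp => //; exact/measurable_EFinP.
split => //; rewrite /expect /Rintegral; congr fine.
rewrite -[RHS]eqm integral_pushforward //; exact/measurable_EFinP.
Qed.

End preserving.
End Expectation.

(** * Measurability of solutions and of zero counts *)

Section Measurability.
Context d (Omega : measurableType d) (R : realType).

Definition cmeas (F : Omega -> R[i]) :=
  measurable_fun setT (fun w => Re (F w)) /\
  measurable_fun setT (fun w => Im (F w)).

Lemma cmeas_cst c : cmeas (fun=> c).
Proof. by split. Qed.

Lemma cmeas_real (X : Omega -> R) : measurable_fun setT X -> cmeas (fun w => (X w)%:C).
Proof. by move=> mX; split => //=. Qed.

Lemma cmeasD F G : cmeas F -> cmeas G -> cmeas (fun w => F w + G w).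
Proof.
move=> [f1 f2] [g1 g2]; split.
  rewrite (_ : (fun w => _) = (fun w => Re (F w)) \+ (fun w => Re (G w))).
    exact: measurable_funD.
  by apply/funext => w /=; case: (F w) (G w) => ? ? [].
rewrite (_ : (fun w => _) = (fun w => Im (F w)) \+ (fun w => Im (G w))).
  exact: measurable_funD.
by apply/funext => w /=; case: (F w) (G w) => ? ? [].
Qed.

Lemma cmeasM F G : cmeas F -> cmeas G -> cmeas (fun w => F w * G w).
Proof.
move=> [f1 f2] [g1 g2]; split.
  rewrite (_ : (fun w => _) = ((fun w => Re (F w)) \* (fun w => Re (G w)))
      \- ((fun w => Im (F w)) \* (fun w => Im (G w)))).
    by apply: measurable_funB; exact: measurable_funM.
  by apply/funext => w /=; case: (F w) (G w) => ? ? [].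
rewrite (_ : (fun w => _) = ((fun w => Re (F w)) \* (fun w => Im (G w)))
    \+ ((fun w => Im (F w)) \* (fun w => Re (G w)))).
  by apply: measurable_funD; exact: measurable_funM.
by apply/funext => w /=; case: (F w) (G w) => ? ? [].
Qed.

Lemma cmeas_normc F : cmeas F -> measurable_fun setT (fun w => normc (F w)).
Proof.
move=> [f1 f2].
rewrite (_ : (fun w => _) = Num.sqrt \o
   ((fun w => Re (F w) ^+ 2) \+ (fun w => Im (F w) ^+ 2))).
  apply: measurableT_comp.
    by apply: continuous_measurable_fun => x; exact: sqrt_continuous.
  by apply: measurable_funD; exact: measurable_funX.
by apply/funext => w /=; case: (F w).
Qed.

Lemma measurable_inv_pos (X : Omega -> R) : (forall w, 0 < X w) ->
  measurable_fun setT X -> measurable_fun setT (fun w => (X w)^-1).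
Proof.
move=> X0 mX; rewrite (_ : (fun w => _) = expR \o (\- (@ln R \o X))).
  apply: measurableT_comp; first exact: measurable_expR.
  by apply: measurable_funN; apply: measurableT_comp => //; exact: measurable_ln.
by apply/funext => w /=; rewrite expRN lnK // posrE.
Qed.

Context (P : probability Omega R).
Variables (T : Omega -> Omega) (f g : Omega -> R).
Hypothesis hT : measure_preserving P T.
Hypotheses (mf : measurable_fun setT f) (mg : measurable_fun setT g).
Hypothesis f0 : forall w, 0 < f w.

Local Notation A w := (jacobi_param f T w).
Local Notation B w := (jacobi_param g T w).

Lemma shift_param (h : Omega -> R) k w :
  shift k (jacobi_param h T w) = jacobi_param h T (iter k T w).
Proof. by apply/funext => n; rewrite /shift /jacobi_param iterD. Qed.

Lemma meas_param (h : Omega -> R) k : measurable_fun setT h ->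
  measurable_fun setT (fun w => jacobi_param h T w k).
Proof. by move=> mh; apply: measurableT_comp => //; have [] := iter_preserving hT k. Qed.

Lemma meas_jacobi_iter z v n :
  cmeas (fun w => (jacobi_iter (A w) (B w) z v n).1) /\
  cmeas (fun w => (jacobi_iter (A w) (B w) z v n).2).
Proof.
elim: n => [|n [IH1 IH2]] /=; first by split; exact: cmeas_cst.
have mA : cmeas (fun w => (A w n.+1)%:C) by apply/cmeas_real/meas_param.
have mAi : cmeas (fun w => (A w n.+1)%:C^-1).
  rewrite (_ : (fun w => _) = fun w => ((A w n.+1)^-1)%:C).
    by apply/cmeas_real/measurable_inv_pos => [w|]; [exact: f0|exact: meas_param].
  by apply/funext => w; rewrite fmorphV.
split; last exact: cmeasM.
apply: cmeasM => //; apply: cmeasD.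
  apply: cmeasM => //; apply: cmeasD; first exact: cmeas_cst.
  rewrite (_ : (fun w => _) = fun w => (- B w n.+1)%:C).
    by apply/cmeas_real; apply: measurable_funN; exact: meas_param.
  by apply/funext => w; rewrite rmorphN.
rewrite (_ : (fun w => _) = fun w => (-1)%:C * (jacobi_iter (A w) (B w) z v n).2).
  by apply: cmeasM => //; exact: cmeas_cst.
by apply/funext => w; rewrite rmorphN mulN1r.
Qed.

Lemma meas_pp z n : measurable_fun setT (fun w => normc (pp (A w) (B w) z n)).
Proof. by apply: cmeas_normc; have [] := meas_jacobi_iter z (1, 0) n. Qed.
Lemma meas_pm z n : measurable_fun setT (fun w => normc (pm (A w) (B w) z n)).
Proof. by apply: cmeas_normc; have [] := meas_jacobi_iter z (1, 0) n. Qed.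
Lemma meas_qq z n : measurable_fun setT (fun w => normc (qq (A w) (B w) z n)).
Proof. by apply: cmeas_normc; have [] := meas_jacobi_iter z (0, -1) n. Qed.
Lemma meas_qm z n : measurable_fun setT (fun w => normc (qm (A w) (B w) z n)).
Proof. by apply: cmeas_normc; have [] := meas_jacobi_iter z (0, -1) n. Qed.

Lemma meas_horner_real n (x : R) :
  measurable_fun setT (fun w => (orthopoly (A w) (B w) n).[x]).
Proof.
rewrite (_ : (fun w => _) = fun w => Re (pp (A w) (B w) x%:C n)).
  by have [[]] := meas_jacobi_iter x%:C (1, 0) n.
by apply/funext => w; rewrite -orthopolyE horner_map.
Qed.

Lemma root_meas n (x : R) :
  measurable [set w | root (orthopoly (A w) (B w) n) x].
Proof.
have := meas_horner_real n x; move=> /(_ measurableT [set 0] (measurable_set1 0)).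
by rewrite setTI; congr measurable; apply/seteqP; split => w /=; rewrite rootE; move/eqP.
Qed.

Lemma param_gt0 w m : 0 < A w m. Proof. exact: f0. Qed.

Definition grid (u v : R) (m i : nat) : R := u + (v - u) * i%:R / m%:R.

(** For a polynomial with simple real zeros and a fine grid, a cell has a zero in
    its interior exactly if the values at its ends have opposite signs. Unlike
    the number of zeros, this count is visibly a measurable function of finitely
    many values of the polynomial. *)
Definition sign_count (p : {poly R}) (u v : R) (m : nat) : R :=
  \sum_(i < m) ((p.[grid u v m i] * p.[grid u v m i.+1] < 0)%R : nat)%:R +
  \sum_(i < m.+1) (root p (grid u v m i) : nat)%:R.

Lemma grid_lt u v m i : u < v -> (0 < m)%N -> grid u v m i < grid u v m i.+1.
Proof.
move=> uv m0; rewrite /grid ltrD2l ltr_pM2r ?invr_gt0 ?ltr0n //.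
by rewrite ltr_pM2l ?subr_gt0 // ltr_nat.
Qed.

Lemma grid_cell u v m t k : u < v -> (0 < m)%N ->
  (\sum_(i < k) ((grid u v m i < t < grid u v m i.+1)%R : nat) +
  \sum_(i < k.+1) ((t == grid u v m i)%R : nat))%N =
  ((grid u v m 0 <= t <= grid u v m k)%R : nat) :> nat.
Proof.
move=> uv m0; elim: k => [|k IH].
  rewrite big_ord0 add0n big_ord1; congr nat_of_bool.
  by apply/eqP/idP => [->|/andP[h1 h2]]; [rewrite lexx|apply/le_anti/andP].
rewrite big_ord_recr [X in (_ + X)%N]big_ord_recr /= addnACA IH.
have lt := grid_lt k uv m0.
have le0 : grid u v m 0 <= grid u v m k.
  rewrite /grid mulr0 mul0r addr0 lerDl divr_ge0 // mulr_ge0 // subr_ge0 ltW //.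
have [h1|h1] := leP (grid u v m 0) t; last first.
  have -> : (grid u v m k < t) = false by apply/negbTE; rewrite -leNgt; lra.
  suff -> : (t == grid u v m k.+1) = false by [].
  by apply/negbTE; rewrite lt_eqF //; lra.
have [h2|h2] := leP t (grid u v m k); rewrite /=.
  have -> : (t == grid u v m k.+1) = false by rewrite lt_eqF //; lra.
  by have -> : t <= grid u v m k.+1 by lra.
by rewrite le_eqVlt; case: (eqVneq t) => [->|_]; rewrite ?ltxx //= addn0.
Qed.

Lemma uniq_gap (r : seq R) : uniq r -> exists2 e : R, 0 < e &
  {in r &, forall s t, s != t -> e < `|s - t|}.
Proof.
elim: r => [|x r IH] /=; first by exists 1.
move=> /andP[xr /IH[e e0 he]].
(* Positive distance of x to the remaining elements. *)
have [e' e'0 he'] : exists2 e' : R, 0 < e' & {in r, forall t, e' < `|x - t|}.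
  elim: r xr {IH he} => [|y r IHr]; first by exists 1.
  rewrite inE negb_or => /andP[xy /IHr[e' e'0 he']].
  have p0 : 0 < `|x - y| by rewrite normr_gt0 subr_eq0.
  exists (Num.min e' (`|x - y| / 2)); first by rewrite lt_min e'0 divr_gt0.
  move=> t; rewrite inE => /orP[/eqP ->|/he' h]; rewrite gt_min; apply/orP; last by left.
  by right; lra.
exists (Num.min e e'); first by rewrite lt_min e0.
move=> s t; rewrite !inE => /orP[/eqP ->|sr] /orP[/eqP ->|tr]; rewrite ?eqxx // => st.
- by rewrite gt_min he' // orbT.
- by rewrite distrC gt_min he' // orbT.
- by rewrite gt_min he.
Qed.

Lemma sign_count_cvg w n u v : u < v ->
  (fun m => sign_count (orthopoly (A w) (B w) n) u v m.+1) @ \oo -->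
  ((num_zeros (orthopoly (A w) (B w) n) `[u, v]%classic)%:R : R).
Proof.
move=> uv; set p := orthopoly _ _ _; set r := roots_of (A w) (B w) n.
have [e e0 he] := uniq_gap (roots_of_uniq (A w) (B w) n).
apply: cvg_near_cst.
have ve : 0 < (v - u) / e by rewrite divr_gt0 // subr_gt0.
exists (Num.truncn ((v - u) / e)).+1 => // m /= hm.
have m0 : 0 < m.+1%:R :> R by rewrite ltr0n.
have small i : grid u v m.+1 i.+1 - grid u v m.+1 i < e.
  have -> : grid u v m.+1 i.+1 - grid u v m.+1 i = (v - u) / m.+1%:R.
    by rewrite /grid -[i.+1%:R]natr1; field; rewrite gt_eqF.
  rewrite ltr_pdivrMr // mulrC -ltr_pdivrMr //.
  apply: lt_le_trans (_ : (Num.truncn ((v - u) / e)).+1%:R <= _).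
    by rewrite truncnS_gt.
  by rewrite ler_nat; exact: leqW.
have pE x : p.[x] = (\prod_(i < n) A w i.+1)^-1 * \prod_(t <- r) (x - t).
  rewrite /p (roots_ofE (B w) n (param_gt0 w)).2 hornerZ horner_prod; congr (_ * _).
  by apply: eq_bigr => t _; rewrite !hornerE.
have A0 : 0 < (\prod_(i < n) A w i.+1)^-1.
  by rewrite invr_gt0 prodr_gt0 // => i _; exact: param_gt0.
have cell i : (p.[grid u v m.+1 i] * p.[grid u v m.+1 i.+1] < 0) =
    (\sum_(t <- r) ((grid u v m.+1 i < t < grid u v m.+1 i.+1)%R : nat))%N :> nat.
  set x := grid _ _ _ i; set y := grid _ _ _ i.+1.
  have xy : x < y by exact: grid_lt.
  have -> : p.[x] * p.[y] = (\prod_(i < n) A w i.+1)^-1 ^+ 2 *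
      \prod_(t <- r) ((x - t) * (y - t)).
    by rewrite !pE big_split /=; ring.
  rewrite pmulr_rlt0 ?exprn_gt0 //.
  have [/hasP[t0 t0r ht0]|/hasPn no] := boolP (has (fun t => x < t < y) r).
    have z : (\sum_(t <- r | t != t0) ((x < t < y)%R : nat))%N = 0%N.
      rewrite big1_seq // => t /andP[tt0 tr]; apply/eqP; rewrite eqb0.
      apply/negP => /andP[h1 h2].
      have := he _ _ tr t0r tt0; have := small i; rewrite -/x -/y.
      move/andP: ht0 => [h3 h4] h5 h6.
      have h7 : `|t - t0| < e by rewrite ltr_norml; apply/andP; split; lra.
      by have := lt_trans h6 h7; rewrite ltxx.
    rewrite !(bigD1_seq t0) ?roots_of_uniq //= ht0 z addn0.
    congr nat_of_bool.
    have neg : (x - t0) * (y - t0) < 0 by move/andP: ht0 => [h3 h4]; nra.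
    rewrite nmulr_rlt0 // big_seq_cond prodr_gt0 // => t /andP[tr tt0].
    have := he _ _ tr t0r tt0; have := small i; rewrite -/x -/y.
    move/andP: ht0 => [h3 h4]; rewrite lter_normr.
    by move=> h5 /orP[h|h]; nra.
  rewrite [RHS]big1_seq => [|t /andP[_ /no/negbTE ->]] //.
  apply/eqP; rewrite eqb0 -leNgt big_seq_cond prodr_ge0 // => t /andP[/no h _].
  move: h; rewrite negb_and -!leNgt => /orP[h|h]; nra.
rewrite /sign_count.
under eq_bigr do rewrite cell.
rewrite -!natr_sum -natrD; congr _%:R.
have rootE' i : root p (grid u v m.+1 i) =
    (\sum_(t <- r) ((t == grid u v m.+1 i)%R : nat))%N :> nat.
  rewrite -mem_roots_of //; last exact: param_gt0.
  rewrite -/r -(count_uniq_mem _ (roots_of_uniq _ _ _)) -sum1_count big_mkcond /=.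
  by apply: eq_bigr => t _; case: eqP.
under [X in (_ + X)%N]eq_bigr do rewrite rootE'.
rewrite exchange_big /= [X in (_ + X)%N]exchange_big /= -big_split /=.
rewrite num_zerosE; last exact: param_gt0.
rewrite -/r -sum1_count [RHS]big_mkcond /=; apply: eq_bigr => t _.
rewrite grid_cell // {1}/grid mulr0 mul0r addr0.
have -> : grid u v m.+1 m.+1 = v.
  by rewrite /grid; field; rewrite gt_eqF.
by case: (_ && _).
Qed.

Lemma num_zeros_meas n u v k : u < v ->
  measurable [set w | num_zeros (orthopoly (A w) (B w) n) `[u, v]%classic = k].
Proof.
move=> uv.
have mN : measurable_fun setT (fun w =>
    (num_zeros (orthopoly (A w) (B w) n) `[u, v]%classic)%:R : R).
  apply: (@measurable_fun_cvg _ _ R setT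
    (fun m w => sign_count (orthopoly (A w) (B w) n) u v m.+1)); last first.
    by move=> w _; exact: sign_count_cvg.
  move=> m; apply: measurable_funD; last first.
    apply: measurable_sum => i.
    rewrite (_ : (fun w => _) = \1_[set w | root (orthopoly (A w) (B w) n) (grid u v m.+1 i)]).
      by apply: measurable_indic; exact: root_meas.
    by apply/funext => w; rewrite indicE; congr (nat_of_bool _)%:R; apply/idP/idP; rewrite in_setE.
  apply: measurable_sum => i.
  rewrite (_ : (fun w => _) = \1_[set w | (orthopoly (A w) (B w) n).[grid u v m.+1 i] *
      (orthopoly (A w) (B w) n).[grid u v m.+1 i.+1] < 0]).
    apply: measurable_indic; rewrite -[X in measurable X]setTI.
    have mM := measurable_funM (meas_horner_real n (grid u v m.+1 i))
      (meas_horner_real n (grid u v m.+1 i.+1)).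
    have := mM measurableT `]-oo, 0[%classic (measurable_itv _).
    by congr measurable; apply/seteqP; split => w /=; rewrite in_itv.
  by apply/funext => w; rewrite indicE; congr (nat_of_bool _)%:R; apply/idP/idP; rewrite in_setE.
have := mN measurableT [set k%:R] (measurable_set1 _).
rewrite setTI; congr measurable; apply/seteqP; split => w /=; last by move=> ->.
by move/eqP; rewrite eqr_nat => /eqP.
Qed.

End Measurability.

(** * Transfer matrices without denominators *)

Section Unnormalised.
Context {R : realType}.
Implicit Types (a b : nat -> R) (z : R[i]).

(** The product a_1 ... a_n. Multiplying by it makes the transfer matrices
    polynomial in the parameters, so that no lower bound on f enters the
    estimates. *)
Definition aprod a (n : nat) : R := \prod_(i < n) a i.+1.

Lemma aprod_gt0 a n : (forall m, 0 < a m) -> 0 < aprod a n.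
Proof. by move=> a0; apply: prodr_gt0. Qed.

Lemma aprodS a n : aprod a n.+1 = aprod a n * a n.+1.
Proof. by rewrite /aprod big_ord_recr. Qed.

Lemma aprod_add a k j : aprod a (k + j) = aprod a j * aprod (shift j a) k.
Proof.
elim: k => [|k IH]; first by rewrite /aprod big_ord0 mulr1.
by rewrite addSn !aprodS IH mulrA.
Qed.

Definition unorm a b z v n : R :=
  aprod a n * (normc (jacobi_iter a b z v n).1 + normc (jacobi_iter a b z v n).2).

Definition unorm_tot a b z n : R := unorm a b z (1, 0) n + unorm a b z (0, -1) n.

Lemma unorm_ge0 a b z v n : (forall m, 0 < a m) -> 0 <= unorm a b z v n.
Proof.
by move=> a0; rewrite mulr_ge0 ?(ltW (aprod_gt0 _ a0)) ?addr_ge0 ?normc_ge0.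
Qed.

Lemma unorm0 a b z v : unorm a b z v 0 = normc v.1 + normc v.2.
Proof. by rewrite /unorm /aprod big_ord0 mul1r. Qed.

(** Submultiplicativity: the right-hand factor is the sum of the moduli of all
    entries of the transfer matrix of the last k sites, freed of denominators. *)
Lemma unorm_add a b z v k j : (forall m, 0 < a m) ->
  unorm a b z v (k + j) <=
  unorm a b z v j * unorm_tot (shift j a) (shift j b) z k.
Proof.
move=> a0; rewrite /unorm_tot /unorm aprod_add jacobi_iter_add jacobi_iter_lin.
rewrite -/(pp _ _ _ _) -/(pm _ _ _ _) -/(qq _ _ _ _) -/(qm _ _ _ _).
have A1 := ltW (aprod_gt0 j a0); have A2 := ltW (aprod_gt0 k (shift_gt0 j a0)).
move: (aprod a j) (aprod _ k) A1 A2 => A1 A2 A10 A20.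
move: (jacobi_iter a b z v j) => [x y] /=.
move: (pp _ _ _ _) (pm _ _ _ _) (qq _ _ _ _) (qm _ _ _ _) => p m q r.
have h1 : normc (x * p - y * q) <= normc x * normc p + normc y * normc q.
  by apply: le_trans (le_normcD _ _) _; rewrite normcN !normcM.
have h2 : normc (x * m - y * r) <= normc x * normc m + normc y * normc r.
  by apply: le_trans (le_normcD _ _) _; rewrite normcN !normcM.
move: h1 h2 (normc_ge0 x) (normc_ge0 y) (normc_ge0 p) (normc_ge0 q) (normc_ge0 m) (normc_ge0 r).
move: (normc (_ - _)) (normc (_ - _)) (normc x) (normc y) (normc p) (normc q)
  (normc m) (normc r) => u1 u2 X Y p' q' m' r' h1 h2 X0 Y0 p0 q0 m0 r0.
have -> : A1 * (X + Y) * (A2 * (p' + m') + A2 * (q' + r')) =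
  A1 * A2 * ((X + Y) * (p' + m' + q' + r')) by ring.
rewrite ler_wpM2l ?mulr_ge0 //.
have := mulr_ge0 X0 q0; have := mulr_ge0 X0 r0.
have := mulr_ge0 Y0 p0; have := mulr_ge0 Y0 m0; nra.
Qed.

Lemma unorm_blocks a b z N Q : (forall m, 0 < a m) ->
  unorm a b z (1, 0) (Q * N) <=
  \prod_(q < Q) unorm_tot (shift (q * N) a) (shift (q * N) b) z N.
Proof.
move=> a0; elim: Q => [|Q IH].
  by rewrite mul0n big_ord0 unorm0 normc1 normc0 addr0.
rewrite mulSn big_ord_recr /=; apply: le_trans (unorm_add _ _ _ _ _ a0) _.
rewrite ler_wpM2r // addr_ge0 //; apply: unorm_ge0; exact: shift_gt0.
Qed.

Lemma unorm_bound a b z v M Z n : (forall m, 0 < a m) -> (forall m, a m <= M) ->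
  (forall m, `|b m| <= M) -> normc z <= Z ->
  unorm a b z v n <= (Z + M + 1 + M ^+ 2) ^+ n * (normc v.1 + normc v.2).
Proof.
move=> a0 aM bM zZ.
have M0 : 0 < M by exact: lt_le_trans (a0 0%N) (aM 0%N).
have Z0 : 0 <= Z by exact: le_trans (normc_ge0 _) zZ.
elim: n => [|n IH]; first by rewrite unorm0 mul1r.
rewrite exprS -mulrA; apply: le_trans (_ : (Z + M + 1 + M ^+ 2) * unorm a b z v n <= _); last first.
  by rewrite ler_wpM2l // !addr_ge0 // ?sqr_ge0 // ltW.
rewrite /unorm aprodS /= mulrCA -mulrA.
rewrite ler_wpM2l ?(ltW (aprod_gt0 _ a0)) //.
move: (jacobi_iter a b z v n) => [x y] /=.
have an := a0 n.+1.
rewrite !normcM normcV normc_real gtr0_norm // mulrDr mulrCA mulrV ?unitfE ?gt_eqF // mulr1.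
have h : normc ((z - (b n.+1)%:C) * x - y) <= (Z + M) * normc x + normc y.
  apply: le_trans (le_normcD _ _) _; rewrite normcN lerD2r normcM.
  rewrite ler_wpM2r ?normc_ge0 //; apply: le_trans (le_normcD _ _) _.
  by rewrite normcN normc_real lerD.
have h2 : a n.+1 * (a n.+1 * normc x) <= M ^+ 2 * normc x.
  by rewrite mulrA ler_wpM2r ?normc_ge0 // expr2 ler_pM // ltW.
apply: le_trans (lerD h h2) _.
have := normc_ge0 x; have := normc_ge0 y; have := sqr_ge0 M; nra.
Qed.

(** At a fixed number of sites the entries are polynomials in z with bounded
    coefficients, so moving from height h to the real axis costs O(h), uniformly
    in the parameters. *)
Lemma unorm_lipschitz (M E0 : R) n : 0 < M -> exists2 C : R, 0 <= C &
  forall a b h v, (forall m, 0 < a m) -> (forall m, a m <= M) ->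
  (forall m, `|b m| <= M) -> 0 <= h -> h <= 1 -> normc v.1 + normc v.2 <= 1 ->
  unorm a b (E0 +i* h) v n <= unorm a b (E0%:C) v n + C * h.
Proof.
move=> M0; pose Z := `|E0| + 1; pose c := Z + M + 1 + M ^+ 2.
have c0 : 0 <= c by rewrite !addr_ge0 ?sqr_ge0 // ltW.
suff [C C0 HC] : exists2 C : R, 0 <= C &
  forall a b h v, (forall m, 0 < a m) -> (forall m, a m <= M) ->
  (forall m, `|b m| <= M) -> 0 <= h -> h <= 1 -> normc v.1 + normc v.2 <= 1 ->
  aprod a n * (normc ((jacobi_iter a b (E0 +i* h) v n).1 - (jacobi_iter a b E0%:C v n).1) +
    normc ((jacobi_iter a b (E0 +i* h) v n).2 - (jacobi_iter a b E0%:C v n).2)) <= C * h.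
  exists C => // a b h v a0 aM bM h0 h1 hv.
  rewrite -lerBlDl; apply: le_trans (HC a b h v a0 aM bM h0 h1 hv).
  rewrite /unorm -mulrBr ler_wpM2l ?(ltW (aprod_gt0 _ a0)) //.
  move: (jacobi_iter a b (E0 +i* h) v n) (jacobi_iter a b E0%:C v n) => [x y] [x' y'] /=.
  have e1 : normc x <= normc (x - x') + normc x'.
    by apply: le_trans (le_normcD _ _); rewrite subrK.
  have e2 : normc y <= normc (y - y') + normc y'.
    by apply: le_trans (le_normcD _ _); rewrite subrK.
  lra.
elim: n => [|n [C C0 HC]].
  exists 0 => // a b h v _ _ _ _ _ _.
  by rewrite /= !subrr normc0 addr0 mulr0 mul0r.
exists (c * C + c ^+ n); first by rewrite addr_ge0 ?mulr_ge0 ?exprn_ge0.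
move=> a b h v a0 aM bM h0 h1 hv.
have {HC} := HC a b h v a0 aM bM h0 h1 hv.
have zE : normc (E0%:C : R[i]) <= Z by rewrite normc_real lerDl.
have := @unorm_bound a b E0%:C v M Z n a0 aM bM zE; rewrite -/c => ub.
have {}ub : unorm a b E0%:C v n <= c ^+ n.
  by apply: (le_trans ub); rewrite ler_piMr // exprn_ge0.
move: ub; rewrite /unorm aprodS /=.
have A0 := aprod_gt0 n a0; have an := a0 n.+1.
move: (aprod a n) A0 => A A0.
move: (jacobi_iter a b (E0 +i* h) v n) (jacobi_iter a b E0%:C v n) => [x y] [x' y'] /= ub HC.
have nz : normc (E0 +i* h) <= Z.
  rewrite (_ : E0 +i* h = E0%:C + (0 +i* h)); last by simpc.
  apply: le_trans (le_normcD _ _) _; rewrite normc_real lerD2l /=.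
  by rewrite expr0n add0r sqrtr_sqr ger0_norm.
have aC : (a n.+1)%:C != 0 :> R[i] by exact: realC_neq0.
rewrite [X in normc X + _](_ : _ =
   (((E0 +i* h) - (b n.+1)%:C) * (x - x') + (0 +i* h) * x' - (y - y')) / (a n.+1)%:C); last first.
  rewrite (_ : E0 +i* h = E0%:C + (0 +i* h)); last by simpc.
  by field.
rewrite -mulrBr !normcM normcV normc_real gtr0_norm //.
have k1 : normc (((E0 +i* h) - (b n.+1)%:C) * (x - x') + (0 +i* h) * x' - (y - y'))
    <= (Z + M) * normc (x - x') + h * normc x' + normc (y - y').
  apply: le_trans (le_normcD _ _) _; rewrite normcN lerD2r.
  apply: le_trans (le_normcD _ _) _; rewrite !normcM; apply: lerD.
    rewrite ler_wpM2r ?normc_ge0 //; apply: le_trans (le_normcD _ _) _.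
    by rewrite normcN normc_real lerD.
  by rewrite [normc (0 +i* h)]/= expr0n add0r sqrtr_sqr ger0_norm.
have k2 : a n.+1 * (a n.+1 * normc (x - x')) <= M ^+ 2 * normc (x - x').
  by rewrite mulrA ler_wpM2r ?normc_ge0 // expr2 ler_pM // ltW.
move: k1 k2 ub HC (normc_ge0 (x - x')) (normc_ge0 (y - y')) (normc_ge0 x') (normc_ge0 y').
move: (normc (_ - (y - y'))) (normc (x - x')) (normc (y - y')) (normc x') (normc y').
move=> u dx dy X Y k1 k2 ub HC dx0 dy0 X0 Y0.
have -> : A * a n.+1 * (u / a n.+1 + a n.+1 * dx) = A * (u + a n.+1 * (a n.+1 * dx)).
  by field; rewrite gt_eqF.
apply: (@le_trans _ _ (c * (A * (dx + dy)) + h * (A * (X + Y)))).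
  have -> : c * (A * (dx + dy)) + h * (A * (X + Y)) =
     A * (c * (dx + dy) + h * (X + Y)) by ring.
  rewrite ler_pM2l //; apply: (le_trans (lerD k1 k2)).
  have := mulr_ge0 h0 Y0; have := sqr_ge0 M.
  have : 0 <= Z by exact: addr_ge0.
  rewrite /c; nra.
rewrite [leRHS]mulrDl; apply: lerD.
  by rewrite -mulrA ler_wpM2l.
by rewrite mulrC ler_wpM2r.
Qed.

(** The matrices of the difference equation act on (u_(n+1), u_n) with a_0 = 1,
    those of [jacobi_iter] on (u_n, a_n u_(n-1)) with indices lower by one: the
    second row differs by the factor a_n, and the second column by a sign, as
    the q_n start from (0, -1). *)
Lemma transfer_entries a b (E : R) n : (forall m, 0 < a m) ->
  [/\ (transfer_matrix a b E n 0 0)%:C = pp a b E%:C n,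
      (transfer_matrix a b E n 0 1)%:C = - qq a b E%:C n,
      (set_a0 a n * transfer_matrix a b E n 1 0)%:C = pm a b E%:C n &
      (set_a0 a n * transfer_matrix a b E n 1 1)%:C = - qm a b E%:C n].
Proof.
move=> a0; elim: n => [|n [e1 e2 e3 e4]].
  by rewrite /= !mxE /= !mul1r pp0 qq0 pm0 qm0 opprK oppr0.
have aC : (a n.+1)%:C != 0 :> R[i] by exact: realC_neq0.
rewrite ppS qqS pmS qmS -e1 -e3 -(opprK (qq a b _ n)) -(opprK (qm a b _ n)) -e2 -e4.
have l : lift ord0 ord0 = 1 :> 'I_2 by apply: val_inj.
rewrite /= !mxE !big_ord_recl !big_ord0 !mxE /= !l.
split; rewrite !(rmorphD, rmorphM, rmorphN, rmorphB, rmorph1, rmorph0, fmorphV) /=.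
- by field.
- by field.
- ring.
- ring.
Qed.

Lemma op_norm_entry (A : 'M[R]_2) i j : `|A i j| <= op_norm A.
Proof.
pose v : 'cV[R]_2 := \col_k (k == j)%:R.
have v1 : euclid_norm v <= 1.
  rewrite /euclid_norm (bigD1 j) //= mxE eqxx big1 ?addr0 ?expr1n ?sqrtr1 // => k kj.
  by rewrite mxE (negbTE kj) expr0n.
have Av : (A *m v) i 0 = A i j.
  rewrite mxE (bigD1 j) //= mxE eqxx mulr1 big1 ?addr0 // => k kj.
  by rewrite mxE (negbTE kj) mulr0.
have lo : `|A i j| <= euclid_norm (A *m v).
  rewrite -Av -sqrtr_sqr /euclid_norm ler_sqrt; last by apply: sumr_ge0 => k _; exact: sqr_ge0.
  by rewrite (bigD1 i) //= lerDl sumr_ge0 // => k _; exact: sqr_ge0.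
apply: (le_trans lo); apply: ub_le_sup; last by exists v.
exists (Num.sqrt (\sum_k (\sum_l `|A k l|) ^+ 2)) => _ [u /= u1 <-].
rewrite /euclid_norm ler_sqrt; last by apply: sumr_ge0 => k _; exact: sqr_ge0.
apply: ler_sum => k _; rewrite -[leLHS]real_normK ?num_real //.
rewrite ler_sqr ?nnegrE ?sumr_ge0 // mxE; apply: le_trans (ler_norm_sum _ _ _) _.
apply: ler_sum => l _; rewrite normrM ler_piMr //.
apply: le_trans u1; rewrite -sqrtr_sqr /euclid_norm ler_sqrt; last first.
  by apply: sumr_ge0 => m _; exact: sqr_ge0.
by rewrite (bigD1 l) //= lerDl sumr_ge0 // => m _; exact: sqr_ge0.
Qed.

Lemma unorm_tot_op_norm a b (E M : R) n : (forall m, 0 < a m) ->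
  (forall m, a m <= M) -> 1 <= M ->
  unorm_tot a b E%:C n <= aprod a n * (4 * M * op_norm (transfer_matrix a b E n)).
Proof.
move=> a0 aM M1; have [e1 e2 e3 e4] := transfer_entries b E n a0.
rewrite /unorm_tot /unorm -mulrDr ler_wpM2l ?(ltW (aprod_gt0 _ a0)) //.
rewrite -/(pp _ _ _ _) -/(pm _ _ _ _) -/(qq _ _ _ _) -/(qm _ _ _ _).
rewrite -e1 -e3 -(normcN (qq _ _ _ _)) -(normcN (qm _ _ _ _)) -e2 -e4.
rewrite !normc_real !normrM.
have s0 : 0 < set_a0 a n by case: (n) => [|m] /=.
have sM : set_a0 a n <= M by case: (n) => [|m] /=.
rewrite (gtr0_norm s0).
have h := op_norm_entry (transfer_matrix a b E n).
have h1 := h 0 0; have h2 := h 0 1; have h3 := h 1 0; have h4 := h 1 1.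
have := normr_ge0 (transfer_matrix a b E n 1 0).
have := normr_ge0 (transfer_matrix a b E n 1 1).
have := normr_ge0 (transfer_matrix a b E n 0 0).
move: h1 h2 h3 h4; move: `|_ 0 0| `|_ 0 1| `|_ 1 0| `|_ 1 1| (op_norm _).
move=> x y u v N h1 h2 h3 h4 x0 v0 u0.
have N0 : 0 <= N by exact: le_trans h1.
have k1 : N <= M * N by rewrite ler_peMl.
have k3 : set_a0 a n * u <= M * N by apply: ler_pM => //; exact: ltW.
have k4 : set_a0 a n * v <= M * N by apply: ler_pM => //; exact: ltW.
lra.
Qed.

End Unnormalised.

(** * The logarithmic potential of the density of states *)

Section DOS.
Context {R : realType}.

Lemma zero_measure_integral (p : {poly R}) n (h : R -> R) :
  measurable_fun setT h -> (forall x, 0 <= h x) ->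
  (\int[zero_measure p n]_x (h x)%:E)%E =
  (n%:R^-1 * \sum_(t <- (fset_set (zeros p) : seq R)) h t)%:E.
Proof.
move=> mh h0; rewrite /zero_measure.
have mh' : measurable_fun [set: measurableTypeR R] (EFin \o h) by exact/measurable_EFinP.
rewrite ge0_integral_mscale //=; last by move=> x _; rewrite lee_fin.
rewrite ge0_integral_measure_sum //; last by move=> x _; rewrite lee_fin.
rewrite EFinM; congr (_ * _)%E.
rewrite (big_nth 0) big_mkord -sumEFin; apply: eq_bigr => i _.
by rewrite integral_dirac // diracT mul1e.
Qed.

Variables (E0 W : R).
Hypothesis W1 : 1 <= W.

(** The square of the distance to E0, capped at W so that the test functions below
    are bounded on the whole line. For W large enough the cap is invisible on the
    zeros of the p_n ([root_capped_sqr]). *)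
Definition capped_sqr (x : R) : R := Num.min ((x - E0) ^+ 2) W.

Lemma capped_sqr_ge0 x : 0 <= capped_sqr x.
Proof. by rewrite le_min sqr_ge0 /= (le_trans ler01). Qed.

Lemma capped_sqr_le x : capped_sqr x <= W.
Proof. by rewrite ge_min lexx orbT. Qed.

Definition reg_log (h x : R) : R := ln (1 + capped_sqr x / h ^+ 2).

Lemma reg_log_arg h x : 0 < h -> 1 <= 1 + capped_sqr x / h ^+ 2.
Proof. by move=> h0; rewrite lerDl divr_ge0 ?capped_sqr_ge0 ?sqr_ge0. Qed.

Lemma reg_log_ge0 h x : 0 < h -> 0 <= reg_log h x.
Proof. by move=> h0; rewrite ln_ge0 // reg_log_arg. Qed.

Lemma reg_log_le h x : 0 < h -> reg_log h x <= ln (1 + W / h ^+ 2).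
Proof.
move=> h0; have h2 : 0 < h ^+ 2 by rewrite exprn_gt0.
have a1 := reg_log_arg x h0.
rewrite ler_ln ?posrE.
- by rewrite lerD2l ler_pM2r ?invr_gt0 // capped_sqr_le.
- by rewrite (lt_le_trans ltr01).
- by rewrite ltr_pwDl // divr_ge0 ?(ltW h2) // (le_trans ler01).
Qed.

Lemma reg_log_bounded h x : 0 < h -> `|reg_log h x| <= ln (1 + W / h ^+ 2).
Proof. by move=> h0; rewrite ger0_norm ?reg_log_ge0 ?reg_log_le. Qed.

Lemma capped_sqr_cont : continuous capped_sqr.
Proof.
move=> x; apply: (@continuous_min R R (fun x => (x - E0) ^+ 2 : R^o) (fun=> W : R^o) x).
  apply: (@continuous_comp _ _ _ (fun x : R => x - E0) (fun x : R => x ^+ 2)).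
    by apply: cvgB; [exact: cvg_id|exact: cvg_cst].
  exact: exprn_continuous.
exact: cvg_cst.
Qed.

Lemma reg_log_cont h : 0 < h -> continuous (reg_log h).
Proof.
move=> h0 x; rewrite /reg_log.
have a1 := reg_log_arg x h0.
apply: (@continuous_comp _ _ _ (fun x => 1 + capped_sqr x / h ^+ 2) (@ln R)); last first.
  by apply: continuous_ln; exact: lt_le_trans a1.
apply: cvgD; first exact: cvg_cst.
by apply: cvgMr_tmp; exact: capped_sqr_cont.
Qed.

Lemma reg_log_meas h : 0 < h -> measurable_fun setT (reg_log h).
Proof. by move=> h0; apply: continuous_measurable_fun; exact: reg_log_cont. Qed.

Variable nu : probability (measurableTypeR R) R.

(** Up to the cap, this is the integral of ln (h^2 + (x - E0)^2): twice the
    logarithmic potential of nu at E0 + i h. *)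
Definition log_potential (h : R) : R := expect nu (reg_log h) + 2 * ln h.

Lemma reg_log_intg h : 0 < h -> intg nu (reg_log h).
Proof.
by move=> h0; apply: (@intg_bounded _ _ _ _ _ (ln (1 + W / h ^+ 2)));
  [exact: reg_log_meas|move=> x; exact: reg_log_bounded].
Qed.

Definition poisson_ker (t x : R) : R := t ^+ 2 / (t ^+ 2 + capped_sqr x).

Lemma poisson_ker_bound t x : 0 < t -> 0 <= poisson_ker t x <= 1.
Proof.
move=> t0; have t2 : 0 < t ^+ 2 by rewrite exprn_gt0.
have s0 := capped_sqr_ge0 x; have d0 : 0 < t ^+ 2 + capped_sqr x by rewrite ltr_pwDl.
apply/andP; split; first by rewrite divr_ge0 // ltW.
by rewrite /poisson_ker ler_pdivrMr // mul1r lerDl.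
Qed.

Lemma poisson_ker_intg t : 0 < t -> intg nu (poisson_ker t).
Proof.
move=> t0; apply: (@intg_bounded _ _ _ _ _ 1); last first.
  by move=> x; have /andP[j0 j1] := poisson_ker_bound x t0; rewrite ger0_norm.
have t2 : 0 < t ^+ 2 by rewrite exprn_gt0.
apply: continuous_measurable_fun => x.
apply: cvgM; first exact: cvg_cst.
have d0 : 0 < t ^+ 2 + capped_sqr x by rewrite ltr_pwDl // capped_sqr_ge0.
apply: cvgV; first by rewrite gt_eqF.
by apply: cvgD; [exact: cvg_cst|exact: capped_sqr_cont].
Qed.

(** The integrand grows by ln ((4 t^2 + s) / (t^2 + s)) = ln (1 + 3 t^2 / (t^2 + s)),
    where s is the capped squared distance to E0; then ln (1 + y) <= y. *)
Lemma log_potential_double t : 0 < t ->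
  log_potential (2 * t) - log_potential t <= 3 * expect nu (poisson_ker t).
Proof.
move=> t0; have tt0 : 0 < 2 * t by rewrite mulr_gt0.
have i1 := reg_log_intg tt0; have i2 := reg_log_intg t0; have i3 := poisson_ker_intg t0.
rewrite -(expectZ 3 i3).
have -> : log_potential (2 * t) - log_potential t = expect nu (fun x => (reg_log (2 * t) x + (-1) * reg_log t x) + 2 * ln 2).
  rewrite expectD; [|by apply: intgD => //; exact: intgZ|exact: intg_cst].
  rewrite expectD //; last exact: intgZ.
  rewrite (expectZ (-1)) // expect_cst /log_potential lnM ?posrE //; ring.
apply: expect_le.
- by apply: intgD; [apply: intgD => //; exact: intgZ|exact: intg_cst].
- exact: intgZ.
move=> x; have t2 : 0 < t ^+ 2 by rewrite exprn_gt0.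
have s0 := capped_sqr_ge0 x; have d0 : 0 < t ^+ 2 + capped_sqr x by rewrite ltr_pwDl.
have d1 : 0 < 4 * t ^+ 2 + capped_sqr x by rewrite ltr_pwDl // mulr_gt0.
have e1 : reg_log (2 * t) x + 2 * ln 2 = ln ((4 * t ^+ 2 + capped_sqr x) / t ^+ 2).
  rewrite /reg_log (_ : 2 * ln 2 = ln 4); last first.
    by rewrite (_ : 4 = 2 ^+ 2 :> R) ?lnXn // ?mulr_natl //; ring.
  have k1 := reg_log_arg x tt0.
  rewrite -lnM ?posrE //; last exact: lt_le_trans k1.
  by congr ln; field; rewrite gt_eqF.
have e2 : reg_log t x = ln ((t ^+ 2 + capped_sqr x) / t ^+ 2).
  by rewrite /reg_log; congr ln; field; rewrite gt_eqF.
rewrite mulN1r addrAC e1 e2 -ln_div ?posrE ?divr_gt0 //.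
have -> : (4 * t ^+ 2 + capped_sqr x) / t ^+ 2 / ((t ^+ 2 + capped_sqr x) / t ^+ 2) = 1 + 3 * poisson_ker t x.
  by rewrite /poisson_ker; field; rewrite !gt_eqF.
have /andP[j0 j1] := poisson_ker_bound x t0.
by apply: le_ln1Dx; lra.
Qed.

Definition sym_mass (r : R) : R := fine (nu `]E0 - r, E0 + r[%classic).

Lemma sym_mass_le1 r : sym_mass r <= 1.
Proof.
have h := probability_le1 nu (measurable_itv `]E0 - r, E0 + r[).
rewrite /sym_mass -lee_fin fineK // ge0_fin_numE ?measure_ge0 //.
exact: le_lt_trans h (ltry 1).
Qed.

(** Near 0 by the existence of a finite symmetric derivative, and elsewhere because
    the total mass is 1. *)
Lemma sym_mass_linear D : is_symmetric_derivative nu E0 D ->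
  exists2 c : R, 0 < c & forall r, 0 < r -> sym_mass r <= c * r.
Proof.
move=> hD; have lt : D < `|D| + 1 by rewrite (le_lt_trans (ler_norm D)) // ltrDl.
rewrite /is_symmetric_derivative in hD; have [e /= e0 he] := @cvgr_lt R R _ _ _ _ hD _ lt.
exists (2 * (`|D| + 1) + e^-1).
  by rewrite addr_gt0 ?invr_gt0 // mulr_gt0 // ltr_wpDl.
move=> r r0; have [re|re] := ltP r e.
  have : fine (nu `]E0 - r, E0 + r[%classic) / (2 * r) < `|D| + 1.
    by apply: he => //=; rewrite sub0r normrN gtr0_norm.
  rewrite ltr_pdivrMr ?mulr_gt0 // -/(sym_mass r) => h.
  have : 0 <= e^-1 * r by rewrite mulr_ge0 ?invr_ge0 ?ltW.
  lra.
apply: le_trans (sym_mass_le1 r) _.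
have h1 : 1 <= e^-1 * r by rewrite ler_pdivlMl // mulr1.
have : 0 <= (`|D| + 1) * r by rewrite mulr_ge0 ?addr_ge0 // ltW.
lra.
Qed.

(** Outside ]E0 - 2 t, E0 + 2 t[ the squared distance is at least 4 t^2, and there
    the kernel at scale t is at most 2/5 of the kernel at scale 2 t. *)
Lemma poisson_ker_recursion t : 0 < t -> 2 * t <= 1 ->
  expect nu (poisson_ker t) <= sym_mass (2 * t) + 2 / 5 * expect nu (poisson_ker (2 * t)).
Proof.
move=> t0 t1; have tt0 : 0 < 2 * t by rewrite mulr_gt0.
have mI : measurable (`]E0 - 2 * t, E0 + 2 * t[%classic : set (measurableTypeR R)).
  exact: measurable_itv.
have [e i1] := expect_indic nu mI.
have i2 := poisson_ker_intg t0; have i3 := poisson_ker_intg tt0.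
rewrite /sym_mass -e -(expectZ (2 / 5) i3) -expectD //; last exact: intgZ.
apply: expect_le => //; first by apply: intgD => //; exact: intgZ.
move=> x; have /andP[j0 j1] := poisson_ker_bound x t0.
have /andP[k0 k1] := poisson_ker_bound x tt0.
case: asboolP => [_|hx]; first by rewrite (le_trans j1) // lerDl mulr_ge0.
rewrite add0r.
have hx' : 2 * t <= `|x - E0|.
  rewrite leNgt; apply/negP => h; apply: hx; rewrite /= in_itv /=.
  by move: h; rewrite ltr_norml => /andP[h1 h2]; apply/andP; split; lra.
have hs : (2 * t) ^+ 2 <= capped_sqr x.
  rewrite le_min; apply/andP; split.
    by rewrite -[leRHS]real_normK ?num_real // ler_sqr ?nnegrE // ltW.
  by apply: le_trans W1; rewrite expr_le1 // ltW.
have t2 : 0 < t ^+ 2 by rewrite exprn_gt0.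
move: hs; rewrite /poisson_ker !exprMn; move: (capped_sqr x) (capped_sqr_ge0 x) (t ^+ 2) t2 => s s0 u u0 hs.
have d0 : 0 < u + s by rewrite ltr_pwDl.
have d1 : 0 < 2 ^+ 2 * u + s by rewrite ltr_pwDl // mulr_gt0 // exprn_gt0.
rewrite mulrA ler_pdivlMr // mulrAC ler_pdivrMr //.
rewrite -subr_ge0 (_ : _ - _ = u * (3 / 5 * (s - 2 ^+ 2 * u))); last by field.
by rewrite !mulr_ge0 ?(ltW u0) // subr_ge0.
Qed.

(** Iterating [poisson_ker_recursion] up to a scale of order 1 converges, because
    2/5 times the factor 2 lost in the scale is smaller than 1. *)
Lemma poisson_ker_linear D : is_symmetric_derivative nu E0 D ->
  exists2 K : R, 0 <= K & forall t, 0 < t -> expect nu (poisson_ker t) <= K * t.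
Proof.
move=> /sym_mass_linear [c c0 hc].
pose K := 10 * c + 2; exists K; first by rewrite /K; lra.
suff H k : forall t, 0 < t -> 1 <= 2 * 2 ^+ k * t -> expect nu (poisson_ker t) <= K * t.
  move=> t t0; pose k := Num.truncn t^-1.
  apply: (H k.+1) => //.
  have h : t^-1 <= k.+1%:R by rewrite ltW // truncnS_gt.
  have h2 : k.+1%:R <= 2 ^+ k.+1 :> R by rewrite -natrX ler_nat ltnW // ltn_expl.
  have h3 : 1 <= 2 ^+ k.+1 * t.
    by rewrite -ler_pdivrMr // div1r; exact: le_trans h h2.
  have : 0 <= 2 ^+ k.+1 * t by rewrite (le_trans ler01).
  rewrite -mulrA; lra.
elim: k => [|k IH] t t0 ht.
  apply: (@le_trans _ _ 1).
    rewrite -[leRHS](expect_cst nu); apply: expect_le; [exact: poisson_ker_intg|exact: intg_cst|].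
    by move=> x; have /andP[] := poisson_ker_bound x t0.
  rewrite expr0 mulr1 in ht; rewrite /K; have := mulr_gt0 c0 t0; nra.
have [t1|t1] := leP (2 * t) 1; last first.
  apply: (@le_trans _ _ 1).
    rewrite -[leRHS](expect_cst nu); apply: expect_le; [exact: poisson_ker_intg|exact: intg_cst|].
    by move=> x; have /andP[] := poisson_ker_bound x t0.
  rewrite /K; have := mulr_gt0 c0 t0; nra.
have tt0 : 0 < 2 * t by rewrite mulr_gt0.
have h2 : expect nu (poisson_ker (2 * t)) <= K * (2 * t).
  by apply: IH => //; move: ht; rewrite exprS; congr (_ <= _); ring.
apply: le_trans (poisson_ker_recursion t0 t1) _.
have := hc _ tt0; rewrite /K in h2 *; have := mulr_gt0 c0 t0; lra.
Qed.

(** Summing [log_potential_double] over the dyadic heights below h gives a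
    geometric series. *)
Lemma log_potential_linear D : is_symmetric_derivative nu E0 D ->
  exists2 K : R, 0 <= K &
    forall h k, 0 < h -> log_potential h - log_potential (h / 2 ^+ k) <= K * h.
Proof.
move=> /poisson_ker_linear [K K0 hK]; exists (3 * K); first by rewrite mulr_ge0.
move=> h k h0; suff : log_potential h - log_potential (h / 2 ^+ k) <= 3 * K * (h - h / 2 ^+ k).
  move/le_trans; apply; rewrite ler_wpM2l ?mulr_ge0 // gerBl.
  by rewrite divr_ge0 ?(ltW h0) // exprn_ge0.
elim: k => [|k IH]; first by rewrite expr0 divr1 !subrr mulr0.
pose t := h / 2 ^+ k.+1.
have t0 : 0 < t by rewrite divr_gt0 // exprn_gt0.
have e : h / 2 ^+ k = 2 * t.
  by rewrite /t exprS; field; rewrite expf_neq0.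
have := log_potential_double t0; have := hK t t0; rewrite -/t; rewrite e in IH.
lra.
Qed.

End DOS.

(** * Half of the Thouless formula *)

Section Dominated.
Context d (Omega : measurableType d) (R : realType) (P : probability Omega R).

Lemma expect_dct (X : nat -> Omega -> R) (C c : R) :
  (forall n, measurable_fun setT (X n)) -> (forall n w, `|X n w| <= C) ->
  {ae P, forall w, X n w @[n --> \oo] --> c} ->
  expect P (X n) @[n --> \oo] --> c.
Proof.
move=> mX bX cX.
have D := @dominated_convergence _ _ _ P setT measurableT
  (fun n => EFin \o X n) (EFin \o cst c) (EFin \o cst C).
have [_ _] : [/\ P.-integrable setT (EFin \o cst c),
  [sequence (\int[P]_x `|(X n x)%:E - c%:E|)%E]_n @ \oo --> 0%E &
  [sequence (\int[P]_x (X n x)%:E)%E]_n @ \oo --> (\int[P]_x c%:E)%E].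
  apply: D.
  - by move=> n; apply/measurable_EFinP.
  - by apply/measurable_EFinP.
  - by apply: filterS cX => w h _; apply: cvg_EFin => //; exact: nearW.
  - exact: intg_cst.
  - by apply: aeW => w n _ /=; rewrite lee_fin.
rewrite (_ : (\int[P]_x c%:E)%E = c%:E); last first.
  rewrite integral_cst //; transitivity (c%:E * P setT)%E => //.
  by rewrite probability_setT mule1.
by move=> /fine_cvg.
Qed.

End Dominated.

Section Thouless.
Context d (Omega : measurableType d) (R : realType) (P : probability Omega R).
Variables (T : Omega -> Omega) (f g : Omega -> R).
Hypothesis hT : measure_preserving P T.
Hypotheses (mf : measurable_fun setT f) (mg : measurable_fun setT g).
Hypothesis f0 : forall w, 0 < f w.
Variables (M E0 : R).
Hypotheses (M1 : 1 <= M) (fM : forall w, f w <= M) (gM : forall w, `|g w| <= M).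
Variable nu : probability (measurableTypeR R) R.
Hypothesis hnu : is_density_of_states P T f g nu.

Local Notation A w := (jacobi_param f T w).
Local Notation B w := (jacobi_param g T w).

Let A0 w m : 0 < A w m. Proof. exact: f0. Qed.
Let AM w m : A w m <= M. Proof. exact: fM. Qed.
Let BM w m : `|B w m| <= M. Proof. exact: gM. Qed.

(** All zeros of the p_n lie within 3 M of 0 ([roots_bounded]). *)
Definition cap : R := (3 * M + `|E0|) ^+ 2 + 1.

Lemma cap_ge1 : 1 <= cap. Proof. by rewrite lerDr sqr_ge0. Qed.

Local Notation k_ := (reg_log E0 cap).
Local Notation Ph := (log_potential E0 cap nu).

Definition root_avg K h w : R :=
  K%:R^-1 * \sum_(t <- roots_of (A w) (B w) K) k_ h t.

Lemma root_capped_sqr w K t : t \in roots_of (A w) (B w) K -> capped_sqr E0 cap t = (t - E0) ^+ 2.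
Proof.
move=> /(roots_bounded (A0 w) (AM w) (BM w)) ht; rewrite /capped_sqr; apply/min_idPl.
apply: (@le_trans _ _ ((3 * M + `|E0|) ^+ 2)); last by rewrite lerDl.
rewrite -[leLHS]real_normK ?num_real // ler_sqr ?nnegrE //; last first.
  by rewrite addr_ge0 // mulr_ge0 // (le_trans ler01).
by apply: le_trans (ler_normB _ _) _; rewrite lerD2r ltW.
Qed.

Lemma root_log_sum K h w : 0 < h ->
  \sum_(t <- roots_of (A w) (B w) K) ln (h ^+ 2 + (t - E0) ^+ 2) =
  \sum_(t <- roots_of (A w) (B w) K) k_ h t + K%:R * (2 * ln h).
Proof.
move=> h0; have h2 : 0 < h ^+ 2 by rewrite exprn_gt0.
have -> : K%:R * (2 * ln h) = \sum_(t <- roots_of (A w) (B w) K) (2 * ln h).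
  by rewrite big_const_seq count_predT (roots_ofE (B w) K (A0 w)).1 iter_addr_0 mulr_natl.
rewrite -big_split /= !big_seq; apply: eq_bigr => t tr.
rewrite /reg_log (root_capped_sqr tr) mulr_natl -lnXn // -lnM ?posrE //.
  by congr ln; field; rewrite gt_eqF.
by rewrite ltr_pwDl // divr_ge0 ?sqr_ge0.
Qed.

Lemma root_log_prod K h w : 0 < h ->
  \sum_(t <- roots_of (A w) (B w) K) ln (h ^+ 2 + (t - E0) ^+ 2) =
  2 * ln (aprod (A w) K * normc (pp (A w) (B w) (E0 +i* h) K)).
Proof.
move=> h0; have h2 : 0 < h ^+ 2 by rewrite exprn_gt0.
rewrite normc_pp_roots // mulrA /aprod mulfV ?mul1r; last first.
  by rewrite gt_eqF // prodr_gt0.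
elim: (roots_of _ _ _) => [|t r IH]; first by rewrite !big_nil ln1 mulr0.
have p0 s : 0 < (E0 - s) ^+ 2 + h ^+ 2 by rewrite ltr_wpDl // sqr_ge0.
rewrite !big_cons IH lnM ?posrE ?sqrtr_gt0 //; last first.
  by apply: prodr_gt0 => s _; rewrite sqrtr_gt0.
rewrite mulrDr; congr (_ + _).
rewrite mulr_natl -lnXn ?sqrtr_gt0 // sqr_sqrtr ?(ltW (p0 t)) //.
by rewrite addrC -[in LHS]opprB sqrrN.
Qed.

Lemma root_avg_bounded K h w : 0 < h -> `|root_avg K h w| <= ln (1 + cap / h ^+ 2).
Proof.
move=> h0; rewrite /root_avg normrM.
have b0 : 0 <= ln (1 + cap / h ^+ 2) by exact: le_trans (normr_ge0 _) (reg_log_bounded E0 cap_ge1 0 h0).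
have [->|K0] := posnP K; first by rewrite invr0 normr0 mul0r.
have KR : 0 < K%:R :> R by rewrite ltr0n.
rewrite gtr0_norm ?invr_gt0 // ler_pdivrMl //.
apply: le_trans (ler_norm_sum _ _ _) _.
apply: (@le_trans _ _ (\sum_(t <- roots_of (A w) (B w) K) ln (1 + cap / h ^+ 2))).
  by apply: ler_sum => t _; exact: (reg_log_bounded E0 cap_ge1 t h0).
by rewrite big_const_seq count_predT (roots_ofE (B w) K (A0 w)).1 iter_addr_0 mulr_natl.
Qed.

Lemma aprod_meas K : measurable_fun setT (fun w => aprod (A w) K).
Proof. by apply: measurable_prod => i _; exact: (meas_param hT _ mf). Qed.

Lemma root_avg_meas K h : 0 < h -> measurable_fun setT (root_avg K h).
Proof.
move=> h0; rewrite (_ : root_avg K h = fun w => K%:R^-1 *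
  (2 * ln (aprod (A w) K * normc (pp (A w) (B w) (E0 +i* h) K)) - K%:R * (2 * ln h))).
  apply: measurable_funM => //; apply: measurable_funB => //.
  apply: measurable_funM => //; apply: measurableT_comp; first exact: measurable_ln.
  by apply: measurable_funM; [exact: aprod_meas|exact: (meas_pp hT mf mg f0)].
by apply/funext => w; rewrite -root_log_prod // root_log_sum // addrK.
Qed.

Lemma root_avg_intg K h : 0 < h -> intg P (root_avg K h).
Proof.
by move=> h0; apply: intg_bounded; [exact: root_avg_meas|move=> w; exact: root_avg_bounded].
Qed.

(** Weak convergence to the density of states tests [reg_log], which is bounded
    and continuous, and the averages are bounded uniformly in K and w. *)
Lemma root_avg_cvg h : 0 < h ->
  expect P (root_avg K h) @[K --> \oo] --> expect nu (k_ h).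
Proof.
move=> h0; apply: expect_dct.
- by move=> n; exact: root_avg_meas.
- by move=> n w; exact: root_avg_bounded.
apply: filterS hnu => w /(_ (k_ h) (reg_log_cont cap_ge1 h0)) H.
have {}H : (\int[zero_measure (erg_orthopoly T f g w n) n]_x (k_ h x)%:E)%E
    @[n --> \oo] --> (\int[nu]_x (k_ h x)%:E)%E.
  apply: H; exists (ln (1 + cap / h ^+ 2)); split; first exact: num_real.
  by move=> x Cx y _ /=; apply: le_trans (ltW Cx); exact: (reg_log_bounded E0 cap_ge1 y h0).
have e1 n : (\int[zero_measure (erg_orthopoly T f g w n) n]_x (k_ h x)%:E)%E =
    (root_avg n h w)%:E.
  apply: zero_measure_integral; first by apply: reg_log_meas h0; exact: cap_ge1.
  by move=> x; apply: reg_log_ge0 h0; exact: cap_ge1.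
have e2 : (\int[nu]_x (k_ h x)%:E)%E = (expect nu (k_ h))%:E.
  rewrite /expect /Rintegral fineK //.
  apply: integrable_fin_num => //.
  by apply: reg_log_intg h0; exact: cap_ge1.
move: H; under eq_fun do rewrite e1.
by rewrite e2 => /fine_cvg.
Qed.

Lemma expect_iter X j : intg P X -> intg P (fun w => X (iter j T w)) /\
  expect P (fun w => X (iter j T w)) = expect P X.
Proof. by move=> iX; exact: (intg_T (iter_preserving hT j) iX). Qed.

(** Truncating from below keeps the logarithm bounded, although f may come
    arbitrarily close to 0. *)
Definition block_max (tau : R) (z : R[i]) N w : R :=
  Num.max (unorm_tot (A w) (B w) z N) tau.

Section block.
Variables (tau : R) (N : nat).
Hypothesis tau0 : 0 < tau.

Lemma block_max_gt0 z w : 0 < block_max tau z N w.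
Proof. by rewrite /block_max lt_max tau0 orbT. Qed.

Lemma unorm_tot_meas z : measurable_fun setT (fun w => unorm_tot (A w) (B w) z N).
Proof.
apply: measurable_funD.
  apply: measurable_funM; first exact: aprod_meas.
  apply: measurable_funD; first exact: (meas_pp hT mf mg f0).
  exact: (meas_pm hT mf mg f0).
apply: measurable_funM; first exact: aprod_meas.
apply: measurable_funD; first exact: (meas_qq hT mf mg f0).
exact: (meas_qm hT mf mg f0).
Qed.

Definition growth : R := `|E0| + 1 + M + 1 + M ^+ 2.

Lemma growth_ge1 : 1 <= growth.
Proof.
have m1 := M1; have := normr_ge0 E0; have := sqr_ge0 M; rewrite /growth => h1 h2; lra.
Qed.

Lemma unorm_tot_le z w : normc z <= `|E0| + 1 ->
  unorm_tot (A w) (B w) z N <= 2 * growth ^+ N.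
Proof.
move=> hz; rewrite mulr_natl mulr2n; apply: lerD.
  apply: le_trans (unorm_bound (1, 0) N (A0 w) (AM w) (BM w) hz) _.
  by rewrite normc1 normc0 addr0 mulr1.
apply: le_trans (unorm_bound (0, -1) N (A0 w) (AM w) (BM w) hz) _.
by rewrite normcN normc1 normc0 add0r mulr1.
Qed.

Hypothesis tau1 : tau <= 1.

Lemma block_max_le z w : normc z <= `|E0| + 1 ->
  block_max tau z N w <= 2 * growth ^+ N.
Proof.
move=> hz; rewrite ge_max unorm_tot_le //=; apply: (le_trans tau1).
have : 1 <= growth ^+ N by rewrite exprn_ege1 // growth_ge1.
lra.
Qed.

Lemma block_ln_intg z : normc z <= `|E0| + 1 -> intg P (fun w => ln (block_max tau z N w)).
Proof.
move=> hz; apply: (@intg_bounded _ _ _ _ _ (`|ln tau| + `|ln (2 * growth ^+ N)|)).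
  apply: measurableT_comp; first exact: measurable_ln.
  by apply: measurable_maxr => //; exact: unorm_tot_meas.
move=> w; have b0 := block_max_gt0 z w.
have h1 : ln tau <= ln (block_max tau z N w).
  by rewrite ler_ln ?posrE // /block_max le_max lexx orbT.
have g0 : 0 < growth ^+ N by rewrite exprn_gt0 // (lt_le_trans ltr01 growth_ge1).
have h2 : ln (block_max tau z N w) <= ln (2 * growth ^+ N).
  by rewrite ler_ln ?posrE ?mulr_gt0 // block_max_le.
have := ler_norm (ln (2 * growth ^+ N)); have := ler_norm (- ln tau).
have := normr_ge0 (ln (2 * growth ^+ N)); have := normr_ge0 (ln tau).
rewrite normrN => n1 n2 n3 n4.
by rewrite ler_norml; apply/andP; split; lra.
Qed.

Hypothesis N0 : (0 < N)%N.

Lemma root_avg_block h w Q : 0 < h -> (0 < Q)%N ->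
  (Q * N)%:R * (root_avg (Q * N) h w + 2 * ln h) <=
  2 * \sum_(q < Q) ln (block_max tau (E0 +i* h) N (iter (q * N) T w)).
Proof.
move=> h0 Q0; have QN : (0 < Q * N)%N by rewrite muln_gt0 Q0.
have QNR : 0 < (Q * N)%:R :> R by rewrite ltr0n.
have -> : (Q * N)%:R * (root_avg (Q * N) h w + 2 * ln h) =
    \sum_(t <- roots_of (A w) (B w) (Q * N)) ln (h ^+ 2 + (t - E0) ^+ 2).
  by rewrite root_log_sum // mulrDr /root_avg mulVKf // gt_eqF.
rewrite root_log_prod //.
rewrite ler_pM2l //.
set z := E0 +i* h.
have p0 : pp (A w) (B w) z (Q * N) != 0 by exact: pp_neq0.
have lnprod (F : nat -> R) m : (forall i, 0 < F i) ->
    ln (\prod_(i < m) F i) = \sum_(i < m) ln (F i).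
  move=> F0; elim: m => [|m IH]; first by rewrite !big_ord0 ln1.
  by rewrite !big_ord_recr /= lnM ?IH // posrE ?prodr_gt0.
rewrite -(lnprod (fun q => block_max tau z N (iter (q * N) T w))); last first.
  by move=> q; exact: block_max_gt0.
rewrite ler_ln ?posrE; last 2 first.
- by rewrite mulr_gt0 ?aprod_gt0 // normc_gt0.
- by apply: prodr_gt0 => q _; exact: block_max_gt0.
apply: (@le_trans _ _ (unorm (A w) (B w) z (1, 0) (Q * N))).
  by rewrite /unorm ler_pM2l ?aprod_gt0 // lerDl normc_ge0.
apply: le_trans (unorm_blocks _ _ _ _ (A0 w)) _.
apply: ler_prod => q _; rewrite addr_ge0 ?unorm_ge0 //=; last first.
- by move=> m; exact: A0.
- by move=> m; exact: A0.
rewrite !shift_param /block_max le_max lexx //.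
Qed.

(** Cut p_(Q N) into Q blocks of N sites: by submultiplicativity and stationarity
    each of them contributes at most the expectation of one block. *)
Lemma log_potential_le_block h : 0 < h -> h <= 1 ->
  Ph h <= 2 / N%:R * expect P (fun w => ln (block_max tau (E0 +i* h) N w)).
Proof.
move=> h0 h1; have NR : 0 < N%:R :> R by rewrite ltr0n.
have hz : normc (E0 +i* h) <= `|E0| + 1.
  rewrite (_ : E0 +i* h = E0%:C + (0 +i* h)); last by simpc.
  apply: le_trans (le_normcD _ _) _; rewrite normc_real lerD2l /=.
  by rewrite expr0n add0r sqrtr_sqr gtr0_norm.
pose L w := ln (block_max tau (E0 +i* h) N w).
have iL : intg P L by exact: block_ln_intg.
have key Q : (0 < Q)%N -> expect P (root_avg (Q * N) h) <= 2 / N%:R * expect P L - 2 * ln h.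
  move=> Q0; have QNR : 0 < (Q * N)%:R :> R by rewrite ltr0n muln_gt0 Q0.
  have QR : 0 < Q%:R :> R by rewrite ltr0n.
  have iS : intg P (fun w => \sum_(q < Q) L (iter (q * N) T w)).
    by apply: (@intg_sum _ _ _ P Q (fun q w => L (iter (q * N) T w))) => q; have [] := expect_iter (q * N) iL.
  have iR := root_avg_intg (Q * N) h0.
  have : expect P (fun w => (Q * N)%:R * (root_avg (Q * N) h w + 2 * ln h)) <=
      expect P (fun w => 2 * \sum_(q < Q) L (iter (q * N) T w)).
    apply: expect_le.
    - by apply: intgZ; apply: intgD => //; exact: intg_cst.
    - exact: intgZ.
    - by move=> w; exact: root_avg_block.
  rewrite expectZ; last by apply: intgD => //; exact: intg_cst.
  rewrite expectD //; last exact: intg_cst.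
  rewrite expect_cst (expectZ 2) //.
  rewrite (@expect_sum _ _ _ P Q (fun q w => L (iter (q * N) T w))); last first.
    by move=> q; have [] := expect_iter (q * N) iL.
  under eq_bigr do rewrite (expect_iter _ iL).2.
  rewrite sumr_const card_ord -(mulr_natl (expect P L)) => H.
  rewrite lerBrDr -(ler_pM2l QNR); apply: (le_trans H).
  by rewrite le_eqVlt; apply/orP; left; apply/eqP; rewrite natrM; field; rewrite gt_eqF.
rewrite /log_potential -lerBrDr.
have cv := root_avg_cvg h0.
have cv' : expect P (root_avg (Q.+1 * N) h) @[Q --> \oo] --> expect nu (k_ h).
  apply: (@cvg_comp _ _ _ (fun Q => Q.+1 * N)%N (fun K => expect P (root_avg K h)) _ \oo) => //.
  move=> S [n _ hS]; exists n => // m /= nm; apply: hS => /=.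
  by rewrite (leq_trans nm) // (leq_trans (leqnSn m)) // leq_pmulr.
rewrite -(cvg_lim _ cv') //; apply: limr_le; first by apply/cvg_ex; eexists; exact: cv'.
by apply: nearW => Q; exact: key.
Qed.

Lemma block_lipschitz : exists2 C : R, 0 <= C & forall h, 0 < h -> h <= 1 ->
  expect P (fun w => ln (block_max tau (E0 +i* h) N w)) <=
  expect P (fun w => ln (block_max tau E0%:C N w)) + C * h.
Proof.
have [C C0 HC] := unorm_lipschitz E0 N (lt_le_trans ltr01 M1).
exists (2 * C / tau); first by rewrite divr_ge0 ?mulr_ge0 // ltW.
move=> h h0 h1.
have hz : normc (E0 +i* h) <= `|E0| + 1.
  rewrite (_ : E0 +i* h = E0%:C + (0 +i* h)); last by simpc.
  apply: le_trans (le_normcD _ _) _; rewrite normc_real lerD2l /=.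
  by rewrite expr0n add0r sqrtr_sqr gtr0_norm.
have hz0 : normc (E0%:C : R[i]) <= `|E0| + 1 by rewrite normc_real lerDl.
have i1 := block_ln_intg hz; have i2 := block_ln_intg hz0.
rewrite -[X in _ <= _ + X](expect_cst P) -expectD //; last exact: intg_cst.
apply: expect_le => //; first by apply: intgD => //; exact: intg_cst.
move=> w; have b0 := block_max_gt0 E0%:C w; have b1 := block_max_gt0 (E0 +i* h) w.
have bt : tau <= block_max tau E0%:C N w by rewrite /block_max le_max lexx orbT.
have hb : block_max tau (E0 +i* h) N w <= block_max tau E0%:C N w + 2 * C * h.
  have Ch : 0 <= 2 * C * h by rewrite !mulr_ge0 // ltW.
  rewrite {1}/block_max ge_max; apply/andP; split; last by rewrite (le_trans bt) // lerDl.
  apply: (@le_trans _ _ (unorm_tot (A w) (B w) E0%:C N + 2 * C * h)).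
    have e1 := HC _ _ h (1, 0) (A0 w) (AM w) (BM w) (ltW h0) h1.
    have e2 := HC _ _ h (0, -1) (A0 w) (AM w) (BM w) (ltW h0) h1.
    rewrite normc1 normc0 addr0 in e1; rewrite normcN normc1 normc0 add0r in e2.
    by rewrite /unorm_tot; have := e1 (lexx _); have := e2 (lexx _); lra.
  by rewrite lerD2r /block_max le_max lexx.
have hq : block_max tau (E0 +i* h) N w <= block_max tau E0%:C N w * (1 + 2 * C / tau * h).
  apply: (le_trans hb); rewrite mulrDr mulr1 lerD2l.
  have -> : 2 * C * h = tau * (2 * C / tau * h) by field; rewrite gt_eqF.
  by rewrite ler_wpM2r // !mulr_ge0 ?invr_ge0 // ltW.
have q0 : 0 <= 2 * C / tau * h by rewrite !mulr_ge0 ?invr_ge0 // ltW.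
have q1 : 0 < 1 + 2 * C / tau * h by rewrite ltr_pwDl.
apply: (@le_trans _ _ (ln (block_max tau E0%:C N w * (1 + 2 * C / tau * h)))).
  by rewrite ler_ln ?posrE // mulr_gt0.
rewrite lnM ?posrE // lerD2l; apply: le_ln1Dx.
by apply: lt_le_trans q0; rewrite ltrN10.
Qed.

End block.

Hypothesis lyap : {ae P, forall w, forall eta : R, 0 < eta ->
  \forall n \near \oo,
    n%:R^-1 * ln (op_norm (transfer_matrix (A w) (B w) E0 n)) <= eta}.

Definition entries_norm N w : R :=
  normc (pp (A w) (B w) E0%:C N) + normc (pm (A w) (B w) E0%:C N) +
  (normc (qq (A w) (B w) E0%:C N) + normc (qm (A w) (B w) E0%:C N)).

Lemma unorm_tot_entries N w : unorm_tot (A w) (B w) E0%:C N = aprod (A w) N * entries_norm N w.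
Proof. by rewrite /unorm_tot /unorm -mulrDr. Qed.

Lemma entries_norm_gt0 N w : 0 < entries_norm N w.
Proof.
have := wronskian (B w) E0%:C N (A0 w); rewrite /entries_norm.
move: (pp _ _ _ _) (pm _ _ _ _) (qq _ _ _ _) (qm _ _ _ _) => p m q r h.
have [p0|p0] := eqVneq p 0; have [m0|m0] := eqVneq m 0; last first.
- by rewrite ltr_wpDr ?addr_ge0 ?normc_ge0 // ltr_wpDr ?normc_ge0 // normc_gt0.
- by rewrite ltr_wpDr ?addr_ge0 ?normc_ge0 // ltr_wpDr ?normc_ge0 // normc_gt0.
- by rewrite ltr_wpDr ?addr_ge0 ?normc_ge0 // ltr_wpDl ?normc_ge0 // normc_gt0.
move: h; rewrite p0 m0 !mul0r subrr => /eqP; rewrite eq_sym oppr_eq0 oner_eq0.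
by [].
Qed.

Lemma entries_norm_meas N : measurable_fun setT (entries_norm N).
Proof.
apply: measurable_funD; apply: measurable_funD.
- exact: (meas_pp hT mf mg f0).
- exact: (meas_pm hT mf mg f0).
- exact: (meas_qq hT mf mg f0).
- exact: (meas_qm hT mf mg f0).
Qed.

(** The growth rate of the normalised transfer matrix at E0, cut off to [0, c] so
    that dominated convergence applies. *)
Definition excess (c : R) N w : R := Num.min (Num.max 0 (N%:R^-1 * ln (entries_norm N w))) c.

Lemma excess_bound c N w : 0 <= c -> 0 <= excess c N w <= c.
Proof. by move=> c0; rewrite /excess le_min c0 andbT le_max lexx /= ge_min lexx orbT. Qed.

Lemma excess_meas c N : measurable_fun setT (excess c N).
Proof.
apply: measurable_minr => //; apply: measurable_maxr => //.
apply: measurable_funM => //; apply: measurableT_comp; first exact: measurable_ln.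
exact: entries_norm_meas.
Qed.

(** A Lyapunov exponent that is at most 0 makes the positive part of the growth rate vanish in the limit. *)
Lemma excess_cvg c : 0 <= c -> expect P (excess c N) @[N --> \oo] --> (0 : R).
Proof.
move=> c0; apply: (@expect_dct _ _ _ _ _ c).
- exact: excess_meas.
- by move=> N w; have /andP[e0 e1] := excess_bound N w c0; rewrite ger0_norm.
apply: filterS lyap => w H.
apply/cvgr0Pnorm_le => eta eta0.
have e2 : 0 < eta / 2 by rewrite divr_gt0.
have [n1 _ h1] := H _ e2.
have l4 : 0 <= ln (4 * M) by rewrite ln_ge0 //; have m1 := M1; lra.
near=> N.
have /andP[x0 _] := excess_bound N w c0; rewrite ger0_norm // /excess.
rewrite ge_min; apply/orP; left; rewrite ge_max (ltW eta0) /=.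
have N0 : (0 < N)%N by near: N; exists 1%N.
have NR : 0 < N%:R :> R by rewrite ltr0n.
have hN : N%:R^-1 * ln (op_norm (transfer_matrix (A w) (B w) E0 N)) <= eta / 2.
  by apply: h1; near: N; exists n1.
have d0 := entries_norm_gt0 N w.
have le : entries_norm N w <= 4 * M * op_norm (transfer_matrix (A w) (B w) E0 N).
  have := unorm_tot_op_norm (B w) E0 N (A0 w) (AM w) M1.
  by rewrite unorm_tot_entries ler_pM2l ?aprod_gt0.
have M40 : 0 < 4 * M by have m1 := M1; lra.
have op0 : 0 < op_norm (transfer_matrix (A w) (B w) E0 N).
  by rewrite -(pmulr_rgt0 _ M40); exact: lt_le_trans le.
have : ln (entries_norm N w) <= ln (4 * M) + ln (op_norm (transfer_matrix (A w) (B w) E0 N)).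
  by rewrite -lnM ?posrE // ler_ln ?posrE // mulr_gt0.
move=> ll; apply: (@le_trans _ _ (N%:R^-1 * ln (4 * M) + eta / 2)).
  apply: le_trans (lerD (lexx _) hN); rewrite -mulrDr.
  by rewrite ler_pM2l ?invr_gt0.
have : N%:R^-1 * ln (4 * M) <= eta / 2.
  rewrite ler_pdivrMl // -ler_pdivrMr //.
  apply: le_trans (_ : (Num.truncn (ln (4 * M) / (eta / 2))).+1%:R <= _).
    by rewrite ltW // truncnS_gt.
  rewrite ler_nat; near: N.
  by exists (Num.truncn (ln (4 * M) / (eta / 2))).+1.
lra.
Unshelve. all: by end_near.
Qed.

Definition lnf_trunc (R0 : R) w : R := Num.max (ln (f w)) (- R0).

Lemma lnf_trunc_le R0 w : 0 <= R0 -> lnf_trunc R0 w <= ln M.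
Proof.
move=> R00; rewrite ge_max ler_ln ?posrE ?fM ?f0 //=; last exact: lt_le_trans (f0 w) (fM w).
by apply: (@le_trans _ _ 0); rewrite ?oppr_le0 // ln_ge0.
Qed.

Lemma lnf_trunc_intg R0 : 0 <= R0 -> intg P (lnf_trunc R0).
Proof.
move=> R00; have lM : 0 <= ln M by rewrite ln_ge0.
apply: (@intg_bounded _ _ _ _ _ (R0 + ln M)).
  apply: measurable_maxr => //; apply: measurableT_comp => //; exact: measurable_ln.
move=> w; have h1 := lnf_trunc_le w R00.
have h2 : - R0 <= lnf_trunc R0 w by rewrite le_max lexx orbT.
by rewrite ler_norml; apply/andP; split; lra.
Qed.

Lemma ln_aprod a n : (forall m, 0 < a m) -> ln (aprod a n) = \sum_(i < n) ln (a i.+1 : R).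
Proof.
move=> a0; elim: n => [|n IH]; first by rewrite /aprod !big_ord0 ln1.
by rewrite aprodS lnM ?posrE ?aprod_gt0 // IH big_ord_recr.
Qed.

(** With the truncation level expR (- N R0), the logarithm of a block splits into
    the contributions of the product of the a_k, each truncated at - R0, and of
    the normalised matrix. The constant ln 2 + ln growth bounds the whole
    logarithm per site, so capping the excess costs nothing. *)
Lemma block_excess R0 N w : 0 <= R0 -> (0 < N)%N ->
  N%:R^-1 * ln (block_max (expR (- (N%:R * R0))) E0%:C N w) <=
  N%:R^-1 * \sum_(i < N) lnf_trunc R0 (iter i.+1 T w) +
  excess (R0 + (ln 2 + ln growth)) N w.
Proof.
move=> R00 N0; have NR : 0 < N%:R :> R by rewrite ltr0n.
have g1 := growth_ge1.
have lg : 0 <= ln growth by rewrite ln_ge0.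
have l2 : 0 <= ln 2 :> R by rewrite ln_ge0 // ler1n.
have c0 : 0 <= R0 + (ln 2 + ln growth) by rewrite !addr_ge0.
have /andP[x0 _] := excess_bound N w c0.
have lo : - R0 <= N%:R^-1 * \sum_(i < N) lnf_trunc R0 (iter i.+1 T w).
  rewrite ler_pdivlMl //; apply: (@le_trans _ _ (\sum_(i < N) (- R0))).
    by rewrite sumr_const card_ord mulr_natl.
  by apply: ler_sum => i _; rewrite le_max lexx orbT.
rewrite /block_max; have [h|h] := leP (unorm_tot (A w) (B w) E0%:C N) (expR (- (N%:R * R0))).
  rewrite expRK mulrN mulKf ?gt_eqF //; lra.
have U0 : 0 < unorm_tot (A w) (B w) E0%:C N by rewrite unorm_tot_entries mulr_gt0 ?aprod_gt0 ?entries_norm_gt0.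
rewrite /excess addr_minr le_min; apply/andP; split.
  rewrite unorm_tot_entries lnM ?posrE ?aprod_gt0 ?entries_norm_gt0 // mulrDr; apply: lerD.
    rewrite ler_pM2l ?invr_gt0 // ln_aprod //; apply: ler_sum => i _.
    by rewrite /lnf_trunc le_max lexx.
  by rewrite le_max lexx orbT.
have hz : normc (E0%:C : R[i]) <= `|E0| + 1 by rewrite normc_real lerDl.
have : N%:R^-1 * ln (unorm_tot (A w) (B w) E0%:C N) <= ln 2 + ln growth.
  rewrite ler_pdivrMl //.
  apply: (@le_trans _ _ (ln (2 * growth ^+ N))).
    rewrite ler_ln ?posrE // ?unorm_tot_le // mulr_gt0 // exprn_gt0 //.
    exact: lt_le_trans g1.
  have gp : 0 < growth by exact: lt_le_trans g1.
  rewrite lnM ?posrE ?exprn_gt0 // lnXn // mulrDr -[X in _ + X](mulr_natl (ln growth)) lerD2r.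
  by rewrite ler_peMl // ler1n.
lra.
Qed.

Variable Kc : R.
Hypothesis hlin : forall h k, 0 < h -> Ph h - Ph (h / 2 ^+ k) <= Kc * h.

(** From height h descend to h / 2^k by the linear bound on the potential, then use
    a block of N sites at that height. First N is chosen so large that the
    excess is small, then k so large that the block may be evaluated on the real
    axis. *)
Lemma log_potential_le_lnf_trunc h R0 : 0 < h -> 0 <= R0 ->
  Ph h <= Kc * h + 2 * expect P (lnf_trunc R0).
Proof.
move=> h0 R00; apply/ler_addgt0Pr => eta eta0.
pose c4 := R0 + (ln 2 + ln growth).
have lg : 0 <= ln growth by rewrite ln_ge0 // growth_ge1.
have l2 : 0 <= ln 2 :> R by rewrite ln_ge0 // ler1n.
have c0 : 0 <= c4 by rewrite !addr_ge0.
have e4 : 0 < eta / 4 by rewrite divr_gt0.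
have [n0 _ hn] := @cvgr_lt R nat _ _ _ _ (excess_cvg c0) _ e4.
pose N := n0.+1.
have exN : expect P (excess c4 N) <= eta / 4 by apply/ltW/hn; rewrite /N /=.
have NR : 0 < N%:R :> R by rewrite ltr0n.
pose tau := expR (- (N%:R * R0)).
have tau0 : 0 < tau by exact: expR_gt0.
have tau1 : tau <= 1 by rewrite -expR0 ler_expR oppr_le0 mulr_ge0.
have [C C0 hC] := block_lipschitz N tau0 tau1.
pose x := 4 * C * h / eta + h.
pose k := Num.truncn x.
have k2 : x <= 2 ^+ k.+1.
  apply: (@le_trans _ _ k.+1%:R); first by rewrite ltW // truncnS_gt.
  by rewrite -natrX ler_nat ltnW // ltn_expl.
have x0 : 0 <= 4 * C * h / eta.
  by apply: divr_ge0; [apply: mulr_ge0; [exact: mulr_ge0|exact: ltW]|exact: ltW].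
have p2 : 0 < 2 ^+ k.+1 :> R by rewrite exprn_gt0.
pose h' := h / 2 ^+ k.+1.
have h'0 : 0 < h' by rewrite divr_gt0.
have h'1 : h' <= 1 by rewrite ler_pdivrMr // mul1r; apply: le_trans k2; rewrite lerDr.
have Ch : C * h' <= eta / 4.
  rewrite /h' mulrA ler_pdivrMr // -ler_pdivrMl ?divr_gt0 //.
  apply: le_trans k2; rewrite /x; have -> : (eta / 4)^-1 * (C * h) = 4 * C * h / eta.
    by field; rewrite gt_eqF.
  by rewrite lerDl ltW.
have s1 := hlin k.+1 h0.
have s2 := log_potential_le_block tau0 tau1 (isT : (0 < N)%N) h'0 h'1.
have s3 := hC h' h'0 h'1.
have hz0 : normc (E0%:C : R[i]) <= `|E0| + 1 by rewrite normc_real lerDl.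
have s4 : N%:R^-1 * expect P (fun w => ln (block_max tau E0%:C N w)) <=
    expect P (lnf_trunc R0) + expect P (excess c4 N).
  have it := lnf_trunc_intg R00.
  have ie : intg P (excess c4 N).
    apply: (@intg_bounded _ _ _ _ _ c4); first exact: excess_meas.
    by move=> w; have /andP[e0 e1] := excess_bound N w c0; rewrite ger0_norm.
  have iS : intg P (fun w => \sum_(i < N) lnf_trunc R0 (iter i.+1 T w)).
    by apply: (@intg_sum _ _ _ P N (fun i w => lnf_trunc R0 (iter i.+1 T w))) => i;
       have [] := expect_iter i.+1 it.
  have -> : expect P (lnf_trunc R0) = N%:R^-1 * expect P (fun w => \sum_(i < N) lnf_trunc R0 (iter i.+1 T w)).
    rewrite (@expect_sum _ _ _ P N (fun i w => lnf_trunc R0 (iter i.+1 T w))); last first.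
      by move=> i; have [] := expect_iter i.+1 it.
    under eq_bigr do rewrite (expect_iter _ it).2.
    by rewrite sumr_const card_ord -[in RHS](mulr_natl (expect P _)) mulKf // gt_eqF.
  have ib := block_ln_intg N tau0 tau1 hz0.
  rewrite -expectZ // -(expectZ _ iS) -expectD //; last exact: intgZ.
  apply: expect_le; [exact: intgZ|by apply: intgD => //; exact: intgZ|].
  by move=> w; exact: block_excess.
have s5 : 2 / N%:R * expect P (fun w => ln (block_max tau (E0 +i* h') N w)) <=
    2 * (N%:R^-1 * expect P (fun w => ln (block_max tau E0%:C N w))) + 2 * (eta / 4).
  apply: (@le_trans _ _ (2 / N%:R * (expect P (fun w => ln (block_max tau E0%:C N w)) + C * h'))).
    by rewrite ler_pM2l // divr_gt0.
  rewrite mulrDr mulrA lerD2l -mulrA ler_pM2l // ler_pdivrMl //.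
  apply: (le_trans Ch); rewrite ler_peMl ?(ltW e4) // ler1n //.
rewrite -/h' in s1; lra.
Qed.

(** Letting the truncation level tend to infinity (monotone convergence) in
    [log_potential_le_lnf_trunc]. As the potential is finite at a fixed height,
    the limit of the truncated expectations is finite, so that ln f is
    integrable. *)
Lemma log_intg : intg P (fun w => ln (f w)) /\
  forall h, 0 < h -> Ph h <= Kc * h + 2 * expect P (fun w => ln (f w)).
Proof.
have lM : 0 <= ln M by rewrite ln_ge0.
have lle w : ln (f w) <= ln M by rewrite ler_ln ?posrE //; exact: lt_le_trans (f0 w) (fM w).
have mln : measurable_fun setT (fun w => ln (f w)).
  by apply: measurableT_comp => //; exact: measurable_ln.
(* Increasing in n and nonnegative, with limit ln M - ln f. *)
pose gn n w := (ln M - lnf_trunc n%:R w)%:E.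
have gm n : measurable_fun setT (gn n).
  apply/measurable_EFinP; apply: measurable_funB => //; exact: intg_meas (lnf_trunc_intg (ler0n R n)).
have g0 n w : setT w -> (0 <= gn n w)%E.
  by move=> _; rewrite lee_fin subr_ge0 lnf_trunc_le.
have gnd w : setT w -> {homo gn ^~ w : n m / (n <= m)%N >-> (n <= m)%E}.
  move=> _ n m nm; rewrite lee_fin lerD2l lerN2 /lnf_trunc ge_max !le_max lexx /=.
  by rewrite lerN2 ler_nat nm orbT.
have gint n : (\int[P]_w gn n w)%E = (ln M - expect P (lnf_trunc n%:R))%:E.
  have it := lnf_trunc_intg (ler0n R n).
  have i2 : intg P (fun w => ln M + (-1) * lnf_trunc n%:R w).
    by apply: intgD; [exact: intg_cst|exact: intgZ].
  have e : expect P (fun w => ln M + (-1) * lnf_trunc n%:R w) = ln M - expect P (lnf_trunc n%:R).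
    rewrite expectD ?expect_cst ?expectZ ?mulN1r //; [exact: intg_cst|exact: intgZ].
  rewrite -e /expect /Rintegral fineK; last by apply: integrable_fin_num.
  by apply: eq_integral => w _; rewrite /gn mulN1r.
have lim w : limn (gn ^~ w) = (ln M - ln (f w))%:E.
  apply: lim_near_cst => //; exists (Num.truncn `|ln (f w)|).+1 => // n /= hn.
  rewrite /gn /lnf_trunc max_l // lerNl.
  apply: le_trans (_ : `|ln (f w)| <= _); first by rewrite -normrN ler_norm.
  apply: le_trans (_ : (Num.truncn `|ln (f w)|).+1%:R <= _).
    by rewrite ltW // truncnS_gt.
  by rewrite ler_nat.
have mono := @cvg_monotone_convergence _ _ _ P setT measurableT gn gm g0 gnd.
have bnd h : 0 < h -> (\int[P]_w (ln M - ln (f w))%:E <= (ln M - (Ph h - Kc * h) / 2)%:E)%E.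
  move=> h0; rewrite (_ : (\int[P]_w _)%E = (\int[P]_w limn (gn ^~ w))%E); last first.
    by apply: eq_integral => w _; rewrite lim.
  rewrite -(cvg_lim _ mono) //; apply: lime_le; first by apply/cvg_ex; eexists; exact: mono.
  apply: nearW => n; rewrite gint lee_fin.
  by have := log_potential_le_lnf_trunc h0 (ler0n R n); lra.
have il : intg P (fun w => ln M - ln (f w)).
  apply/integrableP; split.
    by apply/measurable_EFinP; apply: measurable_funB.
  apply: le_lt_trans (le_trans _ (bnd 1 ltr01)) (ltry _).
  rewrite le_eqVlt; apply/orP; left; apply/eqP.
  by apply: eq_integral => w _; rewrite /= ger0_norm // subr_ge0.
have il' : intg P (fun w => ln (f w)).
  have : intg P (fun w => ln M + (-1) * (ln M - ln (f w))).
    by apply: intgD; [exact: intg_cst|exact: intgZ].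
  by congr intg; apply/funext => w; ring.
split => // h h0.
have e : expect P (fun w => ln M - ln (f w)) = ln M - expect P (fun w => ln (f w)).
  have -> : (fun w => ln M - ln (f w)) = fun w => ln M + (-1) * ln (f w).
    by apply/funext => w; rewrite mulN1r.
  rewrite expectD ?expect_cst ?expectZ ?mulN1r //; [exact: intg_cst|exact: intgZ].
have := bnd h h0.
have fi : (\int[P]_w (ln M - ln (f w))%:E)%E \is a fin_num by exact: integrable_fin_num.
rewrite -(fineK fi) lee_fin -[fine _]/(expect P (fun w => ln M - ln (f w))) e; lra.
Qed.

Definition bad_set (G : R) (n : nat) : set Omega :=
  [set w | bad_block M E0 G n (A w) (B w)].

Lemma bad_meas G n : measurable (bad_set G n).
Proof.
have mM := measurable_funM (meas_qm hT mf mg f0 (scaled_pt E0 n 0) n)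
  (meas_pp hT mf mg f0 (scaled_pt E0 n 0) n).
have := mM measurableT `]block_const M G, +oo[%classic (measurable_itv _).
rewrite setTI; congr measurable; apply/seteqP; split => w /=; rewrite in_itv /= andbT //.
Qed.

Lemma bad_avg G n K w : 0 < G -> (0 < n)%N -> 2 * G <= n%:R ->
  G * \sum_(j < K) (`[< bad_set G n (iter j.+2 T w) >] : nat)%:R <=
  5 * n%:R * (- 2 * \sum_(i < K + n.+2) ln (f (iter i.+1 T w)) +
    (K + n.+3)%:R * (root_avg (K + n.+3) n%:R^-1 w + 2 * ln n%:R^-1) + 2 * ln n%:R).
Proof.
move=> G0 n0 Gn; have nR : 0 < n%:R :> R by rewrite ltr0n.
have iR : 0 < n%:R^-1 :> R by rewrite invr_gt0.
have := @sum_bad_le R (A w) (B w) M E0 G n (A0 w) (AM w) n0 G0 Gn K.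
under eq_bigr do rewrite !shift_param.
move/le_trans; apply; rewrite ler_pM2l ?mulr_gt0 //.
have := @log_loss_sum_le R (A w) (B w) E0 n (A0 w) n0 (K + n.+2).
move/le_trans; apply; rewrite lerD2r -addnS root_log_sum // lerD2l.
rewrite /root_avg mulrDr mulVKf ?gt_eqF ?ltr0n ?addnS //.
Qed.

(** Take expectations in [bad_avg], divide by K and let K tend to infinity. The
    right-hand side becomes 5 n times the excess of the potential at height 1/n
    over 2 E[ln f], which is at most Kc / n. *)
Lemma bad_prob G n : 0 < G -> (0 < n)%N -> 2 * G <= n%:R ->
  fine (P (bad_set G n)) <= 5 * Kc / G.
Proof.
move=> G0 n0 Gn; have nR : 0 < n%:R :> R by rewrite ltr0n.
have iR : 0 < n%:R^-1 :> R by rewrite invr_gt0.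
have [il hPh] := log_intg.
set e := expect P (fun w => ln (f w)) in hPh.
have [pE pI] := expect_indic P (bad_meas G n).
set p := fine _ in pE *.
rewrite ler_pdivlMr // mulrC; apply/ler_addgt0Pr => eta eta0.
set h : R := n%:R^-1 in iR.
(* The error dl enters with the factor 5 n. *)
pose dl := eta / (10 * n%:R).
have d0 : 0 < dl by rewrite divr_gt0 // mulr_gt0.
have lt : expect nu (k_ h) < expect nu (k_ h) + dl by rewrite ltrDl.
have [m0 _ hm] := @cvgr_lt R nat _ _ _ _ (root_avg_cvg iR) _ lt.
have key K : (m0 <= K)%N ->
   G * (K%:R * p) <= 5 * n%:R * (- 2 * ((K + n.+2)%:R * e) +
     (K + n.+3)%:R * (Ph h + dl) + 2 * ln n%:R).
  move=> mK.
  have iB : intg P (fun w => \sum_(j < K) (`[< bad_set G n (iter j.+2 T w) >] : nat)%:R).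
    by apply: (@intg_sum _ _ _ P K (fun j w => (`[< bad_set G n (iter j.+2 T w) >] : nat)%:R)) => j;
      have [] := expect_iter j.+2 pI.
  have iL : intg P (fun w => \sum_(i < K + n.+2) ln (f (iter i.+1 T w))).
    by apply: (@intg_sum _ _ _ P (K + n.+2) (fun i w => ln (f (iter i.+1 T w)))) => i;
      have [] := expect_iter i.+1 il.
  have iA := root_avg_intg (K + n.+3) iR.
  have iA' : intg P (fun w => root_avg (K + n.+3) h w + 2 * ln h).
    by apply: intgD => //; exact: intg_cst.
  have eB : expect P (fun w => \sum_(j < K) (`[< bad_set G n (iter j.+2 T w) >] : nat)%:R) = K%:R * p.
    rewrite (@expect_sum _ _ _ P K (fun j w => (`[< bad_set G n (iter j.+2 T w) >] : nat)%:R)); last first.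
      by move=> j; have [] := expect_iter j.+2 pI.
    under eq_bigr do rewrite (expect_iter _ pI).2 pE.
    by rewrite sumr_const card_ord mulr_natl.
  have eL : expect P (fun w => \sum_(i < K + n.+2) ln (f (iter i.+1 T w))) = (K + n.+2)%:R * e.
    rewrite (@expect_sum _ _ _ P (K + n.+2) (fun i w => ln (f (iter i.+1 T w)))); last first.
      by move=> i; have [] := expect_iter i.+1 il.
    under eq_bigr do rewrite (expect_iter _ il).2.
    by rewrite sumr_const card_ord mulr_natl.
  have iS : intg P (fun w => - 2 * \sum_(i < K + n.+2) ln (f (iter i.+1 T w)) +
    (K + n.+3)%:R * (root_avg (K + n.+3) h w + 2 * ln h)).
    by apply: intgD; exact: intgZ.
  have iS' : intg P (fun w => - 2 * \sum_(i < K + n.+2) ln (f (iter i.+1 T w)) +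
    (K + n.+3)%:R * (root_avg (K + n.+3) h w + 2 * ln h) + 2 * ln n%:R).
    by apply: intgD => //; exact: intg_cst.
  have := expect_le (intgZ G iB) (intgZ (5 * n%:R) iS') (fun w => bad_avg K w G0 n0 Gn).
  rewrite (expectZ G iB) eB (expectZ (5 * n%:R) iS') (expectD iS (intg_cst _ _)) expect_cst.
  rewrite (expectD (intgZ _ iL) (intgZ _ iA')) (expectZ (-2) iL) eL (expectZ _ iA').
  rewrite (expectD iA (intg_cst _ _)) expect_cst => H; apply: (le_trans H).
  rewrite ler_pM2l ?mulr_gt0 // lerD2r lerD2l ler_pM2l ?ltr0n ?addnS //.
  rewrite /log_potential addrAC lerD2r; apply/ltW; apply: hm => /=.
  by apply: (leq_trans mK); rewrite -?addnS leq_addr.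
have hP := hPh h iR.
pose c := 5 * n%:R * (- 2 * (n.+2%:R * e) + n.+3%:R * (Ph h + dl) + 2 * ln n%:R).
have main K : (m0 <= K)%N -> K%:R * (G * p - (5 * Kc + eta / 2)) <= c.
  move=> /key; rewrite !natrD => H.
  have hd : 5 * n%:R * dl = eta / 2 by rewrite /dl; field; rewrite gt_eqF.
  have hKc : 5 * n%:R * (Kc * h) = 5 * Kc by rewrite /h; field; rewrite gt_eqF.
  have K0 : 0 <= K%:R :> R by [].
  have k1 : K%:R * (5 * n%:R * (Ph h - 2 * e)) <= K%:R * (5 * Kc).
    rewrite ler_wpM2l // -hKc ler_pM2l ?mulr_gt0 //; lra.
  have e1 : 5 * n%:R * (- 2 * ((K%:R + n.+2%:R) * e) + (K%:R + n.+3%:R) * (Ph h + dl) +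
      2 * ln n%:R) = K%:R * (5 * n%:R * (Ph h - 2 * e)) + K%:R * (5 * n%:R * dl) + c.
    by rewrite /c; ring.
  move: H; rewrite e1 hd => H.
  have -> : K%:R * (G * p - (5 * Kc + eta / 2)) =
     G * (K%:R * p) - K%:R * (5 * Kc) - K%:R * (eta / 2) by ring.
  lra.
rewrite leNgt; apply/negP => hlt.
have pos : eta / 2 < G * p - (5 * Kc + eta / 2) by lra.
pose K := maxn m0 (Num.truncn (`|c| / (eta / 2))).+1.
have hK : `|c| / (eta / 2) < K%:R.
  apply: lt_le_trans (truncnS_gt _) _; rewrite ler_nat /K leq_max leqnn orbT //.
have := main K (leq_maxl _ _).
rewrite ltr_pdivrMr ?divr_gt0 // in hK.
have K0 : 0 < K%:R :> R by rewrite ltr0n /K (leq_trans _ (leq_maxr _ _)).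
have : K%:R * (eta / 2) < K%:R * (G * p - (5 * Kc + eta / 2)) by rewrite ltr_pM2l.
have := ler_norm c; lra.
Qed.

End Thouless.

(** * Rigidity against Poisson behavior *)

(** At most one of the events holds. *)
Lemma disjoint_indic_sum (R : realType) (I : finType) (Pd : pred I) (E : I -> Prop) (D : R) :
  0 <= D -> (forall i, Pd i -> E i -> 1 <= D) ->
  (forall i j, E i -> E j -> i = j) ->
  \sum_(i | Pd i) ((`[< E i >] : nat)%:R : R) <= D.
Proof.
move=> D0 D1 dis; have [[i0 pi0 ei0]|no] := pselect (exists2 i, Pd i & E i).
  rewrite (bigD1 i0) //= big1 ?addr0.
    by case: asboolP => // _; exact: D1 ei0.
  move=> i /andP[_ ii0]; case: asboolP => // ei.
  by rewrite (dis _ _ ei ei0) eqxx in ii0.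
rewrite big1 // => i pi; case: asboolP => // ei.
by exfalso; apply: no; exists i.
Qed.

Section ExpectBig.
Context d (Omega : measurableType d) (R : realType) (P : probability Omega R).

Lemma expect_big (I : Type) (s : seq I) (Pd : pred I) (X : I -> Omega -> R) :
  (forall i, intg P (X i)) ->
  intg P (fun w => \sum_(i <- s | Pd i) X i w) /\
  expect P (fun w => \sum_(i <- s | Pd i) X i w) = \sum_(i <- s | Pd i) expect P (X i).
Proof.
move=> iX; elim: s => [|i s [IH1 IH2]].
  rewrite big_nil (_ : (fun w => _) = fun=> 0); last by apply/funext => w; rewrite big_nil.
  by split; [exact: intg_cst|exact: expect_cst].
rewrite big_cons; case: ifP => pi.
  rewrite (_ : (fun w => _) = fun w => X i w + \sum_(i <- s | Pd i) X i w).
    by split; [exact: intgD|rewrite expectD // IH2].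
  by apply/funext => w; rewrite big_cons pi.
rewrite (_ : (fun w => _) = fun w => \sum_(i <- s | Pd i) X i w) //.
by apply/funext => w; rewrite big_cons pi.
Qed.

End ExpectBig.

Section Final.
Context d (Omega : measurableType d) (R : realType) (P : probability Omega R).
Variables (T : Omega -> Omega) (f g : Omega -> R).
Hypothesis hT : measure_preserving P T.
Hypotheses (mf : measurable_fun setT f) (mg : measurable_fun setT g).
Hypothesis f0 : forall w, 0 < f w.
Variable (E0 : R).

Local Notation A w := (jacobi_param f T w).
Local Notation B w := (jacobi_param g T w).

Let A0 w m : 0 < A w m. Proof. exact: f0. Qed.

Definition count_event (l : nat) (al be : 'I_l -> R) (k : 'I_l -> nat) (n : nat) :=
  [set w | forall m : 'I_l, num_zeros (erg_orthopoly T f g w n)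
     `[E0 + al m / n%:R, E0 + be m / n%:R]%classic = k m].

Lemma count_event_meas l al be k n : (0 < n)%N -> (forall m, al m < be m) ->
  measurable (@count_event l al be k n).
Proof.
move=> n0 ab; have nR : 0 < n%:R :> R by rewrite ltr0n.
rewrite (_ : count_event _ _ _ _ = \bigcap_(m in [set: 'I_l])
  [set w | num_zeros (orthopoly (A w) (B w) n)
     `[E0 + al m / n%:R, E0 + be m / n%:R]%classic = k m]); last first.
  by apply/seteqP; split => w /= h m; [move=> _; exact: h|exact: h].
apply: fin_bigcap_measurable; first exact: finite_finset.
move=> m _; apply: (num_zeros_meas hT mf mg f0).
by rewrite ltrD2l ltr_pM2r // invr_gt0.
Qed.

Definition point_event (s : R) (n : nat) :=
  [set w | root (orthopoly (A w) (B w) n) (E0 + s / n%:R)].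

Lemma point_event_meas s n : measurable (point_event s n).
Proof. exact: (root_meas hT mf mg f0). Qed.

Variable lam : R.
Hypothesis lam0 : 0 < lam.
Hypothesis poisson : forall (l : nat) (alpha beta : 'I_l -> R) (k : 'I_l -> nat),
    (1 <= l)%N ->
    (forall m, alpha m < beta m) ->
    (forall m m' : 'I_l, m' = m.+1 :> nat -> beta m <= alpha m') ->
    P (count_event alpha beta k n)
      @[n --> \oo] -->
    (\prod_(m < l) ((lam * (beta m - alpha m)) ^+ k m / (k m)`!%:R
                    * expR (- (lam * (beta m - alpha m)))))%:E.

(** A zero at E0 + s/n is incompatible with an empty interval starting there, and
    short intervals are empty with probability close to 1. *)
Lemma point_event_cvg s : fine (P (point_event s n)) @[n --> \oo] --> (0 : R).
Proof.
apply/cvgr0Pnorm_le => e e0.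
pose eta := e / (2 * lam).
have eta0 : 0 < eta by rewrite divr_gt0 // mulr_gt0.
have := @poisson 1 (fun=> s) (fun=> s + eta) (fun=> 0%N) isT _ _.
rewrite big_ord1 expr0 fact0 divr1 mul1r addrAC subrr add0r.
move=> /(_ (fun=> _) _)/fine_cvg cv.
have {cv}cv : fine (P (@count_event 1 (fun=> s) (fun=> s + eta) (fun=> 0%N) n))
    @[n --> \oo] --> expR (- (lam * eta)).
  apply: cv; first by rewrite ltrDl.
  by move=> m m' e1; have := ltn_ord m'; rewrite e1.
have low : 1 - e < expR (- (lam * eta)).
  apply: lt_le_trans (expR_ge1Dx _).
  have -> : lam * eta = e / 2 by rewrite /eta; field; rewrite gt_eqF.
  lra.
have [n1 _ h1] := @cvgr_gt R nat _ _ _ _ cv _ low.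
exists n1.+1 => // n /= nn.
have n0 : (0 < n)%N by exact: leq_trans nn.
have hn : 1 - e < fine (P (@count_event 1 (fun=> s) (fun=> s + eta) (fun=> 0%N) n)).
  by apply: h1 => /=; exact: ltnW.
have mp := point_event_meas s n.
have mc : measurable (@count_event 1 (fun=> s) (fun=> s + eta) (fun=> 0%N) n).
  by apply: count_event_meas => // _; rewrite ltrDl.
have [p1 i1] := expect_indic P mp; have [p2 i2] := expect_indic P mc.
rewrite ger0_norm ?fine_ge0 ?measure_ge0 //.
have : expect P (fun w => (`[< point_event s n w >] : nat)%:R +
   (`[< @count_event 1 (fun=> s) (fun=> s + eta) (fun=> 0%N) n w >] : nat)%:R)
   <= expect P (fun=> 1).
  apply: expect_le; [exact: intgD|exact: intg_cst|move=> w].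
  case: asboolP => [pw|_]; case: asboolP => [cw|_]; rewrite ?addr0 ?add0r //.
  exfalso; have := cw ord0; rewrite /erg_orthopoly num_zerosE // => /eqP.
  apply/negP; rewrite -lt0n -has_count; apply/hasP.
  exists (E0 + s / n%:R); first by rewrite mem_roots_of.
  by rewrite lexx /= lerD2l ler_pM2r ?invr_gt0 ?ltr0n // lerDl ltW.
rewrite expect_cst expectD // p1 p2; lra.
Qed.

Variable M : R.
Hypothesis M1 : 1 <= M.
Variable Kc : R.
Hypothesis Kc0 : 0 <= Kc.
Hypothesis bad_le : forall G n, 0 < G -> (0 < n)%N -> 2 * G <= n%:R ->
  fine (P (bad_set T f g M E0 G n)) <= 5 * Kc / G.

(** Let C be the bound violated with probability at most 2^-32 by [bad_prob], and
    choose the window for this C. Off the bad event, and if no cell endpoint is a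
    zero, the counts in the cells satisfy the lower bound of [counts_ge]; so in the
    limit the Poisson law lets this bound fail with probability at most 2^-32,
    against 2^-30 from [poisson_cells]. *)
Lemma poisson_contradiction : False.
Proof.
(* Makes the bound 5 Kc / G of the hypothesis at most 2^-32. *)
pose G : R := 5 * Kc * 2 ^+ 32 + 1.
have p32 : 0 < 2 ^+ 32 :> R by rewrite exprn_gt0.
have G0 : 0 < G.
  by apply: ltr_wpDl => //; apply: mulr_ge0; [exact: mulr_ge0|exact: ltW].
pose C := block_const M G.
have M0 : 0 <= M by exact: le_trans ler01 M1.
have MG : 0 <= M * (2 * G) by rewrite !mulr_ge0 // ltW.
have C0 : 0 <= C.
  by apply: mulr_ge0; [apply: mulr_ge0 => //; exact: expR_ge0|exact: addr_ge0].
have [x [r [x2 xr [K hK]]]] := poisson_cells lam0 C0.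
have r0 : (1 <= r + r)%N by rewrite addn_gt0 (leq_trans _ xr) // (leq_trans _ x2).
pose al (m : 'I_(r + r)) : R := m%:R - r%:R.
pose be (m : 'I_(r + r)) : R := m%:R + 1 - r%:R.
have ab m : al m < be m by rewrite /al /be; lra.
have adj (m m' : 'I_(r + r)) : m' = m.+1 :> nat -> be m <= al m'.
  by move=> e; rewrite /al /be e -natr1.
pose ev n (k : {ffun 'I_(r + r) -> 'I_K}) := count_event al be (fun m => k m) n.
pose Pd (k : {ffun 'I_(r + r) -> 'I_K}) :=
  \sum_(m < r + r) cell_sup x (cell_index r m) * (k m : nat)%:R
        < - ln ((x%:R ^+ 2 + 2) ^+ 2 * (2 * C + 1)).
have cvk k : fine (P (ev n k)) @[n --> \oo] --> \prod_(m < r + r) pois lam (k m).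
  have := @poisson _ al be (fun m => k m) r0 ab adj.
  move/fine_cvg; congr (_ --> _); apply: eq_bigr => m _.
  by rewrite /pois /al /be (_ : _ - _ = 1) ?mulr1 //; ring.
have cvsum : \sum_(k | Pd k) fine (P (ev n k)) @[n --> \oo] -->
    \sum_(k | Pd k) \prod_(m < r + r) pois lam (k m).
  by apply: cvg_big => [|k _]; [exact: add_continuous|exact: cvk].
pose pe (j : 'I_(r + r).+1) n := point_event (j%:R - r%:R) n.
have cvp : \sum_(j < (r + r).+1) fine (P (pe j n)) @[n --> \oo] --> (0 : R).
  rewrite [X in _ --> X](_ : 0 = \sum_(j < (r + r).+1) (0 : R)); last by rewrite big1.
  by apply: cvg_big => [|j _]; [exact: add_continuous|exact: point_event_cvg].
have cvp' : 2^-1 ^+ 32 + \sum_(j < (r + r).+1) fine (P (pe j n)) @[n --> \oo] -->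
    (2^-1 ^+ 32 + 0 : R).
  by apply: cvgD => //; exact: cvg_cst.
have le : \sum_(k | Pd k) \prod_(m < r + r) pois lam (k m) <= 2^-1 ^+ 32 + 0.
  apply: (ler_cvg_to cvsum cvp').
  exists (Num.truncn (2 * G)).+1 => // n /= hn.
  have n0 : (0 < n)%N by exact: leq_trans hn.
  have Gn : 2 * G <= n%:R.
    apply: ltW; apply: lt_le_trans (truncnS_gt _) _; by rewrite ler_nat.
  have pb : fine (P (bad_set T f g M E0 G n)) <= 2^-1 ^+ 32.
    apply: le_trans (bad_le G0 n0 Gn) _.
    rewrite ler_pdivrMr // exprVn -ler_pdivrMl ?invr_gt0 // invrK mulrC.
    by rewrite /G lerDl.
  have mb : measurable (bad_set T f g M E0 G n) by exact: (bad_meas hT mf mg f0).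
  have [e1 i1] := expect_indic P mb.
  have mk k : measurable (ev n k) by exact: count_event_meas.
  have mp j : measurable (pe j n) by exact: (point_event_meas _ n).
  have ik k := (expect_indic P (mk k)).2; have ek k := (expect_indic P (mk k)).1.
  have ip j := (expect_indic P (mp j)).2; have ep j := (expect_indic P (mp j)).1.
  under eq_bigr do rewrite -ek.
  rewrite (eq_bigr _ (fun j _ => esym (ep j))).
  have [ib1 <-] := expect_big (index_enum _) Pd ik.
  have [ib2 <-] := expect_big (index_enum _) predT ip.
  apply: le_trans (_ : expect P (fun w => (`[< bad_set T f g M E0 G n w >] : nat)%:R +
     \sum_(j < (r + r).+1) (`[< pe j n w >] : nat)%:R) <= _); last first.
    by rewrite expectD // e1 lerD2r.
  apply: expect_le => //; first exact: intgD.
  move=> w; apply: disjoint_indic_sum.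
  - by rewrite addr_ge0 // sumr_ge0.
  - move=> k pk ekw.
    have [hb|hb] := pselect (bad_set T f g M E0 G n w).
      by rewrite (asboolT hb) lerDl sumr_ge0.
    have [[j hj]|nj] := pselect (exists j, pe j n w).
      rewrite (bigD1 j) //= (asboolT hj) addrCA lerDl addr_ge0 // sumr_ge0 //.
    exfalso; move: pk; rewrite /Pd; apply/negP; rewrite -leNgt.
    have hC : normc (qm (A w) (B w) (scaled_pt E0 n 0) n) *
        normc (pp (A w) (B w) (scaled_pt E0 n 0) n) <= C.
      by rewrite leNgt; apply/negP => h; apply: hb.
    have ne j : (j <= r + r)%N -> ~~ root (orthopoly (A w) (B w) n) (E0 + (j%:R - r%:R) / n%:R).
      move=> jr; apply/negP => h; apply: nj.
      by exists (Ordinal (jr : (j < (r + r).+1)%N)).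
    apply: le_trans (counts_ge (A0 w) n0 C0 x2 xr ne hC) _.
    by apply: ler_sum => m _; rewrite -(ekw m).
  - move=> k k' h h'; apply/ffunP => m; apply: val_inj.
    by rewrite /= -(h m) -(h' m).
have : 2^-1 ^+ 30 < 2^-1 ^+ 32 + 0 :> R by exact: lt_le_trans hK le.
rewrite addr0 (exprD _ 30 2); have : 0 < 2^-1 ^+ 30 :> R by rewrite exprn_gt0.
have -> : 2^-1 ^+ 2 = 1 / 4 :> R by field.
lra.
Qed.

End Final.

Theorem corollary4p2 (R : realType) (d : measure_display)
    (Omega : measurableType d) (P : probability Omega R)
    (T : Omega -> Omega) (f g : Omega -> R)
    (nu : probability (measurableTypeR R) R) (E0 : R) (gammaE0 : \bar R)
    (hJ : ergodic_jacobi P T f g)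
    (hnu : is_density_of_states P T f g nu)
    (hgamma : is_lyapunov_exponent P T f g E0 gammaE0)
    (hderiv : exists D : R, is_symmetric_derivative nu E0 D)
    (hpoisson : poisson_behavior P T f g E0) :
  (0 < gammaE0)%E.
Proof.
rewrite ltNge; apply/negP => gamma_le0.
have [[hT _] mf mg f0 [[Mf [_ bf]] [Mg [_ bg]]]] := hJ.
pose M := 1 + `|Mf| + `|Mg| + 1.
have nf := ler_norm Mf; have ng := ler_norm Mg.
have af := normr_ge0 Mf; have ag := normr_ge0 Mg.
have M1 : 1 <= M by rewrite /M; lra.
have Mf_lt : Mf < M by rewrite /M; lra.
have Mg_lt : Mg < M by rewrite /M; lra.
have fM w : f w <= M by apply: le_trans (ler_norm _) _; exact: (bf _ Mf_lt w I).
have gM w : `|g w| <= M by exact: (bg _ Mg_lt w I).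
have lyap : {ae P, forall w, forall eta : R, 0 < eta ->
  \forall n \near \oo, n%:R^-1 *
    ln (op_norm (transfer_matrix (jacobi_param f T w) (jacobi_param g T w) E0 n)) <= eta}.
  apply: filterS hgamma => w hw eta eta0.
  have lt : (gammaE0 < eta%:E)%E by rewrite (le_lt_trans gamma_le0) // lte_fin.
  have op : nbhs gammaE0 [set y | (y < eta%:E)%E].
    by apply: open_nbhs_nbhs; split => //; exact: open_ereal_lt_ereal.
  have [n0 _ h] := hw _ op; exists n0 => // n nn.
  by have := h n nn; rewrite /= lte_fin => /ltW.
have [D hD] := hderiv.
have [Kc Kc0 hlin] := log_potential_linear (cap_ge1 M E0) hD.
have [lam lam0 hp] := hpoisson.
have bl := bad_prob hT mf mg f0 M1 fM gM hnu lyap hlin.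
exact: (poisson_contradiction hT mf mg f0 lam0 hp M1 Kc0 bl).
Qed.
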